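(* Let $\mathcal{U}$ be a (not necessarily finite) semisimple ribbon category, and let $\{\mathsf{U}_i\}_{i\in I}$ be a set of distinct (pairwise non-isomorphic) simple objects of $\mathcal{U}$, with $0\in I$ and $\mathsf{U}_0=\mathbf{1}_{\mathcal{U}}$. Let $\mathcal{V}$ be a ribbon category (not necessarily semisimple). Let $$\mathsf{A}=\bigoplus_{i\in I}\mathsf{U}_i\boxtimes\mathsf{V}_i$$ be a simple commutative associative unital algebra in $\mathcal{C}=\mathcal{U}\boxtimes\mathcal{V}$ (in $\mathcal{C}_\oplus$ if $I$ is infinite), where the $\mathsf{V}_i$ are objects of $\mathcal{V}$, not assumed to be simple except for $\mathsf{V}_0=\mathbf{1}_{\mathcal{V}}$. Assume $$\dim\mathrm{Hom}_{\mathcal{U}}(\mathsf{U}_0,\mathsf{U}_i)=\delta_{i,0}=\dim\mathrm{Hom}_{\mathcal{V}}(\mathsf{V}_0,\mathsf{V}_i)\qquad(i\in I),$$ and that there is a partition $I=I^0\sqcup I^1$ with $0\in I^0$ such that $\theta_{\mathsf{A}}|_{\mathsf{U}_i\boxtimes\mathsf{V}_i}=(-1)^j\,\mathrm{Id}_{\mathsf{U}_i\boxtimes\mathsf{V}_i}$ for each $i\in I^j$, $j=0,1$. Let $\mathcal{U}_{\mathsf{A}}\subseteq\mathcal{U}$ and $\mathcal{V}_{\mathsf{A}}\subseteq\mathcal{V}$ be the full subcategories whose objects are isomorphic to direct sums of the $\mathsf{U}_i$ and of the $\mathsf{V}_i$, respectively. Then: (1) The categories $\mathcal{U}_{\mathsf{A}}\subseteq\mathcal{U}$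 and $\mathcal{V}_{\mathsf{A}}\subseteq\mathcal{V}$ are ribbon subcategories. Moreover, $\mathcal{V}_{\mathsf{A}}$ is semisimple with distinct simple objects $\{\mathsf{V}_i\}_{i\in I}$. (2) There is a braid-reversed tensor equivalence $\tau:\mathcal{U}_{\mathsf{A}}\to\mathcal{V}_{\mathsf{A}}$ such that $\tau(\mathsf{U}_i)\cong\mathsf{V}_i^*$ for all $i\in I$.
   Context: All categories are linear over a fixed field $\mathbb{F}$ (one may take $\mathbb F=\mathbb C$). A tensor category is an abelian monoidal category with bilinear $\otimes$, right exact in each variable, unit $\mathbf 1$, unit isomorphisms $l,r$ and associativity isomorphisms $\mathcal A_{\mathsf X,\mathsf Y,\mathsf Z}:\mathsf X\otimes(\mathsf Y\otimes\mathsf Z)\to(\mathsf X\otimes\mathsf Y)\otimes\mathsf Z$; braided means with a braiding $\mathcal R$. A ribbon category is a rigid braided tensor category with a twist: a natural isomorphism $\theta:\mathrm{Id}\to\mathrm{Id}$ with $\theta_{\mathbf 1}=\mathrm{Id}$, $\theta_{\mathsf X^*}=(\theta_{\mathsf X})^*$ and $\theta_{\mathsf X\otimes\mathsf Y}=\mathcal R_{\mathsf Y,\mathsf X}\circ\mathcal R_{\mathsf X,\mathsf Y}\circ(\theta_{\mathsf X}\otimes\theta_{\mathsf Y})$. A ribbon subcategory is a full subcategory containing the unit and closed under tensor products and duals. Semisimple means every object is a finite direct sum of simple objects. The Deligne product $\mathcal U\boxtimes\mathcal V$ carries the componentwise braided tensor structure and twist. The direct sum completion $\mathcal C_\oplus$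 has objects $\bigoplus_{s\in S}\mathsf X_s$ ($S$ any set, $\mathsf X_s$ in $\mathcal C$), and morphisms $\bigoplus_s\mathsf X_s\to\bigoplus_t\mathsf Y_t$ are families $(f_{s,t}:\mathsf X_s\to\mathsf Y_t)$ with, for each $s$, $f_{s,t}=0$ for all but finitely many $t$; braided tensor structure and twist extend componentwise. A commutative associative unital algebra $(\mathsf A,\mu,\iota)$ has $\mu:\mathsf A\otimes\mathsf A\to\mathsf A$ and $\iota:\mathbf 1\to\mathsf A$ with $\mu(\mathrm{Id}\otimes\mu)=\mu(\mu\otimes\mathrm{Id})\mathcal A_{\mathsf A,\mathsf A,\mathsf A}$, $\mu(\iota\otimes\mathrm{Id})=l_{\mathsf A}$, $\mu(\mathrm{Id}\otimes\iota)=r_{\mathsf A}$, $\mu\mathcal R_{\mathsf A,\mathsf A}=\mu$. It is called simple if it is simple as a left $\mathsf A$-module. A braid-reversed tensor equivalence $\tau:\mathcal D\to\mathcal E$ is a tensor equivalence which is a braided equivalence $\mathcal D\to\mathcal E^{\mathrm{rev}}$, where $\mathcal E^{\mathrm{rev}}$ is $\mathcal E$ with braiding $\mathcal R^{\mathrm{rev}}_{\mathsf X,\mathsf Y}=\mathcal R_{\mathsf Y,\mathsf X}^{-1}$.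
   Formalization: Every V_i is assumed nonzero (if some V_i = 0 the hypotheses can still hold, but V_i is then not simple, so claim (1) fails); for finite I the algebra A and its simplicity are likewise taken in the completion C_⊕. *)

(* Defs.v *)
From HB Require Import structures.
From mathcomp Require Import all_boot all_algebra.
From mathcomp Require Import boolp classical_sets functions cardinality fsbigop.

Set Implicit Arguments.
Unset Strict Implicit.
Unset Printing Implicit Defensive.

Import GRing.Theory.

Declare Scope cat_scope.
Delimit Scope cat_scope with cat.
Local Open Scope ring_scope.
Local Open Scope cat_scope.

(** * Linear categories *)

Record category (F : fieldType) := Category {
  ob :> Type;
  mor : ob -> ob -> lmodType F;
  idm : forall x, mor x x;
  compm : forall x y z, mor y z -> mor x y -> mor x z;
  compmA : forall w x y z (h : mor y z) (g : mor x y) (f : mor w x),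
    compm h (compm g f) = compm (compm h g) f;
  comp1m : forall x y (f : mor x y), compm (idm y) f = f;
  compm1 : forall x y (f : mor x y), compm f (idm x) = f;
  compm_linl : forall x y z (f : mor x y) a (g g' : mor y z),
    compm (a *: g + g') f = a *: compm g f + compm g' f;
  compm_linr : forall x y z (g : mor y z) a (f f' : mor x y),
    compm g (a *: f + f') = a *: compm g f + compm g f' }.

Arguments mor {F c}.
Arguments idm {F c}.
Arguments compm {F c x y z}.

Notation "g ∘ f" := (compm g f) (at level 40, left associativity) : cat_scope.

(** ** Morphisms and objects of a category *)

Definition inverses F (C : category F) (x y : C) (f : mor x y) (g : mor y x) :=
  g ∘ f = idm x /\ f ∘ g = idm y.

Definition is_iso F (C : category F) (x y : C) (f : mor x y) :=
  exists g, inverses f g.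

Definition isomorphic F (C : category F) (x y : C) :=
  exists f : mor x y, is_iso f.

Definition is_mono F (C : category F) (x y : C) (f : mor x y) :=
  forall w (g h : mor w x), f ∘ g = f ∘ h -> g = h.

Definition is_epi F (C : category F) (x y : C) (f : mor x y) :=
  forall z (g h : mor y z), g ∘ f = h ∘ f -> g = h.

Definition is_kernel F (C : category F) (w x y : C) (k : mor w x)
    (f : mor x y) :=
  f ∘ k = 0 /\
  forall v (g : mor v x), f ∘ g = 0 -> exists! h : mor v w, k ∘ h = g.

Definition is_cokernel F (C : category F) (x y z : C) (c : mor y z)
    (f : mor x y) :=
  c ∘ f = 0 /\
  forall v (g : mor y v), g ∘ f = 0 -> exists! h : mor z v, h ∘ c = g.

(* [s] is a direct sum of the finite family [x]; for [n = 0] this says that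
   [s] is a zero object. *)
Definition is_dsum F (C : category F) n (x : 'I_n -> C) (s : C) :=
  exists (inj : forall k, mor (x k) s) (prj : forall k, mor s (x k)),
    [/\ forall k, prj k ∘ inj k = idm (x k),
        forall k l, k != l -> prj l ∘ inj k = 0
      & \sum_k (inj k ∘ prj k) = idm s].

Definition simple F (C : category F) (x : C) :=
  idm x <> 0 /\
  forall y (f : mor y x), is_mono f -> f = 0 \/ is_iso f.

Record abelian F (C : category F) : Prop := Abelian {
  abelian_dsum : forall n (x : 'I_n -> C), exists s, is_dsum x s;
  abelian_ker : forall (x y : C) (f : mor x y),
    exists w (k : mor w x), is_kernel k f;
  abelian_coker : forall (x y : C) (f : mor x y),
    exists z (c : mor y z), is_cokernel c f;
  abelian_mono : forall (x y : C) (f : mor x y), is_mono f ->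
    exists z (g : mor y z), is_kernel f g;
  abelian_epi : forall (x y : C) (f : mor x y), is_epi f ->
    exists w (g : mor w x), is_cokernel f g }.

Definition semisimple F (C : category F) :=
  forall x : C, exists n (c : 'I_n -> C),
    (forall k, simple (c k)) /\ is_dsum c x.

Definition has_dim (F : fieldType) (M : lmodType F) (n : nat) :=
  exists b : 'I_n -> M,
    forall v, exists! a : 'rV[F]_n, v = \sum_k a 0 k *: b k.

(** ** Elementary consequences of bilinearity *)

Lemma comp0m F (C : category F) (x y z : C) (f : mor x y) :
  (0 : mor y z) ∘ f = 0.
Proof.
have /esym/eqP := compm_linl f 1 (0 : mor y z) 0.
by rewrite !scale1r addr0 -subr_eq0 addrK => /eqP.
Qed.

Lemma compm0 F (C : category F) (x y z : C) (g : mor y z) :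
  g ∘ (0 : mor x y) = 0.
Proof.
have /esym/eqP := compm_linr g 1 (0 : mor x y) 0.
by rewrite !scale1r addr0 -subr_eq0 addrK => /eqP.
Qed.

Lemma compm_suml F (C : category F) (x y z : C) (f : mor x y) (I : Type)
    (r : seq I) (g : I -> mor y z) :
  (\sum_(i <- r) g i) ∘ f = \sum_(i <- r) (g i ∘ f).
Proof.
elim: r => [|i r IH]; first by rewrite !big_nil comp0m.
by rewrite !big_cons -[g i]scale1r compm_linl IH !scale1r.
Qed.

Lemma compm_sumr F (C : category F) (x y z : C) (g : mor y z) (I : Type)
    (r : seq I) (f : I -> mor x y) :
  g ∘ (\sum_(i <- r) f i) = \sum_(i <- r) (g ∘ f i).
Proof.
elim: r => [|i r IH]; first by rewrite !big_nil compm0.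
by rewrite !big_cons -[f i]scale1r compm_linr IH !scale1r.
Qed.

(** * Linear functors and bilinear bifunctors *)

Record functor F (C D : category F) := Functor {
  fob :> C -> D;
  fmap : forall x y : C, mor x y -> mor (fob x) (fob y);
  fmap1 : forall x, fmap (idm x) = idm (fob x);
  fmapM : forall x y z (g : mor y z) (f : mor x y),
    fmap (g ∘ f) = fmap g ∘ fmap f;
  fmap_lin : forall x y a (f f' : mor x y),
    fmap (a *: f + f') = a *: fmap f + fmap f' }.

Arguments fmap {F C D} _ {x y}.

Program Definition idF F (C : category F) : functor C C :=
  {| fob := fun x => x; fmap := fun _ _ f => f |}.

Program Definition compF F (C D E : category F) (G : functor D E)
    (H : functor C D) : functor C E :=
  {| fob := fun x => G (H x); fmap := fun _ _ f => fmap G (fmap H f) |}.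
Next Obligation. by move=> *; rewrite !fmap1. Qed.
Next Obligation. by move=> *; rewrite !fmapM. Qed.
Next Obligation. by move=> *; rewrite !fmap_lin. Qed.

Definition natural F (C D : category F) (G H : functor C D)
    (t : forall x, mor (G x) (H x)) :=
  forall x y (f : mor x y), t y ∘ fmap G f = fmap H f ∘ t x.

Definition nat_isomorphic F (C D : category F) (G H : functor C D) :=
  exists t : forall x, mor (G x) (H x), natural t /\ forall x, is_iso (t x).

Definition equivalence F (C D : category F) (G : functor C D) :=
  exists H : functor D C,
    nat_isomorphic (compF H G) (idF C) /\ nat_isomorphic (compF G H) (idF D).

(* Preservation of all right exact sequences x -> y -> z -> 0. *)
Definition right_exact F (C D : category F) (G : functor C D) :=
  forall (x y z : C) (f : mor x y) (c : mor y z),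
    is_cokernel c f -> is_cokernel (fmap G c) (fmap G f).

Record bifunctor F (C D E : category F) := Bifunctor {
  bob :> C -> D -> E;
  bmap : forall (x x' : C) (y y' : D),
    mor x x' -> mor y y' -> mor (bob x y) (bob x' y');
  bmap1 : forall x y, bmap (idm x) (idm y) = idm (bob x y);
  bmapM : forall x x' x'' y y' y'' (f' : mor x' x'') (f : mor x x')
      (g' : mor y' y'') (g : mor y y'),
    bmap (f' ∘ f) (g' ∘ g) = bmap f' g' ∘ bmap f g;
  bmap_linl : forall x x' y y' a (f f' : mor x x') (g : mor y y'),
    bmap (a *: f + f') g = a *: bmap f g + bmap f' g;
  bmap_linr : forall x x' y y' a (f : mor x x') (g g' : mor y y'),
    bmap f (a *: g + g') = a *: bmap f g + bmap f g' }.

Arguments bmap {F C D E} _ {x x' y y'}.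

Lemma bmap0l F (C D E : category F) (B : bifunctor C D E) x x' y y'
    (g : mor y y') : bmap B (0 : mor x x') g = 0.
Proof.
have /esym/eqP := bmap_linl B 1 (0 : mor x x') 0 g.
by rewrite !scale1r addr0 -subr_eq0 addrK => /eqP.
Qed.

Lemma bmap0r F (C D E : category F) (B : bifunctor C D E) x x' y y'
    (f : mor x x') : bmap B f (0 : mor y y') = 0.
Proof.
have /esym/eqP := bmap_linr B 1 f (0 : mor y y') 0.
by rewrite !scale1r addr0 -subr_eq0 addrK => /eqP.
Qed.

Lemma bmap_suml F (C D E : category F) (B : bifunctor C D E) x x' y y'
    (I : Type) (r : seq I) (f : I -> mor x x') (g : mor y y') :
  bmap B (\sum_(i <- r) f i) g = \sum_(i <- r) bmap B (f i) g.
Proof.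
elim: r => [|i r IH]; first by rewrite !big_nil bmap0l.
by rewrite !big_cons -[f i]scale1r bmap_linl IH !scale1r.
Qed.

Lemma bmap_sumr F (C D E : category F) (B : bifunctor C D E) x x' y y'
    (I : Type) (r : seq I) (f : mor x x') (g : I -> mor y y') :
  bmap B f (\sum_(i <- r) g i) = \sum_(i <- r) bmap B f (g i).
Proof.
elim: r => [|i r IH]; first by rewrite !big_nil bmap0r.
by rewrite !big_cons -[g i]scale1r bmap_linr IH !scale1r.
Qed.

Definition birex F (C D E : category F) (B : bifunctor C D E) :=
  (forall (u : D) (x y z : C) (f : mor x y) (c : mor y z),
     is_cokernel c f -> is_cokernel (bmap B c (idm u)) (bmap B f (idm u))) /\
  (forall (u : C) (x y z : D) (f : mor x y) (c : mor y z),
     is_cokernel c f -> is_cokernel (bmap B (idm u) c) (bmap B (idm u) f)).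

(** * Braided, balanced and ribbon structures

   The records carry the data; the laws are the predicates that follow. The
   inverses of the structure isomorphisms are part of the data. *)

Record braided F := Braided {
  brcat :> category F;
  tens : bifunctor brcat brcat brcat;
  unit_ob : brcat;
  lun : forall x, mor (tens unit_ob x) x;
  lunV : forall x, mor x (tens unit_ob x);
  run : forall x, mor (tens x unit_ob) x;
  runV : forall x, mor x (tens x unit_ob);
  assoc : forall x y z, mor (tens x (tens y z)) (tens (tens x y) z);
  assocV : forall x y z, mor (tens (tens x y) z) (tens x (tens y z));
  braid : forall x y, mor (tens x y) (tens y x);
  braidV : forall x y, mor (tens y x) (tens x y) }.

Arguments tens {F b}.
Arguments unit_ob {F b}.
Arguments lun {F b}.
Arguments lunV {F b}.
Arguments run {F b}.
Arguments runV {F b}.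
Arguments assoc {F b}.
Arguments assocV {F b}.
Arguments braid {F b}.
Arguments braidV {F b}.

Notation "x ⊗ y" := (bob tens x y)
  (at level 35, right associativity) : cat_scope.
Notation "f ⊗m g" := (bmap tens f g)
  (at level 35, right associativity) : cat_scope.

Record balanced F := Balanced {
  blbr :> braided F;
  twist : forall x : blbr, mor x x }.

Arguments twist {F b}.

Record ribbon F := Ribbon {
  rbbl :> balanced F;
  dual : rbbl -> rbbl;
  ev : forall x, mor (dual x ⊗ x) unit_ob;
  coev : forall x, mor unit_ob (x ⊗ dual x) }.

Arguments dual {F r}.
Arguments ev {F r}.
Arguments coev {F r}.

Record braided_tensor_category F (T : braided F) : Prop := BraidedTensor {
  bt_abelian : abelian T;
  bt_rex : birex (@tens F T);
  bt_lunK : forall x : T, inverses (lun x) (lunV x);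
  bt_runK : forall x : T, inverses (run x) (runV x);
  bt_assK : forall x y z : T, inverses (assoc x y z) (assocV x y z);
  bt_brdK : forall x y : T, inverses (braid x y) (braidV x y);
  bt_lun_nat : forall (x y : T) (f : mor x y),
    lun y ∘ (idm unit_ob ⊗m f) = f ∘ lun x;
  bt_run_nat : forall (x y : T) (f : mor x y),
    run y ∘ (f ⊗m idm unit_ob) = f ∘ run x;
  bt_ass_nat : forall (x x' y y' z z' : T)
      (f : mor x x') (g : mor y y') (h : mor z z'),
    assoc x' y' z' ∘ (f ⊗m (g ⊗m h))
    = ((f ⊗m g) ⊗m h) ∘ assoc x y z;
  bt_brd_nat : forall (x x' y y' : T) (f : mor x x') (g : mor y y'),
    braid x' y' ∘ (f ⊗m g) = (g ⊗m f) ∘ braid x y;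
  bt_triangle : forall x y : T,
    (run x ⊗m idm y) ∘ assoc x unit_ob y = idm x ⊗m lun y;
  bt_pentagon : forall w x y z : T,
    assoc (w ⊗ x) y z ∘ assoc w x (y ⊗ z)
    = (assoc w x y ⊗m idm z) ∘ assoc w (x ⊗ y) z
      ∘ (idm w ⊗m assoc x y z);
  bt_hexagon1 : forall x y z : T,
    assoc z x y ∘ braid (x ⊗ y) z ∘ assoc x y z
    = (braid x z ⊗m idm y) ∘ assoc x z y ∘ (idm x ⊗m braid y z);
  bt_hexagon2 : forall x y z : T,
    assocV y z x ∘ braid x (y ⊗ z) ∘ assocV x y z
    = (idm y ⊗m braid x z) ∘ assocV y x z ∘ (braid x y ⊗m idm z) }.

Record balanced_tensor_category F (T : balanced F) : Prop := BalancedTensor {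
  bl_braided : braided_tensor_category T;
  bl_twist_iso : forall x : T, is_iso (twist x);
  bl_twist_nat : forall (x y : T) (f : mor x y),
    twist y ∘ f = f ∘ twist x;
  bl_twist1 : twist (unit_ob : T) = idm unit_ob;
  bl_twistM : forall x y : T,
    twist (x ⊗ y) = braid y x ∘ braid x y ∘ (twist x ⊗m twist y) }.

Definition dual_mor F (T : ribbon F) (x y : T) (f : mor x y) :
    mor (dual y) (dual x) :=
  lun (dual x) ∘ (ev y ⊗m idm (dual x)) ∘ assoc (dual y) y (dual x)
  ∘ (idm (dual y) ⊗m ((f ⊗m idm (dual x)) ∘ coev x)) ∘ runV (dual y).

(* Rigidity is expressed with left duals; in a braided category these are
   also right duals. *)
Record ribbon_category F (T : ribbon F) : Prop := RibbonCategory {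
  rb_balanced : balanced_tensor_category T;
  rb_zigzag : forall x : T,
    run x ∘ (idm x ⊗m ev x) ∘ assocV x (dual x) x
    ∘ (coev x ⊗m idm x) ∘ lunV x
    = idm x;
  rb_zagzig : forall x : T,
    lun (dual x) ∘ (ev x ⊗m idm (dual x)) ∘ assoc (dual x) x (dual x)
    ∘ (idm (dual x) ⊗m coev x) ∘ runV (dual x)
    = idm (dual x);
  rb_twist_dual : forall x : T, twist (dual x) = dual_mor (twist x) }.

(* The same tensor category with braiding R^rev_(x,y) = (R_(y,x))^-1. *)
Definition rev_braided F (T : braided F) : braided F :=
  {| brcat := T; tens := tens; unit_ob := unit_ob;
     lun := lun; lunV := lunV; run := run; runV := runV;
     assoc := assoc; assocV := assocV;
     braid := fun x y => braidV y x; braidV := fun x y => braid y x |}.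

(** ** Braided tensor functors *)

Record braided_functor F (S T : braided F) (G : functor S T)
    (J : forall x y, mor (G x ⊗ G y) (G (x ⊗ y)))
    (e : mor unit_ob (G unit_ob)) : Prop := BraidedFunctor {
  bf_J_iso : forall x y, is_iso (J x y);
  bf_e_iso : is_iso e;
  bf_J_nat : forall x x' y y' (f : mor x x') (g : mor y y'),
    J x' y' ∘ (fmap G f ⊗m fmap G g) = fmap G (f ⊗m g) ∘ J x y;
  bf_ass : forall x y z,
    fmap G (assoc x y z) ∘ J x (y ⊗ z) ∘ (idm (G x) ⊗m J y z)
    = J (x ⊗ y) z ∘ (J x y ⊗m idm (G z)) ∘ assoc (G x) (G y) (G z);
  bf_lun : forall x,
    fmap G (lun x) ∘ J unit_ob x ∘ (e ⊗m idm (G x)) = lun (G x);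
  bf_run : forall x,
    fmap G (run x) ∘ J x unit_ob ∘ (idm (G x) ⊗m e) = run (G x);
  bf_brd : forall x y,
    fmap G (braid x y) ∘ J x y = J y x ∘ braid (G x) (G y) }.

Definition braided_equivalence F (S T : braided F) (G : functor S T) :=
  equivalence G /\ exists J e, @braided_functor F S T G J e.

(* A functor [S -> T] is the same thing as a functor [S -> rev_braided T]. *)
Definition braid_reversed_equivalence F (S T : braided F) (G : functor S T) :=
  @braided_equivalence F S (rev_braided T) G.

(** ** Full subcategories *)

Section FullSubcategory.
Variable F : fieldType.

Program Definition full_subcat (C : category F) (P : C -> Prop) : category F :=
  {| ob := {x : C | P x};
     mor := fun x y => mor (sval x) (sval y);
     idm := fun x => idm (sval x);
     compm := fun _ _ _ g f => g ∘ f |}.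
Next Obligation. by move=> *; exact: compmA. Qed.
Next Obligation. by move=> *; exact: comp1m. Qed.
Next Obligation. by move=> *; exact: compm1. Qed.
Next Obligation. by move=> *; exact: compm_linl. Qed.
Next Obligation. by move=> *; exact: compm_linr. Qed.

(* Fullness is built into [full_subcat]. *)
Record ribbon_subcategory (T : ribbon F) (P : T -> Prop) : Prop :=
    RibbonSubcategory {
  sub_one : P unit_ob;
  sub_tens : forall x y, P x -> P y -> P (x ⊗ y);
  sub_dual : forall x, P x -> P (dual x) }.

Program Definition sub_tensor (T : ribbon F) (P : T -> Prop)
    (hP : ribbon_subcategory P) :
    bifunctor (full_subcat P) (full_subcat P) (full_subcat P) :=
  @Bifunctor F (full_subcat P) (full_subcat P) (full_subcat P)
    (fun x y => exist P (sval x ⊗ sval y)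
                  (sub_tens hP (svalP x) (svalP y)))
    (fun x x' y y' f g => f ⊗m g) _ _ _ _.
Next Obligation. by move=> *; exact: bmap1. Qed.
Next Obligation. by move=> *; exact: bmapM. Qed.
Next Obligation. by move=> *; exact: bmap_linl. Qed.
Next Obligation. by move=> *; exact: bmap_linr. Qed.

Definition sub_braided (T : ribbon F) (P : T -> Prop)
    (hP : ribbon_subcategory P) : braided F :=
  @Braided F (full_subcat P) (sub_tensor hP) (exist P unit_ob (sub_one hP))
    (fun x => lun (sval x)) (fun x => lunV (sval x))
    (fun x => run (sval x)) (fun x => runV (sval x))
    (fun x y z => assoc (sval x) (sval y) (sval z))
    (fun x y z => assocV (sval x) (sval y) (sval z))
    (fun x y => braid (sval x) (sval y))
    (fun x y => braidV (sval x) (sval y)).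

End FullSubcategory.

(* The objects isomorphic to finite direct sums of members of the family. *)
Definition sums_of F (C : category F) (I : Type) (X : I -> C) (x : C) :=
  exists n (c : 'I_n -> I), is_dsum (fun k => X (c k)) x.

(** * Deligne products *)

(* Composition with [B] is an equivalence from the right exact functors
   [C -> E] to the bilinear bifunctors [U x V -> E] that are right exact in
   each variable: [dl_ext] is essential surjectivity and [dl_nat] is full
   faithfulness. *)
Record deligne_universal F (U V C : category F) (B : bifunctor U V C) :
    Prop := DeligneUniversal {
  dl_birex : birex B;
  dl_ext : forall (E : category F), abelian E ->
    forall G : bifunctor U V E, birex G ->
    exists H : functor C E, right_exact H /\
    exists t : forall x y, mor (H (B x y)) (G x y),
      (forall x y, is_iso (t x y)) /\
      (forall x x' y y' (f : mor x x') (g : mor y y'),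
         t x' y' ∘ fmap H (bmap B f g) = bmap G f g ∘ t x y);
  dl_nat : forall (E : category F), abelian E ->
    forall H K : functor C E, right_exact H -> right_exact K ->
    forall t : (forall x y, mor (H (B x y)) (K (B x y))),
      (forall x x' y y' (f : mor x x') (g : mor y y'),
         t x' y' ∘ fmap H (bmap B f g) = fmap K (bmap B f g) ∘ t x y) ->
    exists s : forall z, mor (H z) (K z),
      [/\ natural s, forall x y, s (B x y) = t x y
        & forall s' : (forall z, mor (H z) (K z)), natural s' ->
            (forall x y, s' (B x y) = t x y) -> forall z, s' z = s z] }.

(* The braided tensor structure and the twist of [C] are componentwise on the
   objects [x ⊠ y], up to the coherent isomorphisms [m] and [e]. *)
Record componentwise F (U V C : balanced F) (B : bifunctor U V C)
    (m : forall x x' y y', mor (B x y ⊗ B x' y') (B (x ⊗ x') (y ⊗ y')))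
    (e : mor unit_ob (B unit_ob unit_ob)) : Prop := Componentwise {
  cw_m_iso : forall x x' y y', is_iso (m x x' y y');
  cw_e_iso : is_iso e;
  cw_m_nat : forall x1 x1' x2 x2' y1 y1' y2 y2'
      (f1 : mor x1 x1') (f2 : mor x2 x2') (g1 : mor y1 y1') (g2 : mor y2 y2'),
    m x1' x2' y1' y2' ∘ (bmap B f1 g1 ⊗m bmap B f2 g2)
    = bmap B (f1 ⊗m f2) (g1 ⊗m g2) ∘ m x1 x2 y1 y2;
  cw_ass : forall x x' x'' y y' y'',
    bmap B (assoc x x' x'') (assoc y y' y'') ∘ m x (x' ⊗ x'') y (y' ⊗ y'')
      ∘ (idm (B x y) ⊗m m x' x'' y' y'')
    = m (x ⊗ x') x'' (y ⊗ y') y'' ∘ (m x x' y y' ⊗m idm (B x'' y''))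
      ∘ assoc (B x y) (B x' y') (B x'' y'');
  cw_lun : forall x y,
    bmap B (lun x) (lun y) ∘ m unit_ob x unit_ob y ∘ (e ⊗m idm (B x y))
    = lun (B x y);
  cw_run : forall x y,
    bmap B (run x) (run y) ∘ m x unit_ob y unit_ob ∘ (idm (B x y) ⊗m e)
    = run (B x y);
  cw_brd : forall x x' y y',
    bmap B (braid x x') (braid y y') ∘ m x x' y y'
    = m x' x y' y ∘ braid (B x y) (B x' y');
  cw_twist : forall x y, twist (B x y) = bmap B (twist x) (twist y) }.

Record deligne_product F (U V C : balanced F) (B : bifunctor U V C) : Prop :=
    DeligneProduct {
  dp_tensor : balanced_tensor_category C;
  dp_universal : deligne_universal B;
  dp_componentwise : exists m e, @componentwise F U V C B m e }.

(** * Direct sum completion *)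

#[local] Obligation Tactic := idtac.

Section DirectSumCategory.
Variables (F : fieldType) (C : category F).

(* Classically every set underlies a choiceType. *)
Record dsob := DSum { dsidx : choiceType; dsfam : dsidx -> C }.

#[global] Arguments dsfam : clear implicits.

Record dshom (X Y : dsob) := DSHom {
  dsmx :> forall s t, mor (dsfam X s) (dsfam Y t);
  dsfin : forall s, finite_set [set t | dsmx s t != 0] }.

HB.instance Definition _ X Y := gen_eqMixin (dshom X Y).
HB.instance Definition _ X Y := gen_choiceMixin (dshom X Y).

Lemma dshomP X Y (f g : dshom X Y) : (forall s t, f s t = g s t) -> f = g.
Proof.
case: f g => [f hf] [g hg] /= fg.
have {}fg : f = g.
  by apply: functional_extensionality_dep => s;
     apply: functional_extensionality_dep => t; exact: fg.
by rewrite fg in hf *; congr DSHom; exact: Prop_irrelevance.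
Qed.

Program Definition ds0 X Y : dshom X Y := {| dsmx := fun _ _ => 0 |}.
Next Obligation.
by move=> X Y s; apply: (sub_finite_set _ (finite_set0 _)) => t /=;
   rewrite eqxx.
Qed.

Program Definition dsopp X Y (f : dshom X Y) : dshom X Y :=
  {| dsmx := fun s t => - f s t |}.
Next Obligation.
by move=> X Y f s; apply: (sub_finite_set _ (dsfin f s)) => t /=;
   rewrite oppr_eq0.
Qed.

Program Definition dslin X Y a (f g : dshom X Y) : dshom X Y :=
  {| dsmx := fun s t => a *: f s t + g s t |}.
Next Obligation.
move=> X Y a f g s.
apply: (@sub_finite_set _ _
  ([set t | f s t != 0] `|` [set t | g s t != 0])%classic).
  move=> t /=; case: (eqVneq (f s t) 0) => [->|]; last by left.
  by rewrite scaler0 add0r; right.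
by rewrite finite_setU; split; exact: dsfin.
Qed.

Definition dsadd X Y (f g : dshom X Y) := dslin 1 f g.
Definition dsscale X Y a (f : dshom X Y) := dslin a f (ds0 X Y).

Lemma dsaddE X Y (f g : dshom X Y) s t : dsadd f g s t = f s t + g s t.
Proof. by rewrite /= scale1r. Qed.
Lemma dsscaleE X Y a (f : dshom X Y) s t : dsscale a f s t = a *: f s t.
Proof. by rewrite /= addr0. Qed.

Lemma dsaddA X Y : associative (@dsadd X Y).
Proof. by move=> f g h; apply: dshomP => s t; rewrite !dsaddE addrA. Qed.
Lemma dsaddC X Y : commutative (@dsadd X Y).
Proof. by move=> f g; apply: dshomP => s t; rewrite !dsaddE addrC. Qed.
Lemma dsadd0 X Y : left_id (ds0 X Y) (@dsadd X Y).
Proof. by move=> f; apply: dshomP => s t; rewrite dsaddE add0r. Qed.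
Lemma dsaddN X Y : left_inverse (ds0 X Y) (@dsopp X Y) (@dsadd X Y).
Proof. by move=> f; apply: dshomP => s t; rewrite dsaddE addNr. Qed.

HB.instance Definition _ X Y := GRing.isZmodule.Build (dshom X Y)
  (@dsaddA X Y) (@dsaddC X Y) (@dsadd0 X Y) (@dsaddN X Y).

Lemma dsscaleA X Y a b (f : dshom X Y) :
  dsscale a (dsscale b f) = dsscale (a * b) f.
Proof. by apply: dshomP => s t; rewrite !dsscaleE scalerA. Qed.
Lemma dsscale1 X Y : left_id 1 (@dsscale X Y).
Proof. by move=> f; apply: dshomP => s t; rewrite dsscaleE scale1r. Qed.
Lemma dsscaleDr X Y : right_distributive (@dsscale X Y) +%R.
Proof.
by move=> a f g; apply: dshomP => s t; rewrite !(dsscaleE, dsaddE) scalerDr.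
Qed.
Lemma dsscaleDl X Y (f : dshom X Y) :
  {morph (@dsscale X Y)^~ f : a b / a + b}.
Proof.
by move=> a b; apply: dshomP => s t; rewrite !(dsscaleE, dsaddE) scalerDl.
Qed.

HB.instance Definition _ X Y := GRing.Zmodule_isLmodule.Build F (dshom X Y)
  (@dsscaleA X Y) (@dsscale1 X Y) (@dsscaleDr X Y) (@dsscaleDl X Y).

Lemma dslinE X Y a (f g : dshom X Y) s t :
  (a *: f + g) s t = a *: f s t + g s t.
Proof. by rewrite dsaddE dsscaleE. Qed.

Definition dscomp_mx X Y Z (g : dshom Y Z) (f : dshom X Y)
    (s : dsidx X) (u : dsidx Z) : mor (dsfam X s) (dsfam Z u) :=
  \sum_(t \in [set: dsidx Y]) (g t u ∘ f s t).

Lemma dssupp X Y (f : dshom X Y) (l : seq (dsidx X)) :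
  exists2 r : seq (dsidx Y), uniq r &
    forall s t, s \in l -> t \notin r -> f s t = 0.
Proof.
elim: l => [|s l [r ur rP]]; first by exists [::].
have [r' r'E] := (finite_seqP _).1 (dsfin f s).
exists (undup (r' ++ r)); first exact: undup_uniq.
move=> s' t; rewrite mem_undup mem_cat negb_or inE.
move=> /orP[/eqP ->|s'l] /andP[tr' tr]; last exact: rP.
apply/eqP; apply: contraNT tr' => fst.
by have : [set` r']%classic t by rewrite -r'E.
Qed.

Lemma dscompE X Y Z (g : dshom Y Z) (f : dshom X Y) s u
    (r : seq (dsidx Y)) : uniq r -> (forall t, t \notin r -> f s t = 0) ->
  dscomp_mx g f s u = \sum_(t <- r) (g t u ∘ f s t).
Proof.
move=> ur rP; rewrite /dscomp_mx.
have -> : [set: dsidx Y]%classic = [set` @predT (dsidx Y)]%classic.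
  by apply/seteqP; split.
by rewrite -(@bigfs _ _ _ _ r) // => t _ /rP ->; rewrite compm0.
Qed.

Program Definition dscomp X Y Z (g : dshom Y Z) (f : dshom X Y) : dshom X Z :=
  {| dsmx := dscomp_mx g f |}.
Next Obligation.
move=> X Y Z g f s; have [r ur rP] := dssupp f [:: s].
have [r' _ r'P] := dssupp g r.
apply: (sub_finite_set _ (finite_seq r')) => u /=.
rewrite (@dscompE _ _ _ g f s u r) //; last first.
  by move=> t; apply: rP; rewrite inE.
apply: contraNT => ur'; rewrite big_seq big1 // => t tr.
by rewrite (r'P t) // comp0m.
Qed.

Lemma dscomp_mxE X Y Z (g : dshom Y Z) (f : dshom X Y) s u :
  dscomp g f s u = dscomp_mx g f s u.
Proof. by []. Qed.

(* The morphism whose component from [s] to [e s] is [p s], and whose other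
   components are zero. *)
Definition dsdiag_mx X Y (e : dsidx X -> dsidx Y)
    (p : forall s, mor (dsfam X s) (dsfam Y (e s))) s t :
    mor (dsfam X s) (dsfam Y t) :=
  match e s =P t with
  | ReflectT q => ecast t (mor (dsfam X s) (dsfam Y t)) q (p s)
  | ReflectF _ => 0
  end.

Lemma dsdiagE X Y (e : dsidx X -> dsidx Y) p s :
  @dsdiag_mx X Y e p s (e s) = p s.
Proof.
by rewrite /dsdiag_mx; case: eqP => // q; rewrite (eq_irrelevance q erefl).
Qed.

Lemma dsdiag0 X Y (e : dsidx X -> dsidx Y) p s t :
  e s != t -> @dsdiag_mx X Y e p s t = 0.
Proof. by rewrite /dsdiag_mx; case: eqP. Qed.

Program Definition dsdiag X Y (e : dsidx X -> dsidx Y)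
    (p : forall s, mor (dsfam X s) (dsfam Y (e s))) : dshom X Y :=
  {| dsmx := dsdiag_mx p |}.
Next Obligation.
move=> X Y e p s; apply: (sub_finite_set _ (finite_set1 (e s))) => t /=.
by apply: contra_neqP => /eqP ets; apply: dsdiag0; rewrite eq_sym.
Qed.

Definition ds1 X : dshom X X :=
  @dsdiag X X id (fun s => idm (dsfam X s)).

Lemma dscompA W X Y Z (h : dshom Y Z) (g : dshom X Y) (f : dshom W X) :
  dscomp h (dscomp g f) = dscomp (dscomp h g) f.
Proof.
apply: dshomP => s v /=.
have [r ur rP] := dssupp f [:: s]; have [r' ur' r'P] := dssupp g r.
have fP t : t \notin r -> f s t = 0 by apply: rP; rewrite inE.
rewrite (@dscompE _ _ _ h _ s v r') //=; last first.
  move=> u ur'u; rewrite (@dscompE _ _ _ g f s u r) // big_seq big1 // => t tr.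
  by rewrite (r'P t) // comp0m.
rewrite (@dscompE _ _ _ _ f s v r) //=.
under eq_bigr => u _ do rewrite (@dscompE _ _ _ g f s u r) // compm_sumr.
rewrite exchange_big /= big_seq [RHS]big_seq; apply: eq_bigr => t tr.
rewrite (@dscompE _ _ _ h g t v r') // ?compm_suml.
  by apply: eq_bigr => u _; rewrite compmA.
by move=> u; apply: r'P.
Qed.

Lemma dscomp1m X Y (f : dshom X Y) : dscomp (ds1 Y) f = f.
Proof.
apply: dshomP => s u /=; have [r _ rP] := dssupp f [:: s].
rewrite (@dscompE _ _ _ _ f s u (undup (u :: r))) ?undup_uniq //; last first.
  move=> t; rewrite mem_undup inE negb_or => /andP[_]; apply: rP.
  by rewrite inE.
rewrite (bigD1_seq u) ?undup_uniq ?mem_undup ?mem_head //=.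
rewrite (@dsdiagE Y Y id) comp1m big1 ?addr0 // => t tu.
by rewrite (@dsdiag0 Y Y id) // comp0m.
Qed.

Lemma dscompm1 X Y (f : dshom X Y) : dscomp f (ds1 X) = f.
Proof.
apply: dshomP => s u /=.
rewrite (@dscompE _ _ _ f _ s u [:: s]) ?big_seq1 //=.
  by rewrite (@dsdiagE X X id) compm1.
by move=> t; rewrite inE eq_sym => st; rewrite (@dsdiag0 X X id).
Qed.

Lemma dscomp_linl X Y Z (f : dshom X Y) a (g g' : dshom Y Z) :
  dscomp (a *: g + g') f = a *: dscomp g f + dscomp g' f.
Proof.
apply: dshomP => s u; rewrite dslinE !dscomp_mxE.
have [r ur rP] := dssupp f [:: s].
have fP t : t \notin r -> f s t = 0 by apply: rP; rewrite inE.
rewrite !(@dscompE _ _ _ _ f s u r) // scaler_sumr -big_split.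
by apply: eq_bigr => t _; rewrite dslinE compm_linl.
Qed.

Lemma dscomp_linr X Y Z (g : dshom Y Z) a (f f' : dshom X Y) :
  dscomp g (a *: f + f') = a *: dscomp g f + dscomp g f'.
Proof.
apply: dshomP => s u; rewrite dslinE !dscomp_mxE.
have [r _ rP] := dssupp f [:: s]; have [r' _ r'P] := dssupp f' [:: s].
pose l := undup (r ++ r').
have fP t : t \notin l -> f s t = 0.
  by rewrite mem_undup mem_cat negb_or => /andP[/rP-> //]; rewrite inE.
have f'P t : t \notin l -> f' s t = 0.
  by rewrite mem_undup mem_cat negb_or => /andP[_ /r'P-> //]; rewrite inE.
have ul : uniq l by exact: undup_uniq.
rewrite !(@dscompE _ _ _ g _ s u l) //; last first.
  by move=> t tl; rewrite dslinE fP // f'P // scaler0 addr0.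
rewrite scaler_sumr -big_split.
by apply: eq_bigr => t _; rewrite dslinE compm_linr.
Qed.

Definition ds_category : category F :=
  @Category F dsob (fun X Y => dshom X Y) ds1 (fun X Y Z => @dscomp X Y Z)
    dscompA dscomp1m dscompm1 dscomp_linl dscomp_linr.

End DirectSumCategory.

Section DirectSumCompletion.
Variables (F : fieldType) (C : balanced F).

Definition dstens_ob (X Y : dsob C) : dsob C :=
  {| dsidx := (dsidx X * dsidx Y)%type;
     dsfam := fun p => dsfam X p.1 ⊗ dsfam Y p.2 |}.

Program Definition dstens_hom X X' Y Y' (f : dshom X X') (g : dshom Y Y') :
    dshom (dstens_ob X Y) (dstens_ob X' Y') :=
  {| dsmx := fun p q => f p.1 q.1 ⊗m g p.2 q.2 |}.
Next Obligation.
move=> X X' Y Y' f g [s t] /=.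
apply: (sub_finite_set _ (finite_setX (dsfin f s) (dsfin g t))).
move=> [s' t'] /=; case: (eqVneq (f s s') 0) => [->|_].
  by rewrite bmap0l eqxx.
by case: (eqVneq (g t t') 0) => [->|//]; rewrite bmap0r eqxx.
Qed.

Lemma dstensE X X' Y Y' (f : dshom X X') (g : dshom Y Y') p q :
  dstens_hom f g p q = f p.1 q.1 ⊗m g p.2 q.2.
Proof. by []. Qed.

Lemma dstens1 X Y :
  dstens_hom (ds1 X) (ds1 Y) = ds1 (dstens_ob X Y).
Proof.
apply: dshomP => -[s t] [s' t'].
have [[<- <-]|ne] := eqVneq (s, t) (s', t').
  rewrite /= (@dsdiagE _ _ X X id) (@dsdiagE _ _ Y Y id) bmap1.
  by rewrite (@dsdiagE _ _ _ (dstens_ob X Y) id).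
rewrite /= (@dsdiag0 _ _ _ (dstens_ob X Y) id) //.
move: ne; rewrite xpair_eqE negb_and => /orP[ne|ne].
  by rewrite (@dsdiag0 _ _ X X id) // bmap0l.
by rewrite (@dsdiag0 _ _ Y Y id) // bmap0r.
Qed.

Lemma dstensM X X' X'' Y Y' Y'' (f' : dshom X' X'') (f : dshom X X')
    (g' : dshom Y' Y'') (g : dshom Y Y') :
  dstens_hom (dscomp f' f) (dscomp g' g)
  = dscomp (dstens_hom f' g') (dstens_hom f g).
Proof.
apply: dshomP => -[s t] [s'' t''] /=.
have [r ur rP] := dssupp f [:: s]; have [r' ur' r'P] := dssupp g [:: t].
have fP u : u \notin r -> f s u = 0 by apply: rP; rewrite inE.
have gP u : u \notin r' -> g t u = 0 by apply: r'P; rewrite inE.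
rewrite (dscompE _ _ ur fP) (dscompE _ _ ur' gP).
rewrite (@dscompE _ _ _ _ _ (dstens_hom f' g') (dstens_hom f g) (s, t)
  (s'', t'') [seq (u, u') | u <- r, u' <- r']).
- rewrite big_allpairs bmap_suml; apply: eq_bigr => u _.
  by rewrite bmap_sumr; apply: eq_bigr => u' _; rewrite bmapM.
- by apply: allpairs_uniq => // -[? ?] [? ?] _ _ [-> ->].
- move=> [u u'] nuu' /=; case: (boolP (u \in r)) => [ur'_in|/fP ->].
    rewrite gP ?bmap0r //; apply: contra nuu' => u'r'.
    by apply: allpairs_f.
  by rewrite bmap0l.
Qed.

Lemma dstens_linl X X' Y Y' a (f f' : dshom X X') (g : dshom Y Y') :
  dstens_hom (a *: f + f') g = a *: dstens_hom f g + dstens_hom f' g.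
Proof.
by apply: dshomP => s t; rewrite dslinE !dstensE dslinE bmap_linl.
Qed.

Lemma dstens_linr X X' Y Y' a (f : dshom X X') (g g' : dshom Y Y') :
  dstens_hom f (a *: g + g') = a *: dstens_hom f g + dstens_hom f g'.
Proof.
by apply: dshomP => s t; rewrite dslinE !dstensE dslinE bmap_linr.
Qed.

Definition ds_tensor :
    bifunctor (ds_category C) (ds_category C) (ds_category C) :=
  @Bifunctor F (ds_category C) (ds_category C) (ds_category C) dstens_ob
    dstens_hom dstens1 dstensM dstens_linl dstens_linr.

(* [C] sits in its completion as the one-term sums. *)
Definition ds_single (x : C) : dsob C :=
  {| dsidx := unit : choiceType; dsfam := fun=> x |}.

Definition ds_braided : braided F :=
  @Braided F (ds_category C) ds_tensor (ds_single unit_ob)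
    (fun X => @dsdiag _ C (dstens_ob (ds_single unit_ob) X) X
       (fun p => p.2) (fun p => lun (dsfam X p.2)))
    (fun X => @dsdiag _ C X (dstens_ob (ds_single unit_ob) X)
       (fun s => (tt, s)) (fun s => lunV (dsfam X s)))
    (fun X => @dsdiag _ C (dstens_ob X (ds_single unit_ob)) X
       (fun p => p.1) (fun p => run (dsfam X p.1)))
    (fun X => @dsdiag _ C X (dstens_ob X (ds_single unit_ob))
       (fun s => (s, tt)) (fun s => runV (dsfam X s)))
    (fun X Y Z => @dsdiag _ C
       (dstens_ob X (dstens_ob Y Z)) (dstens_ob (dstens_ob X Y) Z)
       (fun p => ((p.1, p.2.1), p.2.2))
       (fun p => assoc (dsfam X p.1) (dsfam Y p.2.1) (dsfam Z p.2.2)))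
    (fun X Y Z => @dsdiag _ C
       (dstens_ob (dstens_ob X Y) Z) (dstens_ob X (dstens_ob Y Z))
       (fun p => (p.1.1, (p.1.2, p.2)))
       (fun p => assocV (dsfam X p.1.1) (dsfam Y p.1.2) (dsfam Z p.2)))
    (fun X Y => @dsdiag _ C (dstens_ob X Y) (dstens_ob Y X)
       (fun p => (p.2, p.1)) (fun p => braid (dsfam X p.1) (dsfam Y p.2)))
    (fun X Y => @dsdiag _ C (dstens_ob Y X) (dstens_ob X Y)
       (fun p => (p.2, p.1)) (fun p => braidV (dsfam X p.2) (dsfam Y p.1))).

Definition ds_completion : balanced F :=
  {| blbr := ds_braided;
     twist := fun X : ds_braided =>
       @dsdiag _ C X X id (fun s => twist (dsfam X s)) |}.

Definition ds_sum (I : choiceType) (x : I -> C) : ds_completion :=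
  {| dsidx := I; dsfam := x |}.

Definition ds_incl (I : choiceType) (x : I -> C) (i : I) :
    @mor F ds_completion (ds_single (x i)) (ds_sum x) :=
  @dsdiag _ C (ds_single (x i)) (ds_sum x) (fun=> i) (fun=> idm (x i)).

End DirectSumCompletion.

(** * Algebras and their modules *)

Record comm_algebra F (T : braided F) (A : T) (mu : mor (A ⊗ A) A)
    (iota : mor unit_ob A) : Prop := CommAlgebra {
  alg_assoc : mu ∘ (idm A ⊗m mu) = mu ∘ (mu ⊗m idm A) ∘ assoc A A A;
  alg_unitl : mu ∘ (iota ⊗m idm A) = lun A;
  alg_unitr : mu ∘ (idm A ⊗m iota) = run A;
  alg_comm : mu ∘ braid A A = mu }.

Record left_module F (T : braided F) (A : T) (mu : mor (A ⊗ A) A)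
    (iota : mor unit_ob A) (M : T) (act : mor (A ⊗ M) M) : Prop :=
    LeftModule {
  mod_assoc : act ∘ (idm A ⊗m act) = act ∘ (mu ⊗m idm M) ∘ assoc A A M;
  mod_unit : act ∘ (iota ⊗m idm M) = lun M }.

Definition module_mor F (T : braided F) (A M N : T) (actM : mor (A ⊗ M) M)
    (actN : mor (A ⊗ N) N) (f : mor M N) :=
  f ∘ actM = actN ∘ (idm A ⊗m f).

Definition simple_module F (T : braided F) (A : T) (mu : mor (A ⊗ A) A)
    (iota : mor unit_ob A) (N : T) (actN : mor (A ⊗ N) N) :=
  idm N <> 0 /\
  forall (M : T) (actM : mor (A ⊗ M) M) (f : mor M N),
    left_module mu iota actM -> module_mor actM actN f -> is_mono f ->
    f = 0 \/ is_iso f.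

Definition simple_algebra F (T : braided F) (A : T) (mu : mor (A ⊗ A) A)
    (iota : mor unit_ob A) := simple_module mu iota mu.

(* Main.v *)
Require Import Defs.
From HB Require Import structures.
From mathcomp Require Import all_boot all_algebra.
From mathcomp Require Import boolp classical_sets cardinality.
Set Implicit Arguments.
Unset Strict Implicit.
Unset Printing Implicit Defensive.
Import GRing.Theory.
Local Open Scope ring_scope.
Local Open Scope cat_scope.

(* Put P(x, y) = Hom(x ⊠ y, A): a presheaf on U x V, lax monoidal through the
   multiplication of A. Write [univ c], for c in P(x, s), when c represents P(x, -).
   By the Kunneth formula Hom(x ⊠ y, x0 ⊠ y') = Hom(x, x0) ⊗ Hom(y, y'), every x has
   such an s = s(x), and s(X_i) is a power of Y_i. Multiplying the universal
   elements of z and of dual z and restricting along coev gives a pairing of s(z) with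
   s(dual z). The elements of A annihilated by "multiply, then project to the unit
   component" form an ideal, so the simplicity of A makes the pairing nondegenerate
   on both sides; in a rigid abelian category it is then part of a duality. This
   makes s full, faithful and monoidal on the sums of the X_i; in particular
   s(X_i) = Y_i and the Y_i satisfy Schur's lemma. The equivalence is the composite
   of s and duality; it reverses the braiding because the monoidal structure
   x^* ⊗ y^* -> (x ⊗ y)^* of the dual functor involves an inverse braiding. *)

(** * Linear categories *)

(** Two things are unknown at the start. The field need not be algebraically closed, so End(X_i) may
    exceed the scalars; and V is not semisimple, so Y_i may a priori decompose. The Kunneth formula
    therefore yields only the power of Y_i with exponent dim End(X_i), and properties of Y_i have to
    be imported from X_i through the fullness of s. Fullness rests on the duality of s(z) with
    s(dual z), so it is available for objects of the form dual z; this is why the X_i are first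
    shown to be permuted by duality up to isomorphism. Closure of the sums of the X_i under tensor
    products cannot be read off from A either. It comes from a detection principle: a simple S
    receiving a nonzero map from a product of two such sums has P(S, -) nonzero, hence lies in the
    family. For infinite I the algebra lives only in the completion, but a morphism z -> A with z in
    C has finite support, so products of such elements are finite sums of morphisms of C. *)

Lemma dep_choice (A : Type) (B : A -> Type) (P : forall a, B a -> Prop) :
  (forall a, exists b, P a b) -> exists f : forall a, B a, forall a, P a (f a).
Proof.
by move=> h; exists (fun a => sval (cid (h a))) => a; case: cid.
Qed.

Section LinearCategory.
Variables (F : fieldType) (C : category F).
Implicit Types x y z w : C.

Lemma compmDl x y z (f : mor x y) (g g' : mor y z) :
  (g + g') ∘ f = g ∘ f + g' ∘ f.
Proof. by have := compm_linl f 1 g g'; rewrite !scale1r. Qed.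

Lemma compmDr x y z (g : mor y z) (f f' : mor x y) :
  g ∘ (f + f') = g ∘ f + g ∘ f'.
Proof. by have := compm_linr g 1 f f'; rewrite !scale1r. Qed.

Lemma compmZl x y z (f : mor x y) a (g : mor y z) : (a *: g) ∘ f = a *: (g ∘ f).
Proof. by have := compm_linl f a g 0; rewrite comp0m !addr0. Qed.

Lemma compmZr x y z (g : mor y z) a (f : mor x y) : g ∘ (a *: f) = a *: (g ∘ f).
Proof. by have := compm_linr g a f 0; rewrite compm0 !addr0. Qed.

Lemma compmNl x y z (f : mor x y) (g : mor y z) : (- g) ∘ f = - (g ∘ f).
Proof. by rewrite -scaleN1r compmZl scaleN1r. Qed.

Lemma compmNr x y z (g : mor y z) (f : mor x y) : g ∘ (- f) = - (g ∘ f).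
Proof. by rewrite -scaleN1r compmZr scaleN1r. Qed.

Lemma compmBl x y z (f : mor x y) (g g' : mor y z) :
  (g - g') ∘ f = g ∘ f - g' ∘ f.
Proof. by rewrite compmDl compmNl. Qed.

Lemma compmBr x y z (g : mor y z) (f f' : mor x y) :
  g ∘ (f - f') = g ∘ f - g ∘ f'.
Proof. by rewrite compmDr compmNr. Qed.

(** The working form of associativity: in a word associated to the right it contracts two neighbours
    and keeps the tail [h]. *)
Lemma compK w x y z (g : mor y z) (f : mor x y) (e : mor x z) : g ∘ f = e ->
  forall h : mor w x, g ∘ (f ∘ h) = e ∘ h.
Proof. by move=> <- h; rewrite compmA. Qed.

Lemma inverses_sym x y (f : mor x y) (g : mor y x) : inverses f g -> inverses g f.
Proof. by case. Qed.

Lemma inverses_uniq x y (f : mor x y) (g g' : mor y x) :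
  inverses f g -> inverses f g' -> g = g'.
Proof. by move=> [gf _] [_ fg']; rewrite -[g]compm1 -fg' compmA gf comp1m. Qed.

Lemma iso_id x : is_iso (idm x).
Proof. by exists (idm x); split; rewrite comp1m. Qed.

Lemma iso_comp x y z (g : mor y z) (f : mor x y) :
  is_iso g -> is_iso f -> is_iso (g ∘ f).
Proof.
move=> [g' [g'g gg']] [f' [f'f ff']]; exists (f' ∘ g'); split.
  by rewrite compmA -(compmA f') g'g compm1.
by rewrite compmA -(compmA g) ff' compm1.
Qed.

Lemma isomorphic_sym x y : isomorphic x y -> isomorphic y x.
Proof. by move=> [f [g fg]]; exists g, f; exact: inverses_sym. Qed.

Lemma isomorphic_trans x y z : isomorphic x y -> isomorphic y z -> isomorphic x z.
Proof. by move=> [f ff] [g gg]; exists (g ∘ f); exact: iso_comp. Qed.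

Lemma iso_mono x y (f : mor x y) : is_iso f -> is_mono f.
Proof.
move=> [g [gf _]] w h h' /(congr1 (fun k => g ∘ k)).
by rewrite !compmA gf !comp1m.
Qed.

Lemma iso_epi x y (f : mor x y) : is_iso f -> is_epi f.
Proof.
move=> [g [_ fg]] w h h' /(congr1 (fun k => k ∘ g)).
by rewrite -!compmA fg !compm1.
Qed.

Lemma mono_split_iso x y (f : mor x y) (g : mor y x) :
  is_mono f -> f ∘ g = idm y -> is_iso f.
Proof.
by move=> fm fg; exists g; split=> //; apply: fm; rewrite compmA fg comp1m compm1.
Qed.

Lemma is_monoP x y (f : mor x y) :
  (forall w (g : mor w x), f ∘ g = 0 -> g = 0) -> is_mono f.
Proof.
move=> f0 w g h fgh; apply/eqP; rewrite -subr_eq0; apply/eqP; apply: f0.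
by rewrite compmBr fgh subrr.
Qed.

Lemma zero_ob_l x (x0 : idm x = 0) y (f : mor x y) : f = 0.
Proof. by rewrite -[f]compm1 x0 compm0. Qed.

Lemma iso_neq0 x y (f : mor x y) : idm x <> 0 -> is_iso f -> f <> 0.
Proof. by move=> x0 [g [gf _]] f0; apply: x0; rewrite -gf f0 compm0. Qed.

Lemma isomorphic_neq0 x y : isomorphic x y -> idm x <> 0 -> idm y <> 0.
Proof.
move=> [f [g [gf _]]] x0 y0; apply: x0.
by rewrite -gf -[f]comp1m y0 comp0m compm0.
Qed.

Lemma dsum_iso n (c : 'I_n -> C) x y : isomorphic x y -> is_dsum c x -> is_dsum c y.
Proof.
move=> [f [g [gf fg]]] [i [p [pi pi0 ip]]].
exists (fun k => f ∘ i k), (fun k => p k ∘ g); split=> [k|k l kl|].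
- by rewrite compmA -(compmA (p k)) gf compm1 pi.
- by rewrite compmA -(compmA (p l)) gf compm1 pi0.
- transitivity (f ∘ (\sum_k (i k ∘ p k)) ∘ g); last by rewrite ip compm1 fg.
  by rewrite compm_sumr compm_suml; apply: eq_bigr => k _; rewrite !compmA.
Qed.

Lemma dsum_component n (c c' : 'I_n -> C) x :
  (forall k, isomorphic (c k) (c' k)) -> is_dsum c x -> is_dsum c' x.
Proof.
move=> cc' [i [p [pi pi0 ip]]].
have [|u uP] := @dep_choice _ (fun k => (mor (c k) (c' k) * mor (c' k) (c k))%type)
    (fun k u => inverses u.1 u.2).
  by move=> k; have [f [g fg]] := cc' k; exists (f, g).
 exists (fun k => i k ∘ (u k).2), (fun k => (u k).1 ∘ p k).
split=> [k|k l kl|].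
- by rewrite compmA -(compmA (u k).1) pi compm1; case: (uP k).
- by rewrite compmA -(compmA (u l).1) pi0 // compm0 comp0m.
- rewrite -ip; apply: eq_bigr => k _.
  by rewrite compmA -(compmA (i k)); case: (uP k) => -> _; rewrite compm1.
Qed.

Lemma dsum_uniq n (c : 'I_n -> C) x y : is_dsum c x -> is_dsum c y -> isomorphic x y.
Proof.
move=> [i [p [pi pi0 ip]]] [j [q [qj qj0 jq]]].
have sumE (z t : C) (i' : forall k, mor (c k) z) (p' : forall k, mor z (c k))
    (j' : forall k, mor (c k) t) (q' : forall k, mor t (c k)) :
    (forall k, p' k ∘ i' k = idm (c k)) -> (forall k l, k != l -> p' l ∘ i' k = 0) ->
    (\sum_k (j' k ∘ p' k)) ∘ (\sum_k (i' k ∘ q' k)) = \sum_k (j' k ∘ q' k).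
  move=> p'i' p'i'0; rewrite compm_suml; apply: eq_bigr => k _.
  rewrite compm_sumr (bigD1 k) //= big1 => [|l lk].
    by rewrite addr0 -compmA (compmA (p' k)) p'i' comp1m.
  by rewrite -compmA (compmA (p' k)) p'i'0 // comp0m compm0.
by exists (\sum_k (j k ∘ p k)), (\sum_k (i k ∘ q k)); split; rewrite sumE.
Qed.

(** The index of an iterated sum is a dependent pair, which ranges over a finite type and not over
    an ordinal; [fdsum_dsum] returns to ordinals by enumeration. *)
Definition is_fdsum (T : finType) (c : T -> C) x :=
  exists (i : forall k, mor (c k) x) (p : forall k, mor x (c k)),
    [/\ forall k, p k ∘ i k = idm (c k),
        forall k l, k != l -> p l ∘ i k = 0
      & \sum_k (i k ∘ p k) = idm x].

Lemma fdsum_dsum (T : finType) (c : T -> C) x :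
  is_fdsum c x -> is_dsum (fun k : 'I_#|T| => c (enum_val k)) x.
Proof.
move=> [i [p [pi pi0 ip]]].
exists (fun k => i (enum_val k)), (fun k => p (enum_val k)); split=> [k|k l kl|].
- exact: pi.
- by apply: pi0; rewrite (inj_eq enum_val_inj).
- by rewrite -ip (reindex _ (onW_bij _ (@enum_val_bij T))).
Qed.

Lemma dsum_dsum n (m : 'I_n -> nat) (c : forall k, 'I_(m k) -> C)
    (d : 'I_n -> C) x :
  (forall k, is_dsum (c k) (d k)) -> is_dsum d x ->
  is_fdsum (fun t : {k : 'I_n & 'I_(m k)} => c (tag t) (tagged t)) x.
Proof.
move=> cd [i [p [pi pi0 ip]]].
have [|u uP] := @dep_choice _
   (fun k => ((forall l, mor (c k l) (d k)) * (forall l, mor (d k) (c k l)))%type)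
   (fun k u => [/\ forall l, u.2 l ∘ u.1 l = idm (c k l),
        forall l l', l != l' -> u.2 l' ∘ u.1 l = 0
      & \sum_l (u.1 l ∘ u.2 l) = idm (d k)]).
  by move=> k; have [j [q jq]] := cd k; exists (j, q).
exists (fun t => i (tag t) ∘ (u (tag t)).1 (tagged t)).
exists (fun t => (u (tag t)).2 (tagged t) ∘ p (tag t)).
split=> [[k l]|[k l] [k' l']|] /=.
- by rewrite compmA -(compmA _ (p k)) pi compm1; case: (uP k) => ->.
- rewrite compmA -(compmA _ (p k')) => tt'; case: (eqVneq k k') => kk'; last first.
    by rewrite pi0 // compm0 comp0m.
  subst k'; rewrite pi compm1; case: (uP k) => _ -> //.
  by apply: contraNneq tt' => ->.
- rewrite -ip; transitivity (\sum_k \sum_l (i k ∘ (u k).1 l ∘ ((u k).2 l ∘ p k))).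
    by rewrite (sig_big_dep _ (fun _ => xpredT)).
  apply: eq_bigr => k _.
  rewrite -[in RHS](compm1 (i k)); case: (uP k) => _ _ <-.
  rewrite compm_sumr compm_suml; apply: eq_bigr => l _.
  by rewrite !compmA.
Qed.

Lemma sums_of_dsum (I : Type) (X : I -> C) n (d : 'I_n -> C) x :
  (forall k, sums_of X (d k)) -> is_dsum d x -> sums_of X x.
Proof.
move=> Xd dx.
have [|m mP] := @dep_choice _ (fun _ => {m & 'I_m -> I})
    (fun k m => is_dsum (fun l => X (tagged m l)) (d k)).
  by move=> k; have [m [c cd]] := Xd k; exists (existT _ m c).
have := fdsum_dsum (dsum_dsum mP dx).
by move=> xs; eexists; eexists; exact: xs.
Qed.

Lemma sums_of_iso (I : Type) (X : I -> C) x y :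
  isomorphic x y -> sums_of X x -> sums_of X y.
Proof. by move=> xy [n [c cx]]; exists n, c; exact: dsum_iso cx. Qed.

Lemma dsum1 x : is_dsum (fun _ : 'I_1 => x) x.
Proof.
exists (fun=> idm x), (fun=> idm x); split=> [k|k l|].
- by rewrite comp1m.
- by rewrite !ord1.
- by rewrite big_ord1 comp1m.
Qed.

Lemma sums_of1 (I : Type) (X : I -> C) i : sums_of X (X i).
Proof. by exists 1%N, (fun=> i); exact: dsum1. Qed.

Lemma dsum_neq0 n (c : 'I_n -> C) x : idm x <> 0 -> is_dsum c x ->
  exists k, idm (c k) <> 0.
Proof.
move=> x0 [i [p [pi pi0 ip]]]; apply: contrapT => c0; apply: x0.
rewrite -ip big1 // => k _; rewrite (_ : i k = 0) ?comp0m //.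
by apply: zero_ob_l; apply: contrapT => ck; apply: c0; exists k.
Qed.

Lemma dsum_eq n (c : 'I_n -> C) x (i : forall k, mor (c k) x) p y (f g : mor x y) :
  \sum_k (i k ∘ p k) = idm x -> (forall k, f ∘ i k = g ∘ i k) -> f = g.
Proof.
move=> ip fg; rewrite -[f]compm1 -[g]compm1 -ip !compm_sumr.
by apply: eq_bigr => k _; rewrite !compmA fg.
Qed.

Lemma dsum_eqr n (c : 'I_n -> C) x i (p : forall k, mor x (c k)) y (f g : mor y x) :
  \sum_k (i k ∘ p k) = idm x -> (forall k, p k ∘ f = p k ∘ g) -> f = g.
Proof.
move=> ip fg; rewrite -[f]comp1m -[g]comp1m -ip !compm_suml.
by apply: eq_bigr => k _; rewrite -!compmA fg.
Qed.

(** The mono [f] is a kernel of some [g], and [g = 0] because [f] is epi; the identity of [y] then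
    lifts through [f]. *)
Lemma abelian_mono_epi x y (f : mor x y) : abelian C ->
  is_mono f -> is_epi f -> is_iso f.
Proof.
move=> abC fm fe; have [z [g [gf fK]]] := abelian_mono abC fm.
have g0 : g = 0 by apply: fe; rewrite gf comp0m.
have [h [fh _]] := fK y (idm y) (etrans (compm1 g) g0).
exact: mono_split_iso fm fh.
Qed.

Lemma cokernel_epi x y z (c : mor y z) (f : mor x y) : is_cokernel c f -> is_epi c.
Proof.
move=> [cf cK] v g h ghc.
have [k [kc ku]] := cK v (g ∘ c) (etrans (esym (compmA _ _ _))
   (etrans (congr1 _ cf) (compm0 _ _))).
by rewrite -(ku g) // -(ku h) // ghc.
Qed.

End LinearCategory.

Definition is_bisum F (C : category F) (x y s : C) (i : mor x s) (p : mor s x)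
    (j : mor y s) (q : mor s y) :=
  [/\ p ∘ i = idm x, q ∘ j = idm y, q ∘ i = 0, p ∘ j = 0
    & i ∘ p + j ∘ q = idm s].

(** Splitting off one summand is the induction step of [schur_image]. *)
Lemma dsum_recl F (C : category F) n (c : 'I_n.+1 -> C) x y :
  is_dsum c x -> is_dsum (fun k => c (lift ord0 k)) y ->
  exists i p j q, @is_bisum F C (c ord0) y x i p j q.
Proof.
move=> [i [p [pi pi0 ip]]] [i' [p' [pi' pi0' ip']]].
exists (i ord0), (p ord0), (\sum_k (i (lift ord0 k) ∘ p' k)).
exists (\sum_k (i' k ∘ p (lift ord0 k))).
have pq k : p' k ∘ \sum_k (i' k ∘ p (lift ord0 k)) = p (lift ord0 k).
  rewrite compm_sumr (bigD1 k) //= big1 => [|a ak].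
    by rewrite addr0 compmA pi' comp1m.
  by rewrite compmA pi0' ?comp0m.
have ji l : (\sum_k (i (lift ord0 k) ∘ p' k)) ∘ i' l = i (lift ord0 l).
  rewrite compm_suml (bigD1 l) //= big1 => [|a al].
    by rewrite addr0 -compmA pi' compm1.
  by rewrite -compmA pi0' ?compm0 // eq_sym.
split.
- exact: pi.
- apply: (dsum_eqr ip') => k; apply: (dsum_eq ip') => l.
  rewrite compmA pq compm1 -compmA ji.
  case: (eqVneq k l) => [->|kl]; first by rewrite pi' pi.
  by rewrite pi0 ?pi0' // 1?eq_sym // (inj_eq (@lift_inj _ _)) eq_sym.
- by rewrite compm_suml big1 // => k _; rewrite -compmA pi0 ?compm0.
- by rewrite compm_sumr big1 // => k _; rewrite compmA pi0 ?comp0m.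
- rewrite -ip big_ord_recl; congr (_ + _).
  by rewrite compm_suml; apply: eq_bigr => k _; rewrite -compmA pq.
Qed.

Lemma bisum_exists F (C : category F) (x y : C) :
  (forall n (c : 'I_n -> C), exists s, is_dsum c s) ->
  exists s i p j q, @is_bisum F C x y s i p j q.
Proof.
move=> sums; pose c (k : 'I_2) := if k == ord0 then x else y.
have [s cs] := sums 2%N c; exists s.
have yc : is_dsum (fun k => c (lift ord0 k)) y by exact: dsum1.
exact: (dsum_recl cs yc).
Qed.

(** * Categories of finite sums of a family obeying Schur's lemma *)

Section Schur.
Variables (F : fieldType) (C : category F) (I : Type) (S : I -> C).
Hypothesis S_neq0 : forall i, idm (S i) <> 0.
Hypothesis S_schur : forall i j (f : mor (S i) (S j)), f = 0 \/ is_iso f.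
Hypothesis S_sums : forall x, sums_of S x.
Hypothesis dsums : forall n (c : 'I_n -> C), exists s, is_dsum c s.

Lemma schur_retraction i y (f : mor (S i) y) : f <> 0 ->
  exists r : mor y (S i), r ∘ f = idm (S i).
Proof.
move=> f0; have [n [c [j [p [pj pj0 jp]]]]] := S_sums y.
have [k /eqP pk0] : exists k, p k ∘ f != 0.
  apply: contrapT => pf0; apply: f0; apply: (dsum_eqr jp) => k; rewrite compm0.
  by apply/eqP; apply: contrapT => /negP pk0; apply: pf0; exists k.
case: (S_schur (p k ∘ f)) => // -[g [gpf _]].
by exists (g ∘ p k); rewrite -compmA.
Qed.

(** Induction on the number of summands of [x]. The restriction of [f] to all but the first summand
    is already factored; what the first summand adds outside that image is, by Schur, zero or a
    split mono, so the image stays or grows by one summand. *)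
Lemma schur_image (x y : C) (f : mor x y) :
  exists (z : C) (e : mor x z) (m : mor z y) (s : mor z x) (r : mor y z),
    [/\ e ∘ s = idm z, r ∘ m = idm z & f = m ∘ e].
Proof.
have [n [c cx]] := S_sums x; elim: n => [|n IH] in c x cx f *.
  exists x, (idm x), f, (idm x), 0; rewrite !comp1m.
  have x0 : idm x = 0 by have [i [p [_ _ <-]]] := cx; rewrite big_ord0.
  by split; rewrite ?compm1 // comp0m x0.
have [x' cx'] := dsums (fun k => S (c (lift ord0 k))).
have [i [p [j [q [pi qj qi pj ip]]]]] := dsum_recl cx cx'.
have [z [e [m [s [r [es rm fE]]]]]] := IH _ _ cx' (f ∘ j).
(* The restriction of [f] to the first summand, projected to the complement of the image [m] found
   so far. *)
pose h := (idm y - m ∘ r) ∘ (f ∘ i).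
have rh : r ∘ h = 0 by rewrite /h compmA compmBr compm1 (compmA r) rm comp1m subrr comp0m.
have [E [e1 e2 fE']] : exists E : mor x z,
    [/\ E ∘ (j ∘ s) = idm z, E ∘ i = r ∘ (f ∘ i) & f = m ∘ E + h ∘ p].
  exists (e ∘ q + r ∘ (f ∘ i) ∘ p); split.
  - by rewrite compmDl -!compmA (compK qj) comp1m es (compK pj) comp0m !compm0 addr0.
  - by rewrite compmDl -!compmA qi pi !compm0 !compm1 add0r.
  - rewrite -[LHS]compm1 -ip !compmDr !compmA -fE /h.
    by rewrite !compmBl comp1m !compmA -addrA [X in _ = _ + X]addrC subrK addrC.
have hm : (idm y - m ∘ r) ∘ m = 0 by rewrite compmBl comp1m -compmA rm compm1 subrr.
have [h0|h0] := EM (h = 0).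
  by exists z, E, m, (j ∘ s), r; split=> //; rewrite {1}fE' h0 comp0m addr0.
have [rho rhoh] := schur_retraction h0.
have [w [i1 [p1 [i2 [p2 [pi1 pi2 pi12 pi21 ip12]]]]]] :=
  bisum_exists z (S (c ord0)) dsums.
exists w, (i1 ∘ E + i2 ∘ p), (m ∘ p1 + h ∘ p2).
(* A section of the new epi. Since [E ∘ i = r ∘ (f ∘ i)] need not vanish, [i] is corrected by a term
   from the other summands. *)
exists (j ∘ s ∘ p1 + (i - j ∘ s ∘ (r ∘ (f ∘ i))) ∘ p2).
exists (i1 ∘ r + i2 ∘ rho ∘ (idm y - m ∘ r)); split.
- have E1 : (i1 ∘ E + i2 ∘ p) ∘ (j ∘ s) = i1.
    by rewrite compmDl -!compmA e1 (compK pj) comp0m compm0 addr0 compm1.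
  have E2 : (i1 ∘ E + i2 ∘ p) ∘ (i - j ∘ s ∘ (r ∘ (f ∘ i))) = i2.
    rewrite compmBr (compmA _ (j ∘ s)) E1 compmDl -!compmA e2 pi compm1.
    by rewrite addrAC subrr add0r.
  set X := i1 ∘ E + i2 ∘ p in E1 E2 *.
  by rewrite compmDr (compmA X) E1 (compmA X) E2.
- have R1 : (i1 ∘ r + i2 ∘ rho ∘ (idm y - m ∘ r)) ∘ m = i1.
    by rewrite compmDl -!compmA hm rm !compm0 addr0 compm1.
  have R2 : (i1 ∘ r + i2 ∘ rho ∘ (idm y - m ∘ r)) ∘ h = i2.
    rewrite compmDl -!compmA rh compm0 add0r compmBl comp1m -!compmA rh compm0 subr0.
    by rewrite rhoh compm1.
  set X := i1 ∘ r + _ in R1 R2 *.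
  by rewrite compmDr (compmA X) R1 (compmA X) R2.
- rewrite compmDr !compmDl -!compmA (compK pi1) (compK pi12) (compK pi21) (compK pi2).
  by rewrite !comp1m !comp0m !compm0 addr0 add0r {1}fE' /h -!compmA.
Qed.

(** Factor [p = m ∘ e] through its image; cancelling the split epi and the split mono turns
    [p ∘ p = p] into [e ∘ m = idm z]. *)
Lemma schur_split (x : C) (p : mor x x) : p ∘ p = p ->
  exists (z : C) (e : mor x z) (m : mor z x), e ∘ m = idm z /\ m ∘ e = p.
Proof.
move=> pp; have [z [e [m [s [r [es rm pE]]]]]] := schur_image p.
exists z, e, m; split=> //; rewrite -[LHS]comp1m -rm -[LHS]compm1 -es.
by rewrite -!compmA (compK (esym pE)) (compmA m) -pE (compmA p) pp pE -compmA es compm1.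
Qed.

Lemma schur_split_compl (x : C) (p : mor x x) : p ∘ p = p ->
  exists (z : C) (e : mor x z) (m : mor z x), e ∘ m = idm z /\ m ∘ e = idm x - p.
Proof.
move=> pp; apply: schur_split.
by rewrite compmBl comp1m compmBr compm1 pp subrr subr0.
Qed.

(** With [f = m ∘ e] split on both sides by [s] and [r], splitting the idempotents 1 - s e and 1 - m
    r gives the kernel and the cokernel. A mono has s e = 1 and an epi has m r = 1, which makes them
    a kernel and a cokernel. *)
Lemma schur_abelian : abelian C.
Proof.
split=> [//|x y f|x y f|x y f fm|x y f fe];
  have [z [e [m [s [r [es rm fE]]]]]] := schur_image f.
- have [|w [e' [m' [em' me']]]] := schur_split_compl (p := s ∘ e).
    by rewrite -compmA (compK es) comp1m.
  have e0 : e ∘ m' = 0.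
    rewrite -[m']compm1 -em' (compmA m') me' compmBl comp1m compmBr -!compmA.
    by rewrite (compK es) comp1m subrr.
  exists w, m'; split=> [|v g fg]; first by rewrite fE -compmA e0 compm0.
  have eg : e ∘ g = 0 by rewrite -[e]comp1m -rm -(compmA r) -fE -compmA fg compm0.
  exists (e' ∘ g); split=> [|h <-]; last by rewrite compmA em' comp1m.
  by rewrite compmA me' compmBl comp1m -compmA eg compm0 subr0.
- have [|w [e' [m' [em' me']]]] := schur_split_compl (p := m ∘ r).
    by rewrite -compmA (compK rm) comp1m.
  have e0 : e' ∘ m = 0.
    rewrite -[e']comp1m -em' -(compmA e') me' -compmA compmBl comp1m -compmA rm.
    by rewrite compm1 subrr compm0.
  exists w, e'; split=> [|v g gf]; first by rewrite fE compmA e0 comp0m.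
  have gm : g ∘ m = 0 by rewrite -[m]compm1 -es (compmA m) -fE compmA gf comp0m.
  exists (g ∘ m'); split=> [|h <-]; last by rewrite -compmA em' compm1.
  by rewrite -compmA me' compmBr compm1 compmA gm comp0m subr0.
- have [|w [e' [m' [em' me']]]] := schur_split_compl (p := m ∘ r).
    by rewrite -compmA (compK rm) comp1m.
  have se : s ∘ e = idm x.
    by apply: fm; rewrite fE -!compmA (compK es) comp1m compm1.
  exists w, e'; split=> [|v g eg].
    rewrite -[e']comp1m -em' -!compmA (compmA m') me' fE compmBl comp1m -!compmA.
    by rewrite (compK rm) comp1m subrr compm0.
  exists (s ∘ r ∘ g); split=> [|h <-]; last first.
    by rewrite fE -!compmA (compK rm) comp1m (compK se) comp1m.
  rewrite fE -!compmA (compK es) comp1m compmA; apply/eqP.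
  by rewrite eq_sym -subr_eq0 -{1}[g]comp1m -compmBl -me' -compmA eg compm0.
- have [|w [e' [m' [em' me']]]] := schur_split_compl (p := s ∘ e).
    by rewrite -compmA (compK es) comp1m.
  have mr : m ∘ r = idm y.
    by apply: fe; rewrite fE -!compmA (compK rm) !comp1m.
  exists w, m'; split=> [|v g gm].
    rewrite -[m']compm1 -em' (compmA m') me' compmA fE compmBr compm1.
    by rewrite -!compmA (compK es) comp1m subrr comp0m.
  exists (g ∘ s ∘ r); split=> [|h <-]; last first.
    by rewrite fE -!compmA (compK es) comp1m mr compm1.
  rewrite fE -!compmA (compK rm) comp1m; apply/eqP.
  by rewrite eq_sym -subr_eq0 -{1}[g]compm1 -compmBr -me' compmA gm comp0m.
Qed.

Lemma schur_simple i : simple (S i).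
Proof.
split=> [//|y f fm]; have [f0|f0] := EM (f = 0); [by left | right].
have [n [c [j [p [pj pj0 jp]]]]] := S_sums y.
have [k /eqP fk0] : exists k, f ∘ j k != 0.
  apply: contrapT => pf0; apply: f0; apply: (dsum_eq jp) => k; rewrite comp0m.
  by apply/eqP; apply: contrapT => /negP pk0; apply: pf0; exists k.
case: (S_schur (f ∘ j k)) => // -[g [_ fjg]].
by apply: (mono_split_iso (g := j k ∘ g) fm); rewrite compmA.
Qed.

Lemma schur_semisimple : semisimple C.
Proof.
move=> x; have [n [c cx]] := S_sums x.
by exists n, (fun k => S (c k)); split=> // k; exact: schur_simple.
Qed.

Lemma simple_in_family y : simple y -> exists i, isomorphic y (S i).
Proof.
move=> [y0 y_simple]; have [n [c cy]] := S_sums y.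
have [k _] := dsum_neq0 y0 cy.
have [j [p [pj pj0 jp]]] := cy; exists (c k).
apply: isomorphic_sym; exists (j k); case: (y_simple _ (j k)) => //.
  by move=> w g h /(congr1 (fun f => p k ∘ f)); rewrite !compmA pj !comp1m.
by move=> jk0; case: (S_neq0 (i := c k)); rewrite -pj jk0 compm0.
Qed.

End Schur.

(** * Splittings in semisimple abelian categories *)

Section SchurSimple.
Variables (F : fieldType) (C : category F).
Hypotheses (abC : abelian C) (ssC : semisimple C).

Lemma simple_schur (x y : C) : simple x -> simple y ->
  forall f : mor x y, f = 0 \/ is_iso f.
Proof.
move=> [x0 xs] [y0 ys] f.
have [w [k [fk kK]]] := abelian_ker abC f.
have km : is_mono k.
  move=> v g h kgh; have [u [_ uu]] := kK v (k ∘ g) (etrans (compmA _ _ _)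
    (etrans (congr1 (fun a => a ∘ g) fk) (comp0m _ _))).
  by rewrite -(uu g) // -(uu h).
case: (xs _ _ km) => [k0|ki]; last first.
  by left; apply: (iso_epi ki); rewrite fk comp0m.
apply: ys; apply: is_monoP => v g fg.
by have [h [<- _]] := kK v g fg; rewrite k0 comp0m.
Qed.

(** [schur_retraction] for the family of all simple objects, indexed by themselves. *)
Lemma semisimple_retraction (x y : C) (f : mor x y) : simple x -> f <> 0 ->
  exists r : mor y x, r ∘ f = idm x.
Proof.
move=> xs.
apply: (@schur_retraction _ _ {z : C | simple z} (fun z => sval z) _ _
  (exist _ x xs)); first by move=> [z zs] [z' zs']; exact: simple_schur.
move=> z; have [n [c [cs cz]]] := ssC z.
by exists n, (fun k => exist _ (c k) (cs k)).
Qed.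

Lemma semisimple_regular (x y : C) (f : mor x y) : exists r : mor y x, f ∘ r ∘ f = f.
Proof.
have [|||z [e [m [s [r [es rm ->]]]]]] :=
  @schur_image _ _ {z : C | simple z} (fun z => sval z) _ _ _ x y f.
- by move=> [z zs] [z' zs']; exact: simple_schur.
- move=> z; have [n [c [cs cz]]] := ssC z.
  by exists n, (fun k => exist _ (c k) (cs k)).
- exact: abelian_dsum abC.
by exists (s ∘ r); rewrite !compmA -(compmA m) es compm1 -(compmA m) rm compm1.
Qed.

(** A cokernel split in this way is preserved by every linear functor; this yields the right
    exactness of [power_functor] in its first variable. *)
Lemma semisimple_cokernel (x y z : C) (f : mor x y) (c : mor y z) :
  is_cokernel c f -> exists (s : mor z y) (r : mor y x),
    c ∘ s = idm z /\ s ∘ c + f ∘ r = idm y.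
Proof.
move=> cf; have [r frf] := semisimple_regular f; have [cf0 cK] := cf.
have [|s [sc _]] := cK _ (idm y - f ∘ r).
  by rewrite compmBl comp1m frf subrr.
exists s, r; split; last by rewrite sc subrK.
apply: (cokernel_epi cf); rewrite comp1m -compmA sc compmBr compm1 compmA cf0.
by rewrite comp0m subr0.
Qed.

End SchurSimple.

Lemma simple_iso F (C : category F) (x y : C) :
  isomorphic x y -> simple x -> simple y.
Proof.
move=> xy [x0 xs]; split; first exact: isomorphic_neq0 xy x0.
move=> z f fm; have [g gi] := isomorphic_sym xy; have [h [hg gh]] := gi.
case: (xs _ (g ∘ f)) => [||gf].
- by move=> w k l; rewrite -!compmA => /(iso_mono gi) /fm.
- by move=> gf0; left; rewrite -[f]comp1m -hg -compmA gf0 compm0.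
by right; rewrite -[f]comp1m -hg -compmA; apply: iso_comp => //; exists g.
Qed.

(** * Fully faithful and essentially surjective functors *)

Section Equivalence.
Variables (F : fieldType) (C D : category F) (G : functor C D).

Lemma fmap0 (x y : C) : fmap G (0 : mor x y) = 0.
Proof.
have /esym/eqP := fmap_lin G 1 (0 : mor x y) 0.
by rewrite !scale1r addr0 -subr_eq0 addrK => /eqP.
Qed.

Lemma fmapD (x y : C) (f g : mor x y) : fmap G (f + g) = fmap G f + fmap G g.
Proof. by have := fmap_lin G 1 f g; rewrite !scale1r. Qed.

Lemma fmapZ (x y : C) a (f : mor x y) : fmap G (a *: f) = a *: fmap G f.
Proof. by have := fmap_lin G a f 0; rewrite fmap0 !addr0. Qed.

Lemma fmap_sum (x y : C) (J : Type) (r : seq J) (f : J -> mor x y) :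
  fmap G (\sum_(i <- r) f i) = \sum_(i <- r) fmap G (f i).
Proof.
elim: r => [|i r IH]; first by rewrite !big_nil fmap0.
by rewrite !big_cons fmapD IH.
Qed.

Hypothesis G_faithful : forall (x y : C) (f : mor x y), fmap G f = 0 -> f = 0.
Hypothesis G_full : forall (x y : C) (g : mor (G x) (G y)), exists f, fmap G f = g.
Hypothesis G_surj : forall d : D, exists c : C, isomorphic (G c) d.

Lemma fmap_inj (x y : C) : injective (@fmap _ _ _ G x y).
Proof.
move=> f g fg; apply/eqP; rewrite -subr_eq0; apply/eqP; apply: G_faithful.
by rewrite fmapD -scaleN1r fmapZ scaleN1r fg subrr.
Qed.

Lemma ff_equivalence : equivalence G.
Proof.
have [c cP] := dep_choice G_surj.
have [u uP] := dep_choice cP.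
have [v vP] := dep_choice uP.
have [h hP] : exists h : forall x y : D, mor x y -> mor (c x) (c y),
    forall x y g, fmap G (h x y g) = v y ∘ g ∘ u x.
  have [h hP] := @dep_choice (D * D) (fun p => mor p.1 p.2 -> mor (c p.1) (c p.2))
    (fun p k => forall g, fmap G (k g) = v p.2 ∘ g ∘ u p.1)
    (fun p => @dep_choice _ (fun _ => mor (c p.1) (c p.2))
      (fun g f => fmap G f = v p.2 ∘ g ∘ u p.1) (fun g => G_full _)).
  by exists (fun x y => h (x, y)) => x y; exact: (hP (x, y)).
have vu d : v d ∘ u d = idm (G (c d)) by case: (vP d).
have uv d : u d ∘ v d = idm d by case: (vP d).
have h1 x : h x x (idm x) = idm (c x) by apply: fmap_inj; rewrite hP compm1 vu fmap1.
have hM x y z (g : mor y z) (f : mor x y) : h x z (g ∘ f) = h y z g ∘ h x y f.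
  apply: fmap_inj; rewrite fmapM !hP !compmA; congr (_ ∘ _ ∘ _).
  by rewrite -(compmA _ (u y)) uv compm1.
have hlin x y a (f f' : mor x y) : h x y (a *: f + f') = a *: h x y f + h x y f'.
  apply: fmap_inj; rewrite fmap_lin !hP compmDr compmDl.
  by rewrite compmZr compmZl.
pose H := Functor h1 hM hlin.
exists H; split.
  have [t tP] := dep_choice (fun x : C => G_full (u (G x))).
  exists t; split=> [x y f /=|x].
    by apply: fmap_inj; rewrite !fmapM hP !tP !compmA uv comp1m.
  have [s sP] := G_full (v (G x)).
  by exists s; split; apply: fmap_inj; rewrite fmapM tP sP ?vu ?uv fmap1.
exists u; split=> [x y f /=|x]; first by rewrite hP !compmA uv comp1m.
by exists (v x); exact: vP.
Qed.

End Equivalence.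

(** * Monoidal coherence *)

Section Bifunctors.
Variables (F : fieldType) (C D E : category F) (B : bifunctor C D E).

Lemma bmap_comp w x x' x'' y y' y'' (f' : mor x' x'') (f : mor x x')
    (g' : mor y' y'') (g : mor y y') (h : mor w (B x y)) :
  bmap B f' g' ∘ (bmap B f g ∘ h) = bmap B (f' ∘ f) (g' ∘ g) ∘ h.
Proof. by rewrite bmapM compmA. Qed.

Lemma bmapDl x x' y y' (f f' : mor x x') (g : mor y y') :
  bmap B (f + f') g = bmap B f g + bmap B f' g.
Proof. by have := bmap_linl B 1 f f' g; rewrite !scale1r. Qed.

Lemma bmapDr x x' y y' (f : mor x x') (g g' : mor y y') :
  bmap B f (g + g') = bmap B f g + bmap B f g'.
Proof. by have := bmap_linr B 1 f g g'; rewrite !scale1r. Qed.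

Lemma bmapZl x x' y y' a (f : mor x x') (g : mor y y') :
  bmap B (a *: f) g = a *: bmap B f g.
Proof. by have := bmap_linl B a f 0 g; rewrite bmap0l !addr0. Qed.

Lemma bmapZr x x' y y' a (f : mor x x') (g : mor y y') :
  bmap B f (a *: g) = a *: bmap B f g.
Proof. by have := bmap_linr B a f g 0; rewrite bmap0r !addr0. Qed.

Lemma bmap_inverses x x' y y' (f : mor x x') f' (g : mor y y') g' :
  inverses f f' -> inverses g g' -> inverses (bmap B f g) (bmap B f' g').
Proof. by move=> [f1 f2] [g1 g2]; split; rewrite -bmapM ?f1 ?f2 ?g1 ?g2 bmap1. Qed.

Definition bflip : bifunctor D C E :=
  @Bifunctor F D C E (fun x y => B y x) (fun x x' y y' f g => bmap B g f)
    (fun x y => bmap1 B y x)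
    (fun x x' x'' y y' y'' f' f g' g => bmapM B g' g f' f)
    (fun x x' y y' a f f' g => bmap_linr B a g f f')
    (fun x x' y y' a f g g' => bmap_linl B a g g' f).

End Bifunctors.

Section Inverses.
Variables (F : fieldType) (C : category F).

Lemma move_l (x y z : C) (f : mor y z) f' (a : mor x y) b :
  inverses f f' -> f ∘ a = b -> a = f' ∘ b.
Proof. by move=> [f'f _] <-; rewrite compmA f'f comp1m. Qed.

Lemma move_r (x y z : C) (f : mor x y) f' (a : mor y z) b :
  inverses f f' -> a ∘ f = b -> a = b ∘ f'.
Proof. by move=> [_ ff'] <-; rewrite -compmA ff' compm1. Qed.

Lemma inverses_comp (x y z : C) (f : mor x y) f' (g : mor y z) g' :
  inverses f f' -> inverses g g' -> inverses (g ∘ f) (f' ∘ g').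
Proof.
move=> [f1 f2] [g1 g2]; split; rewrite -!compmA.
  by rewrite (compK g1) comp1m.
by rewrite (compK f2) comp1m.
Qed.

Lemma inverses_id (x : C) : inverses (idm x) (idm x).
Proof. by split; rewrite comp1m. Qed.

Lemma inverses_eq (x y : C) (f f' : mor x y) (g g' : mor y x) :
  inverses f g -> inverses f' g' -> f = f' -> g = g'.
Proof. by move=> fg fg' ff'; apply: inverses_uniq fg _; rewrite ff'. Qed.

End Inverses.

(** The part of the axioms that is stable under reversing the tensor product. Each one-sided
    statement proved from it yields its reflection by passing to [mirror]. *)
Record monoidal F (T : braided F) : Prop := Monoidal {
  mo_lunK : forall x : T, inverses (lun x) (lunV x);
  mo_runK : forall x : T, inverses (run x) (runV x);
  mo_assK : forall x y z : T, inverses (assoc x y z) (assocV x y z);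
  mo_lun_nat : forall (x y : T) (f : mor x y),
    lun y ∘ (idm unit_ob ⊗m f) = f ∘ lun x;
  mo_run_nat : forall (x y : T) (f : mor x y),
    run y ∘ (f ⊗m idm unit_ob) = f ∘ run x;
  mo_ass_nat : forall (x x' y y' z z' : T)
      (f : mor x x') (g : mor y y') (h : mor z z'),
    assoc x' y' z' ∘ (f ⊗m (g ⊗m h))
    = ((f ⊗m g) ⊗m h) ∘ assoc x y z;
  mo_triangle : forall x y : T,
    (run x ⊗m idm y) ∘ assoc x unit_ob y = idm x ⊗m lun y;
  mo_pentagon : forall w x y z : T,
    assoc (w ⊗ x) y z ∘ assoc w x (y ⊗ z)
    = (assoc w x y ⊗m idm z) ∘ assoc w (x ⊗ y) z
      ∘ (idm w ⊗m assoc x y z) }.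

Lemma braided_monoidal F (T : braided F) : braided_tensor_category T -> monoidal T.
Proof. by case. Qed.

(* Only the monoidal structure of the mirror is ever used; its braiding is a
   placeholder. *)
Definition mirror F (T : braided F) : braided F :=
  @Braided F T (bflip tens) unit_ob run runV lun lunV
    (fun x y z => assocV z y x) (fun x y z => assoc z y x)
    (fun x y => braid y x) (fun x y => braidV y x).

Section MonoidalTheory.
Variables (F : fieldType) (T : braided F).
Hypothesis T_mon : monoidal T.
Implicit Types w x y z : T.

Let lunK := mo_lunK T_mon.
Let runK := mo_runK T_mon.
Let assK := mo_assK T_mon.
Let id2 x y (f : mor x y) f' (z : T) (ff' : inverses f f') :
  inverses (f ⊗m idm z) (f' ⊗m idm z) := bmap_inverses _ ff' (inverses_id z).
Let id2' x y (f : mor x y) f' (z : T) (ff' : inverses f f') :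
  inverses (idm z ⊗m f) (idm z ⊗m f') := bmap_inverses _ (inverses_id z) ff'.

Lemma tcompm1 x x' x'' y (f' : mor x' x'') (f : mor x x') :
  (f' ∘ f) ⊗m idm y = (f' ⊗m idm y) ∘ (f ⊗m idm y).
Proof. by rewrite -bmapM comp1m. Qed.

Lemma tcomp1m x x' x'' y (f' : mor x' x'') (f : mor x x') :
  idm y ⊗m (f' ∘ f) = (idm y ⊗m f') ∘ (idm y ⊗m f).
Proof. by rewrite -bmapM comp1m. Qed.

Lemma tsplit x x' y y' (f : mor x x') (g : mor y y') :
  f ⊗m g = (f ⊗m idm y') ∘ (idm x ⊗m g).
Proof. by rewrite -bmapM comp1m compm1. Qed.

Lemma tsplit' x x' y y' (f : mor x x') (g : mor y y') :
  f ⊗m g = (idm x' ⊗m g) ∘ (f ⊗m idm y).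
Proof. by rewrite -bmapM comp1m compm1. Qed.

Lemma assV_nat (x x' y y' z z' : T) (f : mor x x') (g : mor y y') (h : mor z z') :
  assocV x' y' z' ∘ ((f ⊗m g) ⊗m h) = (f ⊗m (g ⊗m h)) ∘ assocV x y z.
Proof.
symmetry; rewrite (move_l (assK _ _ _) (mo_ass_nat T_mon f g h)) -compmA.
by case: (assK x y z) => _; rewrite -compmA => ->; rewrite compm1.
Qed.

Lemma ass_natK v (x x' y y' z z' : T) (f : mor x x') (g : mor y y') (h : mor z z')
    (k : mor v _) :
  assoc x' y' z' ∘ ((f ⊗m (g ⊗m h)) ∘ k) = ((f ⊗m g) ⊗m h) ∘ (assoc x y z ∘ k).
Proof. by rewrite compmA (mo_ass_nat T_mon) compmA. Qed.

Lemma assV_natK v (x x' y y' z z' : T) (f : mor x x') (g : mor y y') (h : mor z z')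
    (k : mor v _) :
  assocV x' y' z' ∘ (((f ⊗m g) ⊗m h) ∘ k) = (f ⊗m (g ⊗m h)) ∘ (assocV x y z ∘ k).
Proof. by rewrite compmA assV_nat compmA. Qed.

Lemma lunV_nat x y (f : mor x y) : (idm unit_ob ⊗m f) ∘ lunV x = lunV y ∘ f.
Proof.
rewrite (move_l (lunK _) (mo_lun_nat T_mon f)) -!compmA.
by case: (lunK x) => _ ->; rewrite compm1.
Qed.

Lemma runV_nat x y (f : mor x y) : (f ⊗m idm unit_ob) ∘ runV x = runV y ∘ f.
Proof.
rewrite (move_l (runK _) (mo_run_nat T_mon f)) -!compmA.
by case: (runK x) => _ ->; rewrite compm1.
Qed.

Lemma unitl_inj x y (f g : mor x y) : idm unit_ob ⊗m f = idm unit_ob ⊗m g -> f = g.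
Proof.
move=> fg; apply: (iso_epi (ex_intro _ _ (lunK x))).
by rewrite -!(mo_lun_nat T_mon) fg.
Qed.

Lemma unitr_inj x y (f g : mor x y) : f ⊗m idm unit_ob = g ⊗m idm unit_ob -> f = g.
Proof.
move=> fg; apply: (iso_epi (ex_intro _ _ (runK x))).
by rewrite -!(mo_run_nat T_mon) fg.
Qed.

Lemma lun_unit x : lun (unit_ob ⊗ x) = idm unit_ob ⊗m lun x.
Proof.
apply: (iso_mono (ex_intro _ _ (lunK x))).
by rewrite (mo_lun_nat T_mon).
Qed.

(** Kelly's argument: tensoring with the unit is faithful, and after tensoring the identity follows
    from the pentagon at (1, 1, x, y) and two triangles. *)
Lemma kelly_l x y : (lun x ⊗m idm y) ∘ assoc unit_ob x y = lun (x ⊗ y).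
Proof.
apply: unitl_inj; apply: (iso_mono (ex_intro _ _ (assK _ _ _))).
rewrite -(mo_triangle T_mon) !tcomp1m !compmA (mo_ass_nat T_mon) -(mo_triangle T_mon).
rewrite tcompm1 -[idm (x ⊗ y)]bmap1 (mo_ass_nat T_mon) -!compmA.
congr (_ ∘ _); rewrite !compmA; exact/esym/(mo_pentagon T_mon).
Qed.

Lemma lun1 : lun (unit_ob : T) = run unit_ob.
Proof.
apply: unitr_inj; apply: (iso_epi (ex_intro _ _ (assK unit_ob unit_ob unit_ob))).
by rewrite (mo_triangle T_mon) kelly_l lun_unit.
Qed.

(** This and the next two lemmas are the pentagon solved for the composites that occur when
    contractions are moved past a further tensor factor. *)
Lemma pentagon1 w x y z :
  (idm w ⊗m assoc x y z) ∘ assocV w x (y ⊗ z)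
  = assocV w (x ⊗ y) z ∘ ((assocV w x y ⊗m idm z) ∘ assoc (w ⊗ x) y z).
Proof.
apply/esym/(move_r (assK _ _ _)); rewrite -!compmA (mo_pentagon T_mon).
have [a _] := id2 z (assK w x y); have [b _] := assK w (x ⊗ y) z.
by rewrite -!compmA (compK a) comp1m (compK b) comp1m.
Qed.

Lemma pentagon2 w x y z :
  assoc w x (y ⊗ z) ∘ (idm w ⊗m assocV x y z)
  = assocV (w ⊗ x) y z ∘ ((assoc w x y ⊗m idm z) ∘ assoc w (x ⊗ y) z).
Proof.
apply: (move_l (assK _ _ _)); rewrite compmA.
apply/esym/(move_r (id2' _ (assK _ _ _))).
by rewrite (mo_pentagon T_mon).
Qed.

Lemma pentagon3 w x y z :
  (assocV w x y ⊗m idm z) ∘ assoc (w ⊗ x) y z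
  = assoc w (x ⊗ y) z ∘ ((idm w ⊗m assoc x y z) ∘ assocV w x (y ⊗ z)).
Proof.
apply: (move_l (inverses_sym (assK _ _ _))); exact/esym/pentagon1.
Qed.

Lemma pentagonV w x y z :
  (idm w ⊗m assocV x y z) ∘ assocV w (x ⊗ y) z ∘ (assocV w x y ⊗m idm z)
  = assocV w x (y ⊗ z) ∘ assocV (w ⊗ x) y z.
Proof.
rewrite -compmA; apply/esym/(inverses_eq _ _ (mo_pentagon T_mon w x y z)).
  exact: inverses_comp (assK _ _ _) (assK _ _ _).
apply: inverses_comp (id2' _ (assK _ _ _)) _.
exact: inverses_comp (assK _ _ _) (id2 _ (assK _ _ _)).
Qed.

Lemma triangleV x y :
  assocV x unit_ob y ∘ (runV x ⊗m idm y) = idm x ⊗m lunV y.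
Proof.
apply: (inverses_eq _ _ (mo_triangle T_mon x y)); last exact: id2' (lunK y).
exact: inverses_comp (assK _ _ _) (id2 _ (runK _)).
Qed.

Lemma triangle_run x y : (idm x ⊗m lun y) ∘ assocV x unit_ob y = run x ⊗m idm y.
Proof. by apply/esym/(move_r (assK _ _ _)); rewrite (mo_triangle T_mon). Qed.

Lemma triangle_lunV x y : assoc x unit_ob y ∘ (idm x ⊗m lunV y) = runV x ⊗m idm y.
Proof. by apply/esym/(move_l (inverses_sym (assK _ _ _))); rewrite triangleV. Qed.

Lemma kelly_lV x y : assoc unit_ob x y ∘ lunV (x ⊗ y) = lunV x ⊗m idm y.
Proof.
rewrite -[RHS]compm1; apply: (move_l (id2 _ (lunK x))).
by rewrite compmA kelly_l; case: (lunK (x ⊗ y)).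
Qed.

Lemma kelly_l' x y : lun (x ⊗ y) ∘ assocV unit_ob x y = lun x ⊗m idm y.
Proof. by apply/esym/(move_r (assK _ _ _)); rewrite kelly_l. Qed.

End MonoidalTheory.

Lemma mirror_monoidal F (T : braided F) : monoidal T -> monoidal (mirror T).
Proof.
move=> T_mon; split=> /=.
- exact: mo_runK.
- exact: mo_lunK.
- by move=> x y z; apply: inverses_sym; exact: mo_assK.
- by move=> x y f; exact: mo_run_nat.
- by move=> x y f; exact: mo_lun_nat.
- by move=> *; exact: assV_nat.
- by move=> x y; exact: triangle_run.
- by move=> w x y z; apply/esym; exact: pentagonV.
Qed.

Lemma kelly_r F (T : braided F) : monoidal T -> forall x y : T,
  (idm x ⊗m run y) ∘ assocV x y unit_ob = run (x ⊗ y).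
Proof. by move=> T_mon x y; exact: (kelly_l (mirror_monoidal T_mon)). Qed.

Lemma kelly_r' F (T : braided F) : monoidal T -> forall x y : T,
  run (x ⊗ y) ∘ assoc x y unit_ob = idm x ⊗m run y.
Proof. by move=> T_mon x y; exact: (kelly_l' (mirror_monoidal T_mon)). Qed.

(** * Duality *)

Definition dual_pair F (T : braided F) (o d : T) (e : mor (d ⊗ o) unit_ob)
    (c : mor unit_ob (o ⊗ d)) :=
  run o ∘ ((idm o ⊗m e) ∘ (assocV o d o ∘ ((c ⊗m idm o) ∘ lunV o))) = idm o /\
  lun d ∘ ((e ⊗m idm d) ∘ (assoc d o d ∘ ((idm d ⊗m c) ∘ runV d))) = idm d.

(** A contraction in front of a passive factor [w]. Locking keeps its coherence isomorphisms from
    being unfolded in calculations that use only its naturality and its zigzags. *)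
HB.lock Definition tail_ev F (T : braided F) (o d : T) (e : mor (d ⊗ o) unit_ob) (w : T) :
    mor (d ⊗ o ⊗ w) w :=
  lun w ∘ ((e ⊗m idm w) ∘ assoc d o w).

HB.lock Definition tail_coev F (T : braided F) (o d : T) (c : mor unit_ob (o ⊗ d)) (w : T) :
    mor w (o ⊗ d ⊗ w) :=
  assocV o d w ∘ ((c ⊗m idm w) ∘ lunV w).

Section Duality.
Variables (F : fieldType) (T : braided F).
Hypothesis T_mon : monoidal T.
Implicit Types v w x y z o d : T.

Lemma tail_ev_nat o d (e : mor (d ⊗ o) unit_ob) w w' (f : mor w w') :
  tail_ev e w' ∘ (idm d ⊗m (idm o ⊗m f)) = f ∘ tail_ev e w.
Proof.
rewrite tail_ev.unlock -!compmA (mo_ass_nat T_mon) bmap_comp bmap1 comp1m compm1.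
by rewrite (compmA f) -(mo_lun_nat T_mon) -!compmA bmap_comp comp1m compm1.
Qed.

Lemma tail_coev_nat o d (c : mor unit_ob (o ⊗ d)) w w' (f : mor w w') :
  (idm o ⊗m (idm d ⊗m f)) ∘ tail_coev c w = tail_coev c w' ∘ f.
Proof.
rewrite tail_coev.unlock compmA -(assV_nat T_mon) -!compmA; congr (_ ∘ _).
by rewrite bmap1 bmap_comp comp1m compm1 -(lunV_nat T_mon) bmap_comp comp1m compm1.
Qed.

(* A zigzag with a free tail; [e] and [c] need not be dual to each other. *)
Lemma tail_zigzag o d (e : mor (d ⊗ o) unit_ob) (c : mor unit_ob (o ⊗ d)) w :
  (idm o ⊗m tail_ev e w) ∘ tail_coev c (o ⊗ w)
  = (run o ∘ ((idm o ⊗m e) ∘ (assocV o d o ∘ ((c ⊗m idm o) ∘ lunV o)))) ⊗m idm w.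
Proof.
rewrite tail_ev.unlock tail_coev.unlock !(tcomp1m, tcompm1) -!compmA.
rewrite (compmA (idm o ⊗m assoc d o w)) (pentagon1 T_mon) -!compmA.
rewrite -[idm (o ⊗ w)]bmap1 (compmA (assoc (o ⊗ d) o w)) (mo_ass_nat T_mon) -!compmA.
rewrite (kelly_lV T_mon) (compmA (idm o ⊗m (e ⊗m idm w))) -(assV_nat T_mon) -!compmA.
by rewrite (compmA (idm o ⊗m lun w)) (triangle_run T_mon).
Qed.

Lemma tail_zagzig o d (e : mor (d ⊗ o) unit_ob) (c : mor unit_ob (o ⊗ d)) w :
  tail_ev e (d ⊗ w) ∘ (idm d ⊗m tail_coev c w)
  = (lun d ∘ ((e ⊗m idm d) ∘ (assoc d o d ∘ ((idm d ⊗m c) ∘ runV d)))) ⊗m idm w.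
Proof.
rewrite tail_ev.unlock tail_coev.unlock !(tcomp1m, tcompm1) -!compmA.
rewrite (compmA (assoc d o (d ⊗ w))) (pentagon2 T_mon) -!compmA.
rewrite (compmA (assoc d (o ⊗ d) w)) (mo_ass_nat T_mon) -!compmA.
rewrite (triangle_lunV T_mon) -[idm (d ⊗ w)]bmap1.
rewrite (compmA (e ⊗m _)) -(assV_nat T_mon) -!compmA.
by rewrite (compmA (lun (d ⊗ w))) (kelly_l' T_mon).
Qed.

Section Pair.
Variables (o d : T) (e : mor (d ⊗ o) unit_ob) (c : mor unit_ob (o ⊗ d)).

(** With [luntranspose], the two directions of the adjunction Hom(d ⊗ w, v) = Hom(w, o ⊗ v). *)
Definition ltranspose v w (h : mor (d ⊗ w) v) : mor w (o ⊗ v) :=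
  (idm o ⊗m h) ∘ tail_coev c w.
Definition luntranspose v w (g : mor w (o ⊗ v)) : mor (d ⊗ w) v :=
  tail_ev e v ∘ (idm d ⊗m g).

Lemma ltranspose_nat v w w' (h : mor (d ⊗ w) v) (g : mor w' w) :
  ltranspose (h ∘ (idm d ⊗m g)) = ltranspose h ∘ g.
Proof. by rewrite /ltranspose tcomp1m -!compmA tail_coev_nat. Qed.

(** Kept apart from [ltransposeK] because one triangle identity suffices for this composite; in the
    Deligne product only one is established, in [bx_zig]. *)
Lemma zag_ltransposeK :
  lun d ∘ ((e ⊗m idm d) ∘ (assoc d o d ∘ ((idm d ⊗m c) ∘ runV d))) = idm d ->
  forall v w, cancel (@ltranspose v w) (@luntranspose v w).
Proof.
move=> zag v w h; rewrite /luntranspose /ltranspose tcomp1m compmA tail_ev_nat -compmA.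
by rewrite tail_zagzig zag bmap1 compm1.
Qed.

Lemma ltransposeK v w : dual_pair e c -> cancel (@ltranspose v w) (@luntranspose v w).
Proof. by case=> _ /zag_ltransposeK; apply. Qed.

Lemma luntransposeK v w : dual_pair e c -> cancel (@luntranspose v w) (@ltranspose v w).
Proof.
move=> [zig _] h; rewrite /luntranspose /ltranspose tcomp1m -compmA tail_coev_nat compmA.
by rewrite tail_zigzag zig bmap1 comp1m.
Qed.

End Pair.
End Duality.

(** Reflection exchanges the two zigzags together with the roles of [o] and [d]. *)
Lemma mirror_dual F (T : braided F) (o d : T) (e : mor (d ⊗ o) unit_ob)
    (c : mor unit_ob (o ⊗ d)) :
  dual_pair e c -> @dual_pair F (mirror T) d o e c.
Proof. by case. Qed.

Section Mates.
Variables (F : fieldType) (T : braided F).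
Hypothesis T_mon : monoidal T.
Variables (o d : T) (e : mor (d ⊗ o) unit_ob) (c : mor unit_ob (o ⊗ d)).
Hypothesis ec : dual_pair e c.

Lemma tail_ev1 : tail_ev e unit_ob ∘ (idm d ⊗m runV o) = e.
Proof.
have [_ runVK] := mo_runK T_mon o.
rewrite tail_ev.unlock (lun1 T_mon) -!compmA (compmA (run _)) (mo_run_nat T_mon).
rewrite -!compmA (compmA (run _)) (kelly_r' T_mon) -bmapM runVK comp1m bmap1.
by rewrite compm1.
Qed.

Lemma tail_coev1 : (idm o ⊗m run d) ∘ tail_coev c unit_ob = c.
Proof.
rewrite tail_coev.unlock compmA (kelly_r T_mon) compmA (mo_run_nat T_mon) -(lun1 T_mon).
by have [_ lunVK] := mo_lunK T_mon (unit_ob : T); rewrite -compmA lunVK compm1.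
Qed.

(** With [lmate_uniq]: the pairing [e] identifies Hom(w, o) with Hom(d ⊗ w, 1). It is transposition
    for [v = unit_ob], cleared of the unit isomorphism. *)
Lemma lmate_ex w (k : mor (d ⊗ w) unit_ob) :
  exists g : mor w o, e ∘ (idm d ⊗m g) = k.
Proof.
exists (run o ∘ ltranspose c k); rewrite -[RHS](ltransposeK T_mon ec).
rewrite -{1}tail_ev1 /luntranspose -compmA -bmapM comp1m compmA.
by have [-> _] := mo_runK T_mon o; rewrite comp1m.
Qed.

Lemma lmate_uniq w (g g' : mor w o) :
  e ∘ (idm d ⊗m g) = e ∘ (idm d ⊗m g') -> g = g'.
Proof.
have E (f : mor w o) : e ∘ (idm d ⊗m f) = luntranspose e (runV o ∘ f).
  by rewrite -{1}tail_ev1 -compmA -bmapM comp1m.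
rewrite !E => /(can_inj (luntransposeK T_mon ec (v:=_) (w:=_))).
by apply: iso_mono; exists (run o); apply: inverses_sym; exact: mo_runK.
Qed.

Lemma lcomate_ex v (t : mor unit_ob (o ⊗ v)) :
  exists k : mor d v, t = (idm o ⊗m k) ∘ c.
Proof.
exists (luntranspose e t ∘ runV d).
rewrite -{1}tail_coev1 compmA -bmapM comp1m -compmA.
have [-> _] := mo_runK T_mon d; rewrite compm1.
by rewrite -[LHS](luntransposeK T_mon ec).
Qed.

End Mates.

Section RightMates.
Variables (F : fieldType) (T : braided F).
Hypothesis T_mon : monoidal T.
Variables (o d : T) (e : mor (d ⊗ o) unit_ob) (c : mor unit_ob (o ⊗ d)).
Hypothesis ec : dual_pair e c.
Let Tm := mirror_monoidal T_mon.
Let ecm := mirror_dual ec.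

Lemma rmate_ex w (k : mor (w ⊗ o) unit_ob) :
  exists g : mor w d, e ∘ (g ⊗m idm o) = k.
Proof. exact: (lmate_ex Tm ecm). Qed.

Lemma rmate_uniq w (g g' : mor w d) :
  e ∘ (g ⊗m idm o) = e ∘ (g' ⊗m idm o) -> g = g'.
Proof. exact: (lmate_uniq Tm ecm). Qed.

Lemma rcomate_ex v (t : mor unit_ob (v ⊗ d)) :
  exists k : mor o v, t = (k ⊗m idm d) ∘ c.
Proof. exact: (lcomate_ex Tm ecm). Qed.

Definition rtranspose v w (h : mor (w ⊗ o) v) : mor w (v ⊗ d) :=
  @ltranspose F (mirror T) d o c v w h.
Definition runtranspose v w (g : mor w (v ⊗ d)) : mor (w ⊗ o) v :=
  @luntranspose F (mirror T) d o e v w g.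

Lemma rtransposeK v w : cancel (@rtranspose v w) (@runtranspose v w).
Proof. exact: (ltransposeK Tm ecm). Qed.

Lemma runtransposeK v w : cancel (@runtranspose v w) (@rtranspose v w).
Proof. exact: (luntransposeK Tm ecm). Qed.

End RightMates.

Lemma rtranspose_nat F (T : braided F) (T_mon : monoidal T) (o d : T)
    (c : mor unit_ob (o ⊗ d)) v w w' (h : mor (w ⊗ o) v) (g : mor w' w) :
  rtranspose c (h ∘ (g ⊗m idm o)) = rtranspose c h ∘ g.
Proof. exact: (ltranspose_nat (mirror_monoidal T_mon)). Qed.

Lemma zig_rtransposeK F (T : braided F) (T_mon : monoidal T) (o d : T)
    (e : mor (d ⊗ o) unit_ob) (c : mor unit_ob (o ⊗ d)) :
  run o ∘ ((idm o ⊗m e) ∘ (assocV o d o ∘ ((c ⊗m idm o) ∘ lunV o))) = idm o ->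
  forall v w, cancel (@rtranspose F T o d c v w) (@runtranspose F T o d e v w).
Proof. by move=> zig; exact: (zag_ltransposeK (mirror_monoidal T_mon) zig). Qed.

Section Rigid.
Variables (F : fieldType) (T : ribbon F).
Hypothesis T_rib : ribbon_category T.
Implicit Types x y z w v : T.

Lemma ribbon_braided : braided_tensor_category T.
Proof. exact: bl_braided (rb_balanced T_rib). Qed.
Lemma ribbon_monoidal : monoidal T.
Proof. exact: braided_monoidal ribbon_braided. Qed.
Lemma ribbon_abelian : abelian T.
Proof. exact: bt_abelian ribbon_braided. Qed.
Let T_mon := ribbon_monoidal.

Lemma ribbon_dual x : dual_pair (ev x) (coev x).
Proof.
split; first by have := rb_zigzag T_rib x; rewrite -!compmA.
by have := rb_zagzig T_rib x; rewrite -!compmA.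
Qed.
Let T_dual := ribbon_dual.

Lemma ev_inj x w (k k' : mor w (dual x)) :
  ev x ∘ (k ⊗m idm x) = ev x ∘ (k' ⊗m idm x) -> k = k'.
Proof. exact: (rmate_uniq T_mon (T_dual x)). Qed.

(** Characterised by its mate under evaluation instead of by the formula [dual_mor], so that
    identities between dual morphisms are checked after evaluating. *)
Definition dmor x y (f : mor x y) : mor (dual y) (dual x) :=
  sval (cid (rmate_ex T_mon (T_dual x) (ev y ∘ (idm (dual y) ⊗m f)))).

Lemma dmorE x y (f : mor x y) :
  ev x ∘ (dmor f ⊗m idm x) = ev y ∘ (idm (dual y) ⊗m f).
Proof. by rewrite /dmor; case: cid. Qed.

Lemma dmorP x y (f : mor x y) k :
  ev x ∘ (k ⊗m idm x) = ev y ∘ (idm (dual y) ⊗m f) -> k = dmor f.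
Proof. by rewrite -dmorE; exact: ev_inj. Qed.

Lemma dmor1 x : dmor (idm x) = idm (dual x).
Proof. by apply/esym/dmorP. Qed.

Lemma dmorM x y z (g : mor y z) (f : mor x y) : dmor (g ∘ f) = dmor f ∘ dmor g.
Proof.
apply/esym/dmorP; rewrite tcompm1 compmA dmorE -compmA -tsplit' tsplit compmA dmorE.
by rewrite -compmA -tcomp1m.
Qed.

Lemma dmorZD x y a (f g : mor x y) : dmor (a *: f + g) = a *: dmor f + dmor g.
Proof.
apply/esym/dmorP; rewrite bmapDl bmapZl bmapDr bmapZr !compmDr !compmZr.
by rewrite !dmorE.
Qed.

Lemma dmor0 x y : dmor (0 : mor x y) = 0.
Proof. by apply/esym/dmorP; rewrite bmap0l bmap0r !compm0. Qed.

Lemma dmorD x y (f g : mor x y) : dmor (f + g) = dmor f + dmor g.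
Proof. by have := dmorZD 1 f g; rewrite !scale1r. Qed.

Lemma dmor_sum x y (J : Type) (r : seq J) (f : J -> mor x y) :
  dmor (\sum_(i <- r) f i) = \sum_(i <- r) dmor (f i).
Proof.
elim: r => [|i r IH]; first by rewrite !big_nil dmor0.
by rewrite !big_cons dmorD IH.
Qed.

Lemma dmor_inj x y (f g : mor x y) : dmor f = dmor g -> f = g.
Proof.
move=> fg; apply: (lmate_uniq T_mon (T_dual y)).
by rewrite -!dmorE fg.
Qed.

Lemma dmor_full x y (k : mor (dual y) (dual x)) : exists f : mor x y, dmor f = k.
Proof.
have [f fP] := lmate_ex T_mon (T_dual y) (ev x ∘ (k ⊗m idm x)).
by exists f; apply/esym/dmorP.
Qed.

Lemma dmor_inverses x y (f : mor x y) g : inverses f g -> inverses (dmor f) (dmor g).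
Proof. by move=> [gf fg]; split; rewrite -dmorM ?gf ?fg dmor1. Qed.

Lemma dual_neq0 x : idm x <> 0 -> idm (dual x) <> 0.
Proof. by move=> x0 dx0; apply: x0; apply: dmor_inj; rewrite dmor1 dmor0. Qed.

Lemma dual_dsum n (c : 'I_n -> T) x : is_dsum c x -> is_dsum (fun k => dual (c k)) (dual x).
Proof.
move=> [i [p [pi pi0 ip]]].
exists (fun k => dmor (p k)), (fun k => dmor (i k)); split=> [k|k l kl|].
- by rewrite -dmorM pi dmor1.
- by rewrite -dmorM pi0 ?dmor0 // eq_sym.
- by rewrite -dmor1 -ip dmor_sum; apply: eq_bigr => k _; rewrite dmorM.
Qed.

(** The idempotent of [dual x] onto a simple summand is the dual of an endomorphism of [x]. By Schur
    that endomorphism is zero or invertible, and it is not zero, so the summand is all of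
    [dual x]. *)
Lemma dual_simple x : semisimple T -> simple x -> simple (dual x).
Proof.
move=> ssT [x0 xs]; have dx0 := dual_neq0 x0.
have [n [c [cs cx]]] := ssT (dual x).
have [k _] := dsum_neq0 dx0 cx; have [i [p [pi pi0 ip]]] := cx.
apply: (simple_iso _ (cs k)).
have [u uE] := dmor_full (i k ∘ p k).
case: (simple_schur ribbon_abelian (conj x0 xs) (conj x0 xs) u) => [u0|[r ur]].
  case: (cs k) => -[]; rewrite -[LHS]compm1 -{1}(pi k) -(pi k) -!compmA.
  by rewrite (compmA (i k)) -uE u0 dmor0 comp0m compm0.
have [_] := dmor_inverses ur; rewrite uE -compmA => ir.
exists (i k); apply: mono_split_iso ir.
by move=> w g h /(congr1 (fun f => p k ∘ f)); rewrite !compmA pi !comp1m.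
Qed.

End Rigid.

Section TailEvaluation.
Variables (F : fieldType) (T : braided F).
Hypothesis T_mon : monoidal T.
Implicit Types a o d w y z : T.

Lemma tail_ev_prel a o d (e : mor (d ⊗ o) unit_ob) (k : mor a d) w :
  tail_ev e w ∘ (k ⊗m idm (o ⊗ w)) = tail_ev (e ∘ (k ⊗m idm o)) w.
Proof.
rewrite tail_ev.unlock -[idm (o ⊗ w)]bmap1 -?compmA (mo_ass_nat T_mon).
by rewrite tcompm1 -?compmA.
Qed.

Lemma tail_ev_prer a o d (e : mor (d ⊗ o) unit_ob) (f : mor a o) w :
  tail_ev e w ∘ (idm d ⊗m (f ⊗m idm w)) = tail_ev (e ∘ (idm d ⊗m f)) w.
Proof.
by rewrite tail_ev.unlock -?compmA (mo_ass_nat T_mon) tcompm1 -?compmA.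
Qed.

Lemma tail_ev_assoc o d (e : mor (d ⊗ o) unit_ob) y z :
  (tail_ev e y ⊗m idm z) ∘ (assoc d (o ⊗ y) z ∘ (idm d ⊗m assoc o y z))
  = tail_ev e (y ⊗ z).
Proof.
rewrite tail_ev.unlock !tcompm1 -?compmA (compmA (assoc d o y ⊗m idm z)).
rewrite -(mo_pentagon T_mon) -?compmA (compmA ((e ⊗m idm y) ⊗m idm z)).
by rewrite -(mo_ass_nat T_mon) bmap1 -?compmA (compmA _ (assoc _ y z)) (kelly_l T_mon).
Qed.

Lemma tail_ev_eq1 o d (e : mor (d ⊗ o) unit_ob) y :
  tail_ev e y ∘ assocV d o y = lun y ∘ (e ⊗m idm y).
Proof.
by rewrite tail_ev.unlock -?compmA; case: (mo_assK T_mon d o y) => _ ->; rewrite compm1.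
Qed.

End TailEvaluation.

(** * Duals of tensor products *)

Section RigidTensor.
Variables (F : fieldType) (T : ribbon F).
Hypothesis T_rib : ribbon_category T.
Implicit Types x y z w v : T.
Let T_mon := ribbon_monoidal T_rib.
Let T_dual := ribbon_dual T_rib.
Local Notation dmor := (dmor T_rib).

Definition pair_tens x y : mor ((dual y ⊗ dual x) ⊗ (x ⊗ y)) unit_ob :=
  ev y ∘ ((idm (dual y) ⊗m tail_ev (ev x) y) ∘ assocV (dual y) (dual x) (x ⊗ y)).

(** In this shape the nested contraction is visibly two successive mates, first for [y] and then for
    [x], as [dtens_iso] requires. *)
Lemma pair_tens_left x y :
  pair_tens x y = ev y ∘
    ((run (dual y) ∘ ((idm (dual y) ⊗m ev x) ∘ assocV (dual y) (dual x) x)) ⊗m idm y)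
    ∘ assoc (dual y ⊗ dual x) x y.
Proof.
rewrite /pair_tens tail_ev.unlock -compmA; congr (_ ∘ _).
rewrite !(tcomp1m, tcompm1) -?compmA (pentagon3 T_mon).
rewrite (compmA ((idm (dual y) ⊗m ev x) ⊗m idm y)) -(mo_ass_nat T_mon) -?compmA.
by rewrite (compmA (run _ ⊗m _)) (mo_triangle T_mon).
Qed.

Lemma pair_tens_tail x y z :
  tail_ev (pair_tens x y) z ∘ (idm (dual y ⊗ dual x) ⊗m assoc x y z)
  = tail_ev (ev y) z ∘ ((idm (dual y) ⊗m tail_ev (ev x) (y ⊗ z))
      ∘ assocV (dual y) (dual x) (x ⊗ y ⊗ z)).
Proof.
rewrite -(tail_ev_assoc T_mon (ev x)) /pair_tens tail_ev.unlock !(tcomp1m, tcompm1) -?compmA.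
rewrite (compmA (assocV (dual y) (dual x) (x ⊗ y) ⊗m idm z)) (pentagon3 T_mon) -?compmA.
rewrite -[idm (dual y ⊗ dual x)]bmap1 (assV_nat T_mon).
by rewrite !(ass_natK T_mon).
Qed.

Definition dtens x y : mor (dual y ⊗ dual x) (dual (x ⊗ y)) :=
  sval (cid (rmate_ex T_mon (T_dual (x ⊗ y)) (pair_tens x y))).

Lemma dtensE x y : ev (x ⊗ y) ∘ (dtens x y ⊗m idm (x ⊗ y)) = pair_tens x y.
Proof. by rewrite /dtens; case: cid. Qed.

Lemma dtens_nat x x' y y' (f : mor x x') (g : mor y y') :
  dtens x y ∘ (dmor g ⊗m dmor f) = dmor (f ⊗m g) ∘ dtens x' y'.
Proof.
apply: (ev_inj T_rib); rewrite !tcompm1 !compmA dtensE dmorE.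
rewrite -compmA -(tsplit' (dtens x' y')) (tsplit (dtens x' y')) compmA dtensE.
rewrite /pair_tens -?compmA.
rewrite -[idm (x ⊗ y)]bmap1 -[idm (dual y' ⊗ dual x')]bmap1 !(assV_nat T_mon).
rewrite !(compmA (_ ⊗m tail_ev _ _)) -!bmapM bmap1 (tail_ev_prel T_mon) dmorE.
rewrite [f ⊗m g]tsplit' tcomp1m (compmA (tail_ev _ _)) (tail_ev_nat T_mon) -(compmA g).
rewrite (tail_ev_prer T_mon) !comp1m (tsplit (dmor g)) -(compmA (dmor g ⊗m _)).
by rewrite (compmA (ev y)) dmorE tcomp1m -?compmA.
Qed.

(** Maps from [w] into [dual y ⊗ dual x] also correspond bijectively to maps w ⊗ (x ⊗ y) -> 1, by
    transposing [y] and then [x]. Hence [dual y ⊗ dual x] and [dual (x ⊗ y)] represent the same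
    functor. *)
Lemma dtens_iso x y : is_iso (dtens x y).
Proof.
have inj w (k k' : mor w (dual y ⊗ dual x)) :
    pair_tens x y ∘ (k ⊗m idm (x ⊗ y)) = pair_tens x y ∘ (k' ⊗m idm (x ⊗ y)) -> k = k'.
  rewrite pair_tens_left -?compmA => kk'.
  apply: (can_inj (runtransposeK T_mon (T_dual x) (v:=_) (w:=_))).
  apply: (ev_inj T_rib).
  rewrite /runtranspose /luntranspose tail_ev.unlock /= -?compmA !tcompm1.
  have [_ VA] := mo_assK T_mon w x y.
  apply: (iso_epi (ex_intro _ _ (mo_assK T_mon w x y))).
  move: kk'; rewrite -[idm (x ⊗ y)]bmap1 !(mo_ass_nat T_mon).
  by rewrite !tcompm1 -?compmA.
have surj w (h : mor (w ⊗ (x ⊗ y)) unit_ob) :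
    exists k : mor w (dual y ⊗ dual x), pair_tens x y ∘ (k ⊗m idm (x ⊗ y)) = h.
  have [k1 k1E] := rmate_ex T_mon (T_dual y) (h ∘ assocV w x y).
  exists (rtranspose (coev x) k1).
  have := rtransposeK T_mon (T_dual x) k1.
  rewrite /runtranspose /luntranspose tail_ev.unlock /= => k2E.
  rewrite pair_tens_left -?compmA -[idm (x ⊗ y)]bmap1 (mo_ass_nat T_mon).
  rewrite (compmA (_ ⊗m idm y)) -tcompm1 k2E compmA k1E -compmA.
  by have [-> _] := mo_assK T_mon w x y; rewrite compm1.
have [k kE] := surj _ (ev (x ⊗ y)).
have dk : dtens x y ∘ k = idm (dual (x ⊗ y)).
  by apply: (ev_inj T_rib); rewrite tcompm1 compmA dtensE kE bmap1 compm1.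
exists k; split=> //; apply: inj.
by rewrite tcompm1 compmA kE dtensE bmap1 compm1.
Qed.

(** Under evaluation both sides become the nested contraction of three pairs. *)
Lemma dtens_assoc x y z :
  dmor (assoc x y z) ∘ (dtens (x ⊗ y) z ∘ (idm (dual z) ⊗m dtens x y))
  = dtens x (y ⊗ z) ∘ ((dtens y z ⊗m idm (dual x)) ∘ assoc (dual z) (dual y) (dual x)).
Proof.
apply: (ev_inj T_rib); rewrite !tcompm1 !compmA dmorE dtensE.
rewrite -(compmA (ev _)) -(tsplit' (dtens (x ⊗ y) z)) (tsplit (dtens (x ⊗ y) z)).
rewrite (compmA (ev _)) dtensE -compmA -tsplit' /pair_tens -?compmA.
rewrite (assV_nat T_mon) (bmap_comp _ (idm (dual z))) (tsplit (dtens x y)).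
rewrite (compmA (tail_ev _ _)) (tail_ev_prel T_mon) dtensE pair_tens_tail !comp1m.
rewrite (assV_natK T_mon) bmap1 (compmA (_ ⊗m tail_ev _ _)) -tsplit'.
rewrite (tsplit (dtens y z)) -?compmA (compmA (ev (y ⊗ z))) dtensE /pair_tens -?compmA.
rewrite -[idm (dual z ⊗ dual y)]bmap1 (assV_natK T_mon) (compmA (assocV _ _ _)).
rewrite -(pentagonV T_mon) -?compmA.
have [VK _] := mo_assK T_mon (dual z) (dual y) (dual x).
by rewrite -tcompm1 VK bmap1 compm1 !tcomp1m -?compmA.
Qed.

End RigidTensor.

(** * Braidings and duals *)

Section Braiding.
Variables (F : fieldType) (T : braided F).
Hypothesis T_br : braided_tensor_category T.
Let T_mon := braided_monoidal T_br.
Implicit Types a b c x y z : T.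

Lemma hexagon1 x y z :
  assoc z x y ∘ (braid (x ⊗ y) z ∘ assoc x y z)
  = (braid x z ⊗m idm y) ∘ (assoc x z y ∘ (idm x ⊗m braid y z)).
Proof. by have := bt_hexagon1 T_br x y z; rewrite -!compmA. Qed.

Lemma hexagon2 x y z :
  assocV y z x ∘ (braid x (y ⊗ z) ∘ assocV x y z)
  = (idm y ⊗m braid x z) ∘ (assocV y x z ∘ (braid x y ⊗m idm z)).
Proof. by have := bt_hexagon2 T_br x y z; rewrite -!compmA. Qed.

(** The hexagon at (1, 1, x), combined with the faithfulness of tensoring with the unit. *)
Lemma braid_unitl x : run x ∘ braid unit_ob x = lun x.
Proof.
apply: (unitr_inj T_mon).
apply: (iso_epi (ex_intro _ _ (mo_assK T_mon unit_ob x unit_ob))).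
rewrite (kelly_l T_mon) tcompm1 -?compmA.
have bi : is_iso (idm unit_ob ⊗m braid unit_ob x).
  exists (idm unit_ob ⊗m braidV unit_ob x).
  by apply: bmap_inverses (inverses_id _) _; exact: bt_brdK.
apply: (iso_epi bi); rewrite -?compmA -hexagon1 -?compmA.
rewrite (compmA (run x ⊗m _)) (mo_triangle T_mon) (compmA (idm x ⊗m lun _)).
by rewrite -(bt_brd_nat T_br) -?compmA (kelly_l T_mon) (mo_lun_nat T_mon).
Qed.

Lemma braid_unitr x : lun x ∘ braid x unit_ob = run x.
Proof.
apply: (unitl_inj T_mon).
apply: (iso_epi (ex_intro _ _ (inverses_sym (mo_assK T_mon unit_ob x unit_ob)))).
rewrite (kelly_r T_mon) tcomp1m -?compmA.
have bi : is_iso (braid x unit_ob ⊗m idm unit_ob).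
  exists (braidV x unit_ob ⊗m idm unit_ob).
  by apply: bmap_inverses _ (inverses_id _); exact: bt_brdK.
apply: (iso_epi bi); rewrite -?compmA -hexagon2 -?compmA.
rewrite (compmA (_ ⊗m lun x)) (triangle_run T_mon) (compmA (run _ ⊗m idm x)).
by rewrite -(bt_brd_nat T_br) -?compmA (kelly_r T_mon) (mo_run_nat T_mon).
Qed.

Lemma braidV_nat x x' y y' (f : mor x x') (g : mor y y') :
  braidV x' y' ∘ (g ⊗m f) = (f ⊗m g) ∘ braidV x y.
Proof.
apply/esym/(move_l (bt_brdK T_br _ _)); rewrite compmA (bt_brd_nat T_br) -?compmA.
by have [_ ->] := bt_brdK T_br x y; rewrite compm1.
Qed.

Lemma braidV_unitl x : run x ∘ braidV x unit_ob = lun x.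
Proof. by apply/esym/(move_r (bt_brdK T_br _ _)); exact: braid_unitr. Qed.

Lemma braidV_unitr x : lun x ∘ braidV unit_ob x = run x.
Proof. by apply/esym/(move_r (bt_brdK T_br _ _)); exact: braid_unitl. Qed.

(** Both sides reverse the order of three factors; this is the Yang-Baxter relation written with
    block braidings. *)
Lemma braid_reverse a b c :
  (idm a ⊗m braid c b) ∘ braid (c ⊗ b) a
  = assocV a b c ∘ ((braid b a ⊗m idm c) ∘ (braid c (b ⊗ a) ∘ assocV c b a)).
Proof.
rewrite (compmA (braid b a ⊗m idm c)) -(bt_brd_nat T_br (idm c)) -?compmA.
have := hexagon2 c a b; rewrite compmA => /(move_r (inverses_sym (mo_assK T_mon _ _ _))).
rewrite -?compmA (compmA (assocV a b c)) => ->.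
have /(move_l (mo_assK T_mon _ _ _)) /(move_r (mo_assK T_mon _ _ _)) := hexagon1 c b a.
by move=> ->; rewrite -?compmA.
Qed.

Lemma braidV_reverse a b c :
  braidV (c ⊗ b) a ∘ (idm a ⊗m braidV c b)
  = assoc c b a ∘ (braidV c (b ⊗ a) ∘ ((braidV b a ⊗m idm c) ∘ assoc a b c)).
Proof.
apply: (inverses_eq _ _ (braid_reverse a b c)).
  apply: inverses_comp (bt_brdK T_br _ _) _.
  exact: bmap_inverses (inverses_id _) (bt_brdK T_br _ _).
rewrite (compmA (assoc c b a)) (compmA (assoc c b a ∘ _)).
apply: inverses_comp _ (inverses_sym (mo_assK T_mon _ _ _)).
apply: inverses_comp _ (bmap_inverses _ (bt_brdK T_br _ _) (inverses_id _)).
exact: inverses_comp (inverses_sym (mo_assK T_mon _ _ _)) (bt_brdK T_br _ _).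
Qed.

End Braiding.

Section DualProduct.
Variables (F : fieldType) (T : ribbon F).
Hypothesis T_rib : ribbon_category T.
Implicit Types x y z w v : T.
Let T_br := ribbon_braided T_rib.
Let T_mon := ribbon_monoidal T_rib.
Let T_dual := ribbon_dual T_rib.
Local Notation dmor := (dmor T_rib).
Local Notation dtens := (dtens T_rib).

(** Sliding [x] across the contraction of [y] with its dual: a braiding with [y] on one side is an
    inverse braiding with [dual y] on the other. [ev_braid] is the companion for a factor sliding
    from the opposite side. *)
Lemma tail_ev_braid x y :
  tail_ev (ev y) x ∘ (idm (dual y) ⊗m braid x y)
  = run x ∘ ((idm x ⊗m ev y) ∘ (assocV x (dual y) y
      ∘ ((braidV x (dual y) ⊗m idm y) ∘ assoc (dual y) x y))).
Proof.
have bK : inverses (braid x (dual y) ⊗m idm y) (braidV x (dual y) ⊗m idm y).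
  exact: bmap_inverses (bt_brdK T_br _ _) (inverses_id _).
have /esym/(move_r bK) := bt_hexagon2 T_br x (dual y) y.
move/(move_r (inverses_sym (mo_assK T_mon _ _ _))); rewrite -?compmA => ->.
rewrite (compmA (tail_ev _ _)) (tail_ev_eq1 T_mon) -?compmA.
rewrite (compmA (ev y ⊗m _)) -(bt_brd_nat T_br) -?compmA.
by rewrite (compmA (lun x)) (braid_unitr T_br).
Qed.

Lemma ev_braid x z :
  run z ∘ ((idm z ⊗m ev x) ∘ (assocV z (dual x) x ∘ (braid (dual x) z ⊗m idm x)))
  = tail_ev (ev x) z ∘ ((idm (dual x) ⊗m braidV x z) ∘ assocV (dual x) z x).
Proof.
have bK : inverses (idm (dual x) ⊗m braid x z) (idm (dual x) ⊗m braidV x z).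
  exact: bmap_inverses (inverses_id _) (bt_brdK T_br _ _).
have /esym/(move_r bK) := bt_hexagon1 T_br (dual x) x z.
move/(move_r (mo_assK T_mon _ _ _)); rewrite -?compmA => ->.
have [VK _] := mo_assK T_mon z (dual x) x.
rewrite (compK VK) comp1m (compmA (idm z ⊗m _)) -(bt_brd_nat T_br) -?compmA.
by rewrite (compmA (run z)) (braid_unitl T_br) tail_ev.unlock -?compmA.
Qed.

Lemma tail_ev_unit x : tail_ev (ev x) unit_ob = ev x ∘ (idm (dual x) ⊗m run x).
Proof.
rewrite -[in RHS](tail_ev1 T_mon (ev x)) -compmA -tcomp1m.
by have [-> _] := mo_runK T_mon x; rewrite bmap1 compm1.
Qed.

(** Both sides reduce to a contraction after the inverse braiding of [x] with [dual y]:
    [tail_ev_braid] rewrites the left side and [ev_braid] the right. *)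
Lemma dtens_braid x y :
  dmor (braid x y) ∘ dtens y x = dtens x y ∘ braid (dual x) (dual y).
Proof.
apply: (ev_inj T_rib); rewrite !tcompm1 !compmA dmorE dtensE.
rewrite -compmA -tsplit' (tsplit (dtens y x)) compmA dtensE.
rewrite (pair_tens_left T_rib x y) /pair_tens -?compmA.
rewrite -[idm (dual x ⊗ dual y)]bmap1 (assV_nat T_mon) (bmap_comp _ (idm (dual x))).
rewrite comp1m tail_ev_braid -[idm (x ⊗ y)]bmap1 (mo_ass_nat T_mon).
rewrite (compmA (_ ⊗m idm y)) -tcompm1 -?compmA ev_braid !tcompm1 -?compmA.
rewrite (pentagon3 T_mon) (compmA ((idm (dual x) ⊗m _) ⊗m _)) -(mo_ass_nat T_mon).
rewrite !tcomp1m -?compmA (compmA (tail_ev _ _ ⊗m _)).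
have -> : (tail_ev (ev x) (dual y) ⊗m idm y) ∘ assoc (dual x) (x ⊗ dual y) y
    = tail_ev (ev x) (dual y ⊗ y) ∘ (idm (dual x) ⊗m assocV x (dual y) y).
  rewrite -(tail_ev_assoc T_mon) -?compmA -tcomp1m.
  by have [_ ->] := mo_assK T_mon x (dual y) y; rewrite bmap1 compm1.
rewrite -?compmA (compmA (ev y)) -(tail_ev_nat T_mon) tail_ev_unit -?compmA.
by [].
Qed.

Definition dprod x y : mor (dual x ⊗ dual y) (dual (x ⊗ y)) :=
  dtens x y ∘ braidV (dual y) (dual x).

Lemma dprod_iso x y : is_iso (dprod x y).
Proof.
apply: iso_comp (dtens_iso T_rib x y) _.
by exists (braid (dual y) (dual x)); apply: inverses_sym; exact: bt_brdK.
Qed.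

Lemma dprod_nat x x' y y' (f : mor x x') (g : mor y y') :
  dprod x y ∘ (dmor f ⊗m dmor g) = dmor (f ⊗m g) ∘ dprod x' y'.
Proof.
by rewrite /dprod -compmA (braidV_nat T_br) !compmA (dtens_nat T_rib).
Qed.

(** [dtens] reverses the order of the factors and [braidV] restores it, so this combines
    [dtens_assoc] with the three-factor reversal [braidV_reverse]. *)
Lemma dprod_assoc x y z :
  dmor (assoc x y z) ∘ (dprod (x ⊗ y) z ∘ ((dprod x y ⊗m idm (dual z))
    ∘ assoc (dual x) (dual y) (dual z)))
  = dprod x (y ⊗ z) ∘ (idm (dual x) ⊗m dprod y z).
Proof.
rewrite /dprod tcomp1m tcompm1 -?compmA.
rewrite (compmA (braidV (dual (y ⊗ z)) _)) (braidV_nat T_br) -?compmA.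
rewrite (braidV_reverse T_br) (compmA (dtens y z ⊗m _)) (compmA (dtens x _)).
rewrite -(dtens_assoc T_rib) -?compmA.
by rewrite (compmA (braidV (dual z) _)) (braidV_nat T_br) -?compmA.
Qed.

Lemma dprod_braid x y :
  dmor (braid x y) ∘ dprod y x = dprod x y ∘ braid (dual y) (dual x).
Proof.
rewrite /dprod compmA dtens_braid -?compmA.
have [_ ->] := bt_brdK T_br (dual x) (dual y).
by have [-> _] := bt_brdK T_br (dual y) (dual x).
Qed.

Definition dunit : mor (unit_ob : T) (dual unit_ob) :=
  sval (cid (rmate_ex T_mon (T_dual unit_ob) (lun unit_ob))).

Lemma dunitE : ev unit_ob ∘ (dunit ⊗m idm unit_ob) = lun unit_ob.
Proof. by rewrite /dunit; case: cid. Qed.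

Lemma dunit_iso : is_iso dunit.
Proof.
exists (ev unit_ob ∘ runV (dual unit_ob)); split.
  rewrite -compmA -(runV_nat T_mon) compmA dunitE (lun1 T_mon).
  by case: (mo_runK T_mon (unit_ob : T)).
apply: (ev_inj T_rib); rewrite tcompm1 compmA dunitE tcompm1 (lun1 T_mon) compmA.
rewrite (mo_run_nat T_mon) -?compmA.
have -> : run (dual unit_ob ⊗ unit_ob) = run (dual unit_ob) ⊗m idm (unit_ob : T).
  apply: (iso_mono (ex_intro _ _ (mo_runK T_mon _))).
  by rewrite (mo_run_nat T_mon).
rewrite -tcompm1; have [_ ->] := mo_runK T_mon (dual unit_ob : T).
by rewrite bmap1.
Qed.

Lemma dprod_lun x :
  dprod unit_ob x ∘ (dunit ⊗m idm (dual x)) = dmor (lun x) ∘ lun (dual x).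
Proof.
apply: (ev_inj T_rib); rewrite /dprod -compmA (braidV_nat T_br).
rewrite !tcompm1 !compmA dmorE dtensE /pair_tens -?compmA.
rewrite -[idm (unit_ob ⊗ x)]bmap1 (assV_natK T_mon) bmap1.
rewrite (bmap_comp _ (idm (dual x))) comp1m (tail_ev_prel T_mon) dunitE.
have -> : tail_ev (lun unit_ob) x = lun x ∘ lun (unit_ob ⊗ x).
  by rewrite tail_ev.unlock (kelly_l T_mon).
rewrite tcomp1m -?compmA (compmA (_ ⊗m lun (unit_ob ⊗ x))) (triangle_run T_mon).
by rewrite -bmapM comp1m (braidV_unitl T_br).
Qed.

Lemma dprod_run x :
  dprod x unit_ob ∘ (idm (dual x) ⊗m dunit) = dmor (run x) ∘ run (dual x).
Proof.
apply: (ev_inj T_rib); rewrite /dprod -compmA (braidV_nat T_br).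
rewrite !tcompm1 !compmA dmorE dtensE /pair_tens -?compmA.
rewrite -[idm (x ⊗ unit_ob)]bmap1 (assV_natK T_mon) bmap1.
rewrite (bmap_comp _ dunit) comp1m bmap1 compm1 (tsplit dunit).
rewrite -?compmA (compmA (ev unit_ob)) dunitE (compmA (lun unit_ob)).
rewrite (mo_lun_nat T_mon) -?compmA (compmA (lun _)) (kelly_l' T_mon).
by rewrite -tcompm1 (braidV_unitr T_br) tail_ev_unit -?compmA.
Qed.

End DualProduct.

(** * Lax presheaves *)

(* [lax x y] plays the role of Hom(x ⊠ y, A); [lmul] is induced by the
   multiplication of A and [uni] by its unit. *)
Record lax_presheaf F (U V : braided F) := LaxPresheaf {
  lax :> U -> V -> lmodType F;
  pull : forall x x' y y', mor x' x -> mor y' y -> lax x y -> lax x' y';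
  lmul : forall x x' y y', lax x y -> lax x' y' -> lax (x ⊗ x') (y ⊗ y');
  uni : lax unit_ob unit_ob }.

Arguments pull {F U V} l {x x' y y'}.
Arguments lmul {F U V} l {x x' y y'}.

Record lax_laws F (U V : braided F) (P : lax_presheaf U V) : Prop := LaxLaws {
  pull_id : forall x y (p : P x y), pull P (idm x) (idm y) p = p;
  pull_pull : forall x x' x'' y y' y'' (f : mor x' x) (f' : mor x'' x')
      (g : mor y' y) (g' : mor y'' y') (p : P x y),
    pull P f' g' (pull P f g p) = pull P (f ∘ f') (g ∘ g') p;
  pull_lin : forall x x' y y' (f : mor x' x) (g : mor y' y) a (p q : P x y),
    pull P f g (a *: p + q) = a *: pull P f g p + pull P f g q;
  pull_linl : forall x x' y y' a (f f' : mor x' x) (g : mor y' y) (p : P x y),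
    pull P (a *: f + f') g p = a *: pull P f g p + pull P f' g p;
  pull_linr : forall x x' y y' (f : mor x' x) a (g g' : mor y' y) (p : P x y),
    pull P f (a *: g + g') p = a *: pull P f g p + pull P f g' p;
  lmul_pull : forall x1 x1' x2 x2' y1 y1' y2 y2' (f1 : mor x1' x1) (f2 : mor x2' x2)
      (g1 : mor y1' y1) (g2 : mor y2' y2) (p : P x1 y1) (q : P x2 y2),
    lmul P (pull P f1 g1 p) (pull P f2 g2 q) = pull P (f1 ⊗m f2) (g1 ⊗m g2) (lmul P p q);
  lmul_assoc : forall x x' x'' y y' y'' (p : P x y) (q : P x' y') (r : P x'' y''),
    pull P (assoc x x' x'') (assoc y y' y'') (lmul P (lmul P p q) r)
    = lmul P p (lmul P q r);
  lmul_unitl : forall x y (p : P x y), lmul P (uni P) p = pull P (lun x) (lun y) p;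
  lmul_unitr : forall x y (p : P x y), lmul P p (uni P) = pull P (run x) (run y) p;
  lmul_comm : forall x x' y y' (p : P x y) (q : P x' y'),
    pull P (braid x x') (braid y y') (lmul P q p) = lmul P p q }.

Definition univ F (U V : braided F) (P : lax_presheaf U V) (x : U) (s : V)
    (c : P x s) :=
  forall y (p : P x y), exists! g : mor y s, pull P (idm x) g c = p.

Section LaxTheory.
Variables (F : fieldType) (U V : braided F) (P : lax_presheaf U V).
Hypothesis P_laws : lax_laws P.
Implicit Types (x : U) (y s : V).

Lemma pull0 x x' y y' (f : mor x' x) (g : mor y' y) : pull P f g 0 = 0.
Proof.
have /esym/eqP := pull_lin P_laws f g 1 0 0.
by rewrite !scale1r addr0 -subr_eq0 addrK => /eqP.
Qed.

Lemma pull0l x x' y y' (g : mor y' y) (p : P x y) : pull P (0 : mor x' x) g p = 0.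
Proof.
have /esym/eqP := pull_linl P_laws 1 (0 : mor x' x) 0 g p.
by rewrite !scale1r addr0 -subr_eq0 addrK => /eqP.
Qed.

Lemma pull0r x x' y y' (f : mor x' x) (p : P x y) : pull P f (0 : mor y' y) p = 0.
Proof.
have /esym/eqP := pull_linr P_laws f 1 (0 : mor y' y) 0 p.
by rewrite !scale1r addr0 -subr_eq0 addrK => /eqP.
Qed.

Lemma pullD x x' y y' (f : mor x' x) (g : mor y' y) (p q : P x y) :
  pull P f g (p + q) = pull P f g p + pull P f g q.
Proof. by have := pull_lin P_laws f g 1 p q; rewrite !scale1r. Qed.

Lemma pullDl x x' y y' (f f' : mor x' x) (g : mor y' y) (p : P x y) :
  pull P (f + f') g p = pull P f g p + pull P f' g p.
Proof. by have := pull_linl P_laws 1 f f' g p; rewrite !scale1r. Qed.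

Lemma pullBl x x' y y' (f f' : mor x' x) (g : mor y' y) (p : P x y) :
  pull P (f - f') g p = pull P f g p - pull P f' g p.
Proof. by rewrite -scaleN1r addrC (pull_linl P_laws) scaleN1r addrC. Qed.

Lemma pull_sum x x' y y' (f : mor x' x) (g : mor y' y) (J : Type) (r : seq J)
    (p : J -> P x y) :
  pull P f g (\sum_(j <- r) p j) = \sum_(j <- r) pull P f g (p j).
Proof.
elim: r => [|j r IH]; first by rewrite !big_nil pull0.
by rewrite !big_cons pullD IH.
Qed.

Lemma pull_suml x x' y y' (J : Type) (r : seq J) (f : J -> mor x' x) (g : mor y' y)
    (p : P x y) :
  pull P (\sum_(j <- r) f j) g p = \sum_(j <- r) pull P (f j) g p.
Proof.
elim: r => [|j r IH]; first by rewrite !big_nil pull0l.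
by rewrite !big_cons pullDl IH.
Qed.

Lemma pullr x y y' y'' (g : mor y' y) (g' : mor y'' y') (p : P x y) :
  pull P (idm x) g' (pull P (idm x) g p) = pull P (idm x) (g ∘ g') p.
Proof. by rewrite (pull_pull P_laws) comp1m. Qed.

Lemma pulll x x' x'' y (f : mor x' x) (f' : mor x'' x') (p : P x y) :
  pull P f' (idm y) (pull P f (idm y) p) = pull P (f ∘ f') (idm y) p.
Proof. by rewrite (pull_pull P_laws) comp1m. Qed.

Lemma lmulp0 x x' y y' (p : P x y) : lmul P p (0 : P x' y') = 0.
Proof.
rewrite -(@pull0l x' x' y' y' (idm y') 0) -(pull_id P_laws p) (lmul_pull P_laws).
by rewrite bmap0r pull0l.
Qed.

Lemma lmul_pulll x1 x1' x2 y1 y1' y2 (f : mor x1' x1) (g : mor y1' y1)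
    (p : P x1 y1) (q : P x2 y2) :
  lmul P (pull P f g p) q = pull P (f ⊗m idm x2) (g ⊗m idm y2) (lmul P p q).
Proof. by rewrite -[q in LHS](pull_id P_laws) (lmul_pull P_laws). Qed.

Lemma lmul_pullr x1 x2 x2' y1 y2 y2' (f : mor x2' x2) (g : mor y2' y2)
    (p : P x1 y1) (q : P x2 y2) :
  lmul P p (pull P f g q) = pull P (idm x1 ⊗m f) (idm y1 ⊗m g) (lmul P p q).
Proof. by rewrite -[p in LHS](pull_id P_laws) (lmul_pull P_laws). Qed.

Lemma univ_ex x s (c : P x s) y (p : P x y) : univ c ->
  exists g : mor y s, pull P (idm x) g c = p.
Proof. by move=> uc; have [g [gP _]] := uc y p; exists g. Qed.

Lemma univ_inj x s (c : P x s) y (g g' : mor y s) : univ c ->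
  pull P (idm x) g c = pull P (idm x) g' c -> g = g'.
Proof.
move=> uc gg'; have [h [hP hu]] := uc y (pull P (idm x) g c).
by rewrite -(hu g) // -(hu g').
Qed.

Lemma univ_eq0 x s (c : P x s) y (g : mor y s) : univ c ->
  pull P (idm x) g c = 0 -> g = 0.
Proof. by move=> uc g0; apply: (univ_inj uc); rewrite g0 pull0r. Qed.

Lemma univ_intro x s (c : P x s) :
  (forall y (p : P x y), exists g : mor y s, pull P (idm x) g c = p) ->
  (forall y (g : mor y s), pull P (idm x) g c = 0 -> g = 0) -> univ c.
Proof.
move=> ex inj y p; have [g gp] := ex y p; exists g; split=> // g' g'p.
apply/eqP; rewrite -subr_eq0; apply/eqP; apply: inj.
by rewrite -scaleN1r addrC (pull_linr P_laws) gp g'p scaleN1r addNr.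
Qed.

Lemma univ_pull x x' s (c : P x s) (f : mor x' x) : is_iso f -> univ c ->
  univ (pull P f (idm s) c).
Proof.
move=> [f' [f'f ff']] uc.
have E y (g : mor y s) : pull P (idm x') g (pull P f (idm s) c)
    = pull P f (idm y) (pull P (idm x) g c).
  by rewrite !(pull_pull P_laws) !comp1m !compm1.
apply: univ_intro => [y p|y g].
  have [g gp] := univ_ex (pull P f' (idm y) p) uc; exists g.
  by rewrite E gp pulll f'f (pull_id P_laws).
rewrite E => g0; apply: (univ_eq0 uc).
by rewrite -[LHS](pull_id P_laws) -{1}ff' -pulll g0 pull0.
Qed.

Lemma univ_isol x x' s (c : P x s) : isomorphic x x' -> univ c ->
  exists c' : P x' s, univ c'.
Proof.
move=> /isomorphic_sym[f fi] uc; exists (pull P f (idm s) c); exact: univ_pull.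
Qed.

Lemma univ_iso x s s' (c : P x s) (c' : P x s') (g : mor s' s) :
  univ c -> univ c' -> pull P (idm x) g c = c' -> is_iso g.
Proof.
move=> uc uc' gc; have [g' gc'] := univ_ex c uc'.
exists g'; split; [apply: (univ_inj uc') | apply: (univ_inj uc)].
  by rewrite -pullr gc' gc (pull_id P_laws).
by rewrite -pullr gc gc' (pull_id P_laws).
Qed.

Lemma univ_uniq x s s' (c : P x s) (c' : P x s') : univ c -> univ c' -> isomorphic s s'.
Proof.
move=> uc uc'; have [g gc] := univ_ex c uc'; exists g; exact: univ_iso uc' uc gc.
Qed.

Lemma univ_isor x s s' (c : P x s) : isomorphic s s' -> univ c ->
  exists c' : P x s', univ c'.
Proof.
move=> [f [f' [f'f ff']]] uc; exists (pull P (idm x) f' c).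
apply: univ_intro => [y p|y g].
  have [g gp] := univ_ex p uc; exists (f ∘ g).
  by rewrite pullr compmA f'f comp1m.
by rewrite pullr => /(univ_eq0 uc) g0; rewrite -[g]comp1m -ff' -compmA g0 compm0.
Qed.

(** P turns a finite direct sum in the first variable into a product of presheaves, and [t], being
    also the product of the [s k], represents that product. *)
Lemma univ_dsum n (x : 'I_n -> U) (s : 'I_n -> V) z t (c : forall k, P (x k) (s k)) :
  (forall k, univ (c k)) -> is_dsum x z -> is_dsum s t -> exists c' : P z t, univ c'.
Proof.
move=> uc [i [p [pi pi0 ip]]] [j [q [qj qj0 jq]]].
exists (\sum_k pull P (p k) (q k) (c k)).
have E y (g : mor y t) k : pull P (i k) (idm y) (pull P (idm z) g (\sum_k pull P (p k) (q k) (c k)))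
    = pull P (idm (x k)) (q k ∘ g) (c k).
  rewrite (pull_pull P_laws) comp1m compm1 pull_sum (bigD1 k) //= big1 ?addr0.
    by rewrite (pull_pull P_laws) pi.
  by move=> l lk; rewrite (pull_pull P_laws) pi0 ?pull0l // eq_sym.
have joint y (p1 p2 : P z y) :
    (forall k, pull P (i k) (idm y) p1 = pull P (i k) (idm y) p2) -> p1 = p2.
  move=> p12; rewrite -(pull_id P_laws p1) -(pull_id P_laws p2) -ip !pull_suml.
  by apply: eq_bigr => k _; rewrite -!pulll p12.
apply: univ_intro => [y a|y g g0].
  have [g gP] := dep_choice (fun k => univ_ex (pull P (i k) (idm y) a) (uc k)).
  exists (\sum_k (j k ∘ g k)); apply: joint => k; rewrite E -gP.
  rewrite compm_sumr (bigD1 k) //= big1 ?addr0 ?compmA ?qj ?comp1m // => l lk.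
  by rewrite compmA qj0 ?comp0m.
apply: (dsum_eqr jq) => k; rewrite compm0; apply: (univ_eq0 (uc k)).
by rewrite -E g0 pull0.
Qed.

End LaxTheory.

Lemma dual_pair_iso F (T : braided F) (T_mon : monoidal T) (o d d' : T)
    (e : mor (d ⊗ o) unit_ob) (c : mor unit_ob (o ⊗ d)) (f : mor d' d) (g : mor d d') :
  inverses f g -> dual_pair e c ->
  dual_pair (e ∘ (f ⊗m idm o)) ((idm o ⊗m g) ∘ c).
Proof.
move=> [gf fg] [zig zag]; split; rewrite !(tcomp1m, tcompm1) -?compmA.
  rewrite (assV_natK T_mon) (compmA (idm o ⊗m (f ⊗m _))) -!bmapM fg.
  by rewrite !comp1m !bmap1 comp1m.
rewrite (ass_natK T_mon) bmap1 (compmA ((f ⊗m _) ⊗m _)) -(tsplit (f ⊗m _)).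
rewrite (tsplit' (f ⊗m _)) -?compmA (compmA (e ⊗m _)) -(tsplit e) (tsplit' e).
rewrite -?compmA (compmA (lun _)) (mo_lun_nat T_mon) -?compmA.
rewrite (compmA ((f ⊗m _) ⊗m idm d)) -(mo_ass_nat T_mon) -?compmA bmap1.
rewrite (compmA (f ⊗m _)) -(tsplit f) (tsplit' f) -?compmA (runV_nat T_mon).
transitivity (g ∘ (idm d ∘ f)); last by rewrite comp1m.
by rewrite -[in RHS]zag -?compmA.
Qed.

(** * The pairing between the representing objects of z and of dual z *)

Section Dualize.
Variables (F : fieldType) (U V : ribbon F) (P : lax_presheaf U V).
Hypotheses (U_rib : ribbon_category U) (V_rib : ribbon_category V).
Hypothesis P_laws : lax_laws P.
Variables (I : Type) (X : I -> U) (Y : I -> V) (e : forall i, P (X i) (Y i)).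
Hypothesis P_unit : univ (uni P).
Hypothesis P_one : forall x (p : P x unit_ob),
  exists! t : mor x unit_ob, pull P t (idm unit_ob) (uni P) = p.
Hypothesis P_nondeg : forall x y (p : P x y),
  (forall j (t : mor unit_ob (x ⊗ X j)), pull P t (idm (y ⊗ Y j)) (lmul P p (e j)) = 0) ->
  p = 0.
Let U_mon := ribbon_monoidal U_rib.
Let V_mon := ribbon_monoidal V_rib.
Let V_br := ribbon_braided V_rib.
Let U_dual := ribbon_dual U_rib.
Let V_dual := ribbon_dual V_rib.

Lemma pull_split x x' y y' (f : mor x' x) (g : mor y' y) (p : P x y) :
  pull P f g p = pull P f (idm y') (pull P (idm x) g p).
Proof. by rewrite (pull_pull P_laws) comp1m compm1. Qed.

Lemma pull_swap x x' y y' (f : mor x' x) (g : mor y' y) (p : P x y) :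
  pull P f (idm y') (pull P (idm x) g p) = pull P (idm x') g (pull P f (idm y) p).
Proof. by rewrite !(pull_pull P_laws) !comp1m !compm1. Qed.

Variables (z : U) (a b : V) (ca : P z a) (cb : P (dual z) b).
Hypotheses (ua : univ ca) (ub : univ cb).

Definition pairing : mor (a ⊗ b) unit_ob :=
  sval (cid (univ_ex (pull P (coev z) (idm (a ⊗ b)) (lmul P ca cb)) P_unit)).

Lemma pairingE :
  pull P (idm unit_ob) pairing (uni P) = pull P (coev z) (idm (a ⊗ b)) (lmul P ca cb).
Proof. by rewrite /pairing; case: cid. Qed.

Lemma pairing_pull y y' (g : mor y a) (g' : mor y' b) :
  pull P (coev z) (idm (y ⊗ y')) (lmul P (pull P (idm z) g ca) (pull P (idm (dual z)) g' cb))
  = pull P (idm unit_ob) (pairing ∘ (g ⊗m g')) (uni P).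
Proof.
by rewrite (lmul_pull P_laws) bmap1 pull_swap -pairingE (pullr P_laws).
Qed.

(** Every test in [P_nondeg] is a value of the pairing: [t] factors through [coev z] by some t' :
    dual z -> X j, and the pullback of [e j] along t' is a restriction of the universal element
    [cb]. *)
Lemma pairing_nondegl y (g : mor y a) : pairing ∘ (g ⊗m idm b) = 0 -> g = 0.
Proof.
move=> g0; apply: (univ_eq0 P_laws ua); apply: P_nondeg => j t.
have [t' ->] := lcomate_ex U_mon (U_dual z) t.
have [g' gE] := univ_ex (pull P t' (idm (Y j)) (e j)) ub.
rewrite -(pulll P_laws) -bmap1 -(lmul_pullr P_laws) -gE bmap1 pairing_pull.
by rewrite (tsplit g) compmA g0 comp0m (pull0r P_laws).
Qed.

(** Commutativity moves the tested element to the right factor; then the argument for the left side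
    applies, with [t] factored through [coev z] on its other leg. *)
Lemma pairing_nondegr y (g : mor y b) : pairing ∘ (idm a ⊗m g) = 0 -> g = 0.
Proof.
move=> g0; apply: (univ_eq0 P_laws ub); apply: P_nondeg => j t.
rewrite -(lmul_comm P_laws) (pull_pull P_laws) compm1.
have [t' ->] := rcomate_ex U_mon (U_dual z) (braid (dual z) (X j) ∘ t).
have [g' gE] := univ_ex (pull P t' (idm (Y j)) (e j)) ua.
rewrite -[braid y _]comp1m -(pull_pull P_laws) -bmap1 -(lmul_pulll P_laws) -gE.
rewrite pull_split pull_swap pairing_pull (tsplit' g') compmA g0 comp0m.
by rewrite (pull0r P_laws) (pull0 P_laws).
Qed.

(* Nondegeneracy makes the comparison map a -> b^* mono and its dual mono, hence the
   map is an isomorphism. *)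
Lemma pairing_dual : exists gamma : mor unit_ob (b ⊗ a), dual_pair pairing gamma.
Proof.
have [f fE] := rmate_ex V_mon (V_dual b) pairing.
suff [f' ff'] : is_iso f.
  exists ((idm b ⊗m f') ∘ coev b); rewrite -fE.
  exact: (dual_pair_iso V_mon ff' (V_dual b)).
have fm : is_mono f.
  apply: is_monoP => w g fg; apply: pairing_nondegl.
  by rewrite -fE -compmA -tcompm1 fg bmap0l compm0.
apply: (abelian_mono_epi (ribbon_abelian V_rib) fm) => v g h gh.
apply: (dmor_inj (T_rib := V_rib)).
suff dm : is_mono (dmor V_rib f) by apply: dm; rewrite -!dmorM gh.
apply: is_monoP => w k fk.
have k0 : ev (dual b) ∘ (k ⊗m f) = 0.
  by rewrite tsplit' compmA -dmorE -compmA -tcompm1 fk bmap0l compm0.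
(* The braiding moves [w] to the second slot. This turns [k], a map into the double dual of [b],
   into a map [g'] into [b], where nondegeneracy applies. *)
have [g' g'E] := lmate_ex V_mon (V_dual b)
  (ev (dual b) ∘ (k ⊗m idm (dual b)) ∘ braid (dual b) w).
have g'0 : g' = 0.
  apply: pairing_nondegr; rewrite -fE -compmA -tsplit tsplit' compmA g'E.
  by rewrite -!compmA (bt_brd_nat V_br) (compmA (k ⊗m _)) -tsplit compmA k0 comp0m.
apply: (ev_inj V_rib); rewrite bmap0l compm0.
apply: (iso_epi (ex_intro _ _ (bt_brdK V_br (dual b) w))).
by rewrite comp0m -g'E g'0 bmap0r compm0.
Qed.

Variable gamma : mor unit_ob (b ⊗ a).
Hypothesis gammaP : dual_pair pairing gamma.

Lemma contract_ex x (p : P x b) : exists t : mor (x ⊗ z) unit_ob,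
  pull P t (idm unit_ob) (uni P) = pull P (idm (x ⊗ z)) gamma (lmul P p ca).
Proof. by have [t [tE _]] := P_one (pull P (idm (x ⊗ z)) gamma (lmul P p ca)); exists t. Qed.

(** The right transpose of [t] along [coev z], with the unit removed. *)
Definition expand x (t : mor (x ⊗ z) unit_ob) : mor x (dual z) :=
  lun (dual z) ∘ ((t ⊗m idm (dual z)) ∘ (assoc x z (dual z)
    ∘ ((idm x ⊗m coev z) ∘ runV x))).

(** The triple product of [p], [ca] and [cb] is evaluated in two ways. Contracting [b] with [a] by
    [gamma] turns the first two factors into [t] and leaves [cb]; contracting [z] with [dual z]
    turns the last two into [pairing] and leaves [p], by a zigzag in V. *)
Lemma univ_full x (p : P x b) (t : mor (x ⊗ z) unit_ob) :
  pull P t (idm unit_ob) (uni P) = pull P (idm (x ⊗ z)) gamma (lmul P p ca) ->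
  pull P (expand t) (idm b) cb = p.
Proof.
move=> tE; have [zig _] := gammaP.
pose q := lmul P (lmul P p ca) cb.
have q_left : pull P (idm (x ⊗ z) ⊗m idm (dual z)) (gamma ⊗m idm b) q
    = pull P (lun (dual z) ∘ (t ⊗m idm (dual z))) (lun b) cb.
  rewrite -(lmul_pulll P_laws) -tE (lmul_pulll P_laws) (lmul_unitl P_laws).
  by rewrite (pull_pull P_laws) bmap1 compm1.
have q_right : pull P (assoc x z (dual z) ∘ (idm x ⊗m coev z)) (assoc b a b) q
    = pull P (run x) (run b ∘ (idm b ⊗m pairing)) p.
  rewrite -[assoc b a b]compm1 -(pull_pull P_laws) (lmul_assoc P_laws) -bmap1.
  rewrite -(lmul_pullr P_laws) -pairingE (lmul_pullr P_laws) (lmul_unitr P_laws).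
  by rewrite (pull_pull P_laws) bmap1 compm1.
have [_ lunK] := mo_lunK V_mon b; have [_ runK] := mo_runK U_mon x.
have [AV VA] := mo_assK V_mon b a b.
have <- : pull P (assoc x z (dual z) ∘ ((idm x ⊗m coev z) ∘ runV x))
    ((gamma ⊗m idm b) ∘ lunV b) q = pull P (expand t) (idm b) cb.
  rewrite -[X in pull P X _ q]comp1m -(pull_pull P_laws) -[X in pull P X _ q]bmap1.
  by rewrite q_left (pull_pull P_laws) lunK /expand -?compmA.
rewrite compmA -[_ ∘ lunV b]comp1m -VA -(compmA (assoc b a b)) -(pull_pull P_laws).
by rewrite q_right (pull_pull P_laws) runK -?compmA zig (pull_id P_laws).
Qed.

(** The chain behind it is Hom(y, b ⊗ s) = Hom(a ⊗ y, s) = P(x, a ⊗ y) = P(dual z ⊗ x, y), where the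
    last step multiplies by [ca] and restricts along [coev z]. The condition on [expand t] says that
    [t] is the evaluation of [z], which closes the zigzag in U. *)
Lemma univ_tens_ex x y s (c : P x s) (uc : univ c) :
  (exists t : mor (dual z ⊗ z) unit_ob,
    [/\ pull P t (idm unit_ob) (uni P) = pull P (idm (dual z ⊗ z)) gamma (lmul P cb ca)
      & expand t = idm (dual z)]) ->
  forall p : P (dual z ⊗ x) y, exists g : mor y (b ⊗ s),
    pull P (idm (dual z ⊗ x)) g (lmul P cb c) = p.
Proof.
move=> [t [tE t1]] p.
have [h hE] := univ_ex (pull P (tail_coev (coev z) x) (idm (a ⊗ y)) (lmul P ca p)) uc.
exists (ltranspose gamma h).
have -> : pull P (idm (dual z ⊗ x)) (ltranspose gamma h) (lmul P cb c)
   = pull P (idm (dual z ⊗ x)) (tail_coev gamma y)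
       (lmul P cb (pull P (idm x) h c)).
  by rewrite (lmul_pullr P_laws) (pull_pull P_laws) bmap1 comp1m.
rewrite hE (lmul_pullr P_laws) (pull_pull P_laws) bmap1 comp1m compm1.
rewrite -(lmul_assoc P_laws) (pull_pull P_laws).
have -> : assoc b a y ∘ tail_coev gamma y = (gamma ⊗m idm y) ∘ lunV y.
  rewrite tail_coev.unlock compmA; have [_ ->] := mo_assK V_mon b a y.
  by rewrite comp1m.
set w := assoc _ _ _ ∘ _.
have -> : pull P w ((gamma ⊗m idm y) ∘ lunV y) (lmul P (lmul P cb ca) p)
  = pull P w (lunV y) (pull P (idm _) (gamma ⊗m idm y) (lmul P (lmul P cb ca) p)).
  by rewrite (pull_pull P_laws) comp1m.
rewrite -[X in pull P X _ (lmul _ _ _)]bmap1 -(lmul_pulll P_laws) -tE.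
rewrite (lmul_pulll P_laws) (lmul_unitl P_laws) !(pull_pull P_laws) bmap1 comp1m.
have [_ ->] := mo_lunK V_mon y.
have -> : lun (dual z ⊗ x) ∘ (t ⊗m idm (dual z ⊗ x) ∘ w) = idm (dual z ⊗ x).
  transitivity (expand t ⊗m idm x); last by rewrite t1 bmap1.
  by rewrite /expand -(tail_zagzig U_mon) tail_ev.unlock -?compmA.
exact: (pull_id P_laws).
Qed.

(** Multiplying by [ca] and restricting along [coev z] recovers from the product the restriction of
    [c] along the transpose of [g]. *)
Lemma univ_tens_inj x y s (c : P x s) (g : mor y (b ⊗ s)) : univ c ->
  pull P (idm (dual z ⊗ x)) g (lmul P cb c) = 0 -> g = 0.
Proof.
move=> uc g0; have := congr1 (fun p => pull P (tail_coev (coev z) x) (idm (a ⊗ y)) (lmul P ca p)) g0.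
rewrite (lmulp0 P_laws) (pull0 P_laws) (lmul_pullr P_laws) (pull_pull P_laws) compm1.
rewrite bmap1 comp1m => E.
suff /(univ_eq0 P_laws uc) g'0 : pull P (idm x) (luntranspose pairing g) c = 0.
  rewrite -[g](luntransposeK V_mon gammaP) g'0 /ltranspose bmap0r comp0m.
  by [].
rewrite -[RHS]E -(lmul_assoc P_laws) (pull_pull P_laws).
have -> : assoc z (dual z) x ∘ tail_coev (coev z) x = (coev z ⊗m idm x) ∘ lunV x.
  rewrite tail_coev.unlock compmA; have [_ ->] := mo_assK U_mon z (dual z) x.
  by rewrite comp1m.
rewrite -[assoc a b s ∘ _]comp1m -(pull_pull P_laws) -[X in pull P _ X (lmul _ _ _)]bmap1.
rewrite -(lmul_pulll P_laws) -pairingE (lmul_pulll P_laws) (lmul_unitl P_laws).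
rewrite !(pull_pull P_laws) bmap1 comp1m; have [_ ->] := mo_lunK U_mon x.
by rewrite /luntranspose tail_ev.unlock -?compmA.
Qed.

End Dualize.

Lemma dual_pair_uniq F (T : braided F) (T_mon : monoidal T) (o d d' : T)
    (e : mor (d ⊗ o) unit_ob) (c : mor unit_ob (o ⊗ d))
    (e' : mor (d' ⊗ o) unit_ob) (c' : mor unit_ob (o ⊗ d')) :
  dual_pair e c -> dual_pair e' c' -> isomorphic d d'.
Proof.
move=> ec ec'; have [f fE] := rmate_ex T_mon ec' e.
have [g gE] := rmate_ex T_mon ec e'.
exists f, g; split.
  by apply: (rmate_uniq T_mon ec); rewrite tcompm1 compmA gE fE bmap1 compm1.
by apply: (rmate_uniq T_mon ec'); rewrite tcompm1 compmA fE gE bmap1 compm1.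
Qed.

Lemma sums_of_simples F (C : category F) (I : Type) (X : I -> C) n (c : 'I_n -> C) x :
  (forall k, exists i, isomorphic (c k) (X i)) -> is_dsum c x -> sums_of X x.
Proof.
by move=> /choice[i iP] cx; exists n, i; exact: dsum_component iP cx.
Qed.

(** * From the lax presheaf to the braid-reversed equivalence *)

Section Main.
Variables (F : fieldType) (U V : ribbon F) (P : lax_presheaf U V).
Hypotheses (U_rib : ribbon_category U) (V_rib : ribbon_category V).
Hypothesis U_ss : semisimple U.
Hypothesis P_laws : lax_laws P.
Variables (I : Type) (X : I -> U) (Y : I -> V) (e : forall i, P (X i) (Y i)).
Hypothesis P_unit : univ (uni P).
Hypothesis P_one : forall x (p : P x unit_ob),
  exists! t : mor x unit_ob, pull P t (idm unit_ob) (uni P) = p.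
Hypothesis P_nondeg : forall x y (p : P x y),
  (forall j (t : mor unit_ob (x ⊗ X j)), pull P t (idm (y ⊗ Y j)) (lmul P p (e j)) = 0) ->
  p = 0.
Hypothesis X_simple : forall i, simple (X i).
Hypothesis X_distinct : forall i j, isomorphic (X i) (X j) -> i = j.
Hypothesis Y_nonzero : forall i, idm (Y i) <> 0.
Hypothesis P_supp : forall x, simple x -> forall y (p : P x y), p <> 0 ->
  exists i, isomorphic x (X i).
Hypothesis P_rep : forall i, exists n (s : V) (c : P (X i) s),
  [/\ (0 < n)%N, is_dsum (fun _ : 'I_n => Y i) s & univ c].
Hypothesis X_unit : sums_of X (unit_ob : U).
Let U_mon := ribbon_monoidal U_rib.
Let V_mon := ribbon_monoidal V_rib.
Let U_br := ribbon_braided U_rib.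
Let V_br := ribbon_braided V_rib.
Let U_dual := ribbon_dual U_rib.
Let V_dual := ribbon_dual V_rib.
Let U_ab := ribbon_abelian U_rib.
Let V_ab := ribbon_abelian V_rib.
Local Notation UA := (sums_of X).
Local Notation VA := (sums_of Y).

(** By semisimplicity it is enough to treat simple objects. On a member of the family [P_rep]
    applies; on any other simple object P vanishes and a zero object represents it. *)
Lemma univ_exists x : exists (s : V) (c : P x s), univ c.
Proof.
have [n [d [ds dx]]] := U_ss x.
have [|sc scP] := @dep_choice _ (fun k => {s : V & P (d k) s}) (fun k sc => univ (tagged sc)).
  move=> k; have [[i di]|noi] := EM (exists i, isomorphic (d k) (X i)).
    have [m [s [c [_ _ uc]]]] := P_rep i.
    have [c' uc'] := univ_isol P_laws (isomorphic_sym di) uc.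
    by exists (existT _ s c').
  have p0 y (p : P (d k) y) : p = 0.
    by apply: contrapT => p0; apply: noi; exact: P_supp p0.
  have [s [i [q [_ _ s0]]]] := abelian_dsum V_ab (fun k : 'I_0 => unit_ob : V).
  exists (existT _ s (0 : P (d k) s)); apply: (univ_intro P_laws) => y p.
    by exists 0; rewrite (pull0 P_laws) (p0 _ p).
  by move=> _; rewrite -[p]comp1m -s0 big_ord0 comp0m.
have [t dt] := abelian_dsum V_ab (fun k => tag (sc k)).
have [c uc] := univ_dsum P_laws scP dx dt.
by exists t, c.
Qed.

Lemma univ_neq0 i s (c : P (X i) s) : univ c -> c <> 0.
Proof.
move=> uc c0; have [n [t [c' [n0 dt uc']]]] := P_rep i.
have [f [g [gf fg]]] := univ_uniq P_laws uc' uc.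
have s0 : idm s = 0.
  by apply: (univ_eq0 P_laws uc); rewrite (pull_id P_laws).
have [j [p [pj _ _]]] := dt.
case: (Y_nonzero (i := i)); rewrite -(pj (Ordinal n0)) -[j _]comp1m -gf -[f]comp1m s0.
by rewrite comp0m compm0 comp0m compm0.
Qed.

(** A nonzero restriction of [f] to a summand X_i has a retraction, so pulling back along it is onto
    P(X_i, -), which is not zero. *)
Lemma lax_faithful x v (f : mor x v) : UA x ->
  (forall y (q : P v y), pull P f (idm y) q = 0) -> f = 0.
Proof.
move=> [n [d [j [p [pj pj0 jp]]]]] f0.
apply: (dsum_eq jp) => k; rewrite comp0m; apply: contrapT => fj.
have [r rfj] := semisimple_retraction U_ab U_ss (X_simple (d k)) fj.
have [s [c uc]] := univ_exists (X (d k)).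
apply: (univ_neq0 uc); rewrite -(pull_id P_laws c) -rfj compmA -!(pulll P_laws).
by rewrite f0 (pull0 P_laws).
Qed.

(** Nondegeneracy for the universal element of X_i produces a nonzero t : 1 -> X_i ⊗ X_j. The mate
    of [t], and that of its braided form, are nonzero maps between simple objects. *)
Lemma dual_index i : exists j, isomorphic (dual (X i)) (X j) /\ isomorphic (dual (X j)) (X i).
Proof.
have [s [c uc]] := univ_exists (X i).
have [j [t t0]] : exists j, exists t : mor unit_ob (X i ⊗ X j), t <> 0.
  apply: contrapT => H; apply: (univ_neq0 uc); apply: P_nondeg => j t.
  have -> : t = 0 by apply: contrapT => t0; apply: H; exists j, t.
  by rewrite (pull0l P_laws).
have dX k := dual_simple U_rib U_ss (X_simple k).
exists j; split.
  have [k kE] := lcomate_ex U_mon (U_dual (X i)) t.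
  have k0 : k <> 0 by move=> k0; apply: t0; rewrite kE k0 bmap0r comp0m.
  by exists k; case: (simple_schur U_ab (dX i) (X_simple j) k).
have [k kE] := lcomate_ex U_mon (U_dual (X j)) (braid (X i) (X j) ∘ t).
have k0 : k <> 0.
  move=> k0; apply: t0; apply: (iso_mono (ex_intro _ _ (bt_brdK U_br (X i) (X j)))).
  by rewrite kE k0 bmap0r comp0m compm0.
by exists k; case: (simple_schur U_ab (dX j) (X_simple i) k).
Qed.

(** The duality arguments apply to objects of the form [dual z]; this brings every sum of the X_i
    into that form. *)
Lemma UA_dual_surj x : UA x -> exists2 z, UA z & isomorphic (dual z) x.
Proof.
move=> [n [d dx]]; have [j jP] := choice (fun k => dual_index (d k)).
have [z dz] := abelian_dsum U_ab (fun k => X (j k)).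
exists z; first by exists n, j.
apply: dsum_uniq dx; apply: dsum_component (dual_dsum U_rib dz) => k.
by case: (jP k).
Qed.

Lemma univ_tens x y s s' (c : P x s) (c' : P y s') : UA x -> univ c -> univ c' ->
  univ (lmul P c c').
Proof.
move=> xA uc uc'; have [z zA [f fi]] := UA_dual_surj xA.
have ub := univ_pull P_laws fi uc; have [a [ca ua]] := univ_exists z.
have [gamma gammaP] := pairing_dual U_rib V_rib P_laws P_unit P_nondeg ua ub.
have [t tE] := contract_ex P_one ca gamma (pull P f (idm s) c).
have fc := univ_full U_rib V_rib P_laws gammaP tE.
have dzA : UA (dual z).
  by apply: sums_of_iso xA; apply: isomorphic_sym; exists f.
(* [expand t] fixes the universal element by [fc], hence acts as the identity on all of P(dual z,
   -), and faithfulness applies. *)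
have t1 : expand t = idm (dual z).
  apply/eqP; rewrite -subr_eq0; apply/eqP; apply: lax_faithful => // y' q.
  have [g <-] := univ_ex q ub.
  rewrite (pull_swap P_laws) (pullBl P_laws) (pull_id P_laws).
  by rewrite fc subrr (pull0 P_laws).
pose cb := pull P f (idm s) c.
have ubc : univ (lmul P cb c').
  apply: (univ_intro P_laws) => w p; last first.
    exact: (univ_tens_inj U_rib V_rib P_laws gammaP uc').
  by apply: (univ_tens_ex U_rib V_rib P_laws uc'); exists t; split; [exact: tE|].
have [f' [f'f ff']] := fi.
have fi2 : is_iso (f' ⊗m idm y).
  by exists (f ⊗m idm y); apply: bmap_inverses (conj ff' f'f) (inverses_id y).
have := univ_pull P_laws fi2 ubc.
rewrite /cb (lmul_pulll P_laws) (pull_pull P_laws) -tcompm1 ff' !bmap1 comp1m.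
by rewrite (pull_id P_laws).
Qed.

(** Faithfulness for a source not yet known to be a sum of the X_i. The transpose of [f] starts at
    [y], which is one; elements over [z ⊗ v] are restrictions of a product of universal elements, on
    which the transpose acts through [f]. *)
Lemma lax_detect z y v (f : mor (dual z ⊗ y) v) : UA z -> UA y ->
  (forall w (q : P v w), pull P f (idm w) q = 0) -> f = 0.
Proof.
move=> zA yA f0.
rewrite -[f](ltransposeK U_mon (U_dual z)) (_ : ltranspose _ _ = 0).
  by rewrite /luntranspose bmap0r compm0.
apply: lax_faithful yA _ => w q.
have [a [ca ua]] := univ_exists z; have [b [cb ub]] := univ_exists v.
have [g <-] := univ_ex q (univ_tens zA ua ub).
rewrite (pull_swap P_laws) /ltranspose -(pulll P_laws) -bmap1 -(lmul_pullr P_laws).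
by rewrite f0 (lmulp0 P_laws) !(pull0 P_laws).
Qed.

(** On a simple summand outside the family P vanishes, so the projection onto it would be nonzero
    and yet undetected. *)
Lemma UA_semisimple x : (forall S (f : mor x S), simple S ->
    (forall w (q : P S w), pull P f (idm w) q = 0) -> f = 0) -> UA x.
Proof.
move=> xf; have [n [d [ds dx]]] := U_ss x; apply: sums_of_simples (dx) => k.
have [i [p [pi _ _]]] := dx.
apply: contrapT => nok; have [dk0 _] := ds k; apply: dk0; rewrite -(pi k).
rewrite (xf _ (p k)) ?comp0m // => w q.
have [->|q0] := EM (q = 0); first by rewrite (pull0 P_laws).
by case: nok; exact: P_supp q0.
Qed.

Lemma UA_tens x y : UA x -> UA y -> UA (x ⊗ y).
Proof.
move=> xA yA; have [z zA [f [f' [f'f ff']]]] := UA_dual_surj xA.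
apply: UA_semisimple => S h _ h0.
rewrite -[h]compm1 -bmap1 -ff' tcompm1 compmA.
rewrite (lax_detect (f := h ∘ (f ⊗m idm y)) zA yA) ?comp0m // => w q.
by rewrite -(pulll P_laws) h0 (pull0 P_laws).
Qed.

Lemma UA_dual x : UA x -> UA (dual x).
Proof.
move=> xA; apply: UA_semisimple => S h _ h0.
(* Replacing [dual x] by [dual x ⊗ unit_ob] gives the source the shape required by [lax_detect]. *)
apply: (iso_epi (ex_intro _ _ (mo_runK U_mon (dual x)))); rewrite comp0m.
apply: lax_detect xA X_unit _ => w q.
by rewrite -(pulll P_laws) h0 (pull0 P_laws).
Qed.

Lemma UA_ribbon : ribbon_subcategory UA.
Proof. by split=> //; [exact: UA_tens | exact: UA_dual]. Qed.

Lemma lax_full x s (c : P x s) x' (p : P x' s) : UA x -> univ c ->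
  exists f : mor x' x, pull P f (idm s) c = p.
Proof.
move=> xA uc; have [z zA [f fi]] := UA_dual_surj xA.
have ub := univ_pull P_laws fi uc; have [a [ca ua]] := univ_exists z.
have [gamma gammaP] := pairing_dual U_rib V_rib P_laws P_unit P_nondeg ua ub.
have [t tE] := contract_ex P_one ca gamma p.
have := univ_full U_rib V_rib P_laws gammaP tE.
by rewrite (pulll P_laws) => <-; exists (f ∘ expand t).
Qed.

(* By fullness every idempotent of the representing object Y_i^n comes from an
   endomorphism of the simple object X_i, so n = 1. *)
Lemma univ_Y i : exists c : P (X i) (Y i), univ c.
Proof.
have [n [s [c [n0 ds uc]]]] := P_rep i; have [j [p [pj pj0 jp]]] := ds.
suff n1 : n = 1%N.
  subst n; apply: (univ_isor P_laws _ uc); exists (p ord0), (j ord0).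
  by split; rewrite ?pj // -jp big_ord1.
apply/eqP; rewrite eqn_leq n0 andbT leqNgt; apply/negP => n1.
pose k0 := Ordinal n0; pose k1 := Ordinal n1.
have k01 : k1 != k0 by [].
have [f fE] := lax_full (pull P (idm (X i)) (j k0 ∘ p k0) c) (sums_of1 X i) uc.
case: (simple_schur U_ab (X_simple i) (X_simple i) f) => [f0|[f' [_ ff']]].
  have e0 : j k0 ∘ p k0 = 0.
    by apply: (univ_eq0 P_laws uc); rewrite -fE f0 (pull0l P_laws).
  case: (Y_nonzero (i := i)); rewrite -(pj k0) -[j k0]compm1 -(pj k0) (compmA (j k0)).
  by rewrite e0 comp0m compm0.
case: (Y_nonzero (i := i)); rewrite -(pj k1) (_ : j k1 = 0) ?compm0 //.
apply: (univ_eq0 P_laws uc).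
(* Undoing [f] turns the restriction of [c] along [j k1] into one that passes through
   [p k0 ∘ j k1 = 0]. *)
have := congr1 (pull P f' (j k1)) fE.
rewrite !(pull_pull P_laws) ff' !comp1m => ->.
by rewrite -compmA pj0 // compm0 (pull0r P_laws).
Qed.

(** Fullness turns [g] into a morphism X_j -> X_i of simple objects, which is zero or invertible,
    and so is [g]. *)
Lemma Y_schur i j (g : mor (Y i) (Y j)) : g = 0 \/ is_iso g /\ i = j.
Proof.
have [ci ui] := univ_Y i; have [cj uj] := univ_Y j.
have [g0|g0] := EM (g = 0); [by left | right].
have [f fE] := lax_full (pull P (idm (X j)) g cj) (sums_of1 X i) ui.
have f0 : f <> 0.
  by move=> f0; apply: g0; apply: (univ_eq0 P_laws uj); rewrite -fE f0 (pull0l P_laws).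
case: (simple_schur U_ab (X_simple j) (X_simple i) f) => // -[f' [f'f ff']].
split; last by apply/esym/X_distinct; exists f, f'.
have [g' g'E] := univ_ex (pull P f' (idm (Y j)) cj) ui.
exists g'; split; [apply: (univ_inj ui) | apply: (univ_inj uj)].
  rewrite -(pullr P_laws) g'E -(pull_swap P_laws) -fE (pulll P_laws) ff'.
  by rewrite !(pull_id P_laws).
rewrite -(pullr P_laws) -fE -(pull_swap P_laws) g'E (pulll P_laws) f'f.
by rewrite !(pull_id P_laws).
Qed.

Lemma VA_univ y : VA y -> exists2 x, UA x & exists c : P x y, univ c.
Proof.
move=> [n [d dy]]; have [x dx] := abelian_dsum U_ab (fun k => X (d k)).
have [c uc] := dep_choice (fun k => univ_Y (d k)).
by exists x; [exists n, d | exact: univ_dsum uc dx dy].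
Qed.

Lemma univ_VA x s (c : P x s) : UA x -> univ c -> VA s.
Proof.
move=> [n [d dx]] uc; have [y dy] := abelian_dsum V_ab (fun k => Y (d k)).
have [c' uc'] := dep_choice (fun k => univ_Y (d k)).
have [a ua] := univ_dsum P_laws uc' dx dy.
by exists n, d; apply: dsum_iso dy; exact: univ_uniq ua uc.
Qed.

Lemma univ_dual z a b (ca : P z a) (cb : P (dual z) b) : univ ca -> univ cb ->
  isomorphic a (dual b).
Proof.
move=> ua ub.
have [gamma gammaP] := pairing_dual U_rib V_rib P_laws P_unit P_nondeg ua ub.
exact: (dual_pair_uniq V_mon gammaP (V_dual b)).
Qed.

(** Closure is inherited through representing objects: products of universal elements are universal,
    and the representing objects of [z] and [dual z] are dual to each other. *)
Lemma VA_ribbon : ribbon_subcategory VA.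
Proof.
split=> [|x y xA yA|y yA].
- exact: univ_VA P_unit.
- have [x' x'A [c uc]] := VA_univ xA; have [y' y'A [d ud]] := VA_univ yA.
  exact: univ_VA (UA_tens x'A y'A) (univ_tens x'A uc ud).
- have [x xA [c uc]] := VA_univ yA; have [z zA zx] := UA_dual_surj xA.
  have [c' uc'] := univ_isol P_laws (isomorphic_sym zx) uc.
  have [a [ca ua]] := univ_exists z.
  exact: sums_of_iso (univ_dual ua uc') (univ_VA zA ua).
Qed.

Lemma dual_univ_exists x : exists sc : {s : V & P (dual x) s}, univ (tagged sc).
Proof. by have [s [c uc]] := univ_exists (dual x); exists (existT _ s c). Qed.

(** Representing objects depend contravariantly on the first variable; representing P(dual x, -)
    makes the assignment covariant in [x]. *)
Definition sob x : V := tag (sval (cid (dual_univ_exists x))).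
Definition sel x : P (dual x) (sob x) := tagged (sval (cid (dual_univ_exists x))).

Lemma sel_univ x : univ (sel x).
Proof. by rewrite /sel /sob; case: cid. Qed.

Arguments sel_univ : clear implicits.

Definition smap x y (f : mor x y) : mor (sob x) (sob y) :=
  sval (cid (univ_ex (pull P (dmor U_rib f) (idm (sob x)) (sel x)) (sel_univ y))).

Lemma smapE x y (f : mor x y) : pull P (idm (dual y)) (smap f) (sel y)
  = pull P (dmor U_rib f) (idm (sob x)) (sel x).
Proof. by rewrite /smap; case: cid. Qed.

Lemma smap1 x : smap (idm x) = idm (sob x).
Proof. by apply: (univ_inj (sel_univ x)); rewrite smapE dmor1. Qed.

Lemma smapM x y z (g : mor y z) (f : mor x y) : smap (g ∘ f) = smap g ∘ smap f.
Proof.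
apply: (univ_inj (sel_univ z)); rewrite smapE -(pullr P_laws) smapE dmorM.
by rewrite -(pull_swap P_laws) smapE (pulll P_laws).
Qed.

Lemma smap_lin x y k (f g : mor x y) : smap (k *: f + g) = k *: smap f + smap g.
Proof.
apply: (univ_inj (sel_univ y)); rewrite smapE dmorZD.
by rewrite (pull_linl P_laws) (pull_linr P_laws) !smapE.
Qed.

Lemma sob_VA x : UA x -> VA (sob x).
Proof. by move=> xA; exact: univ_VA (UA_dual xA) (sel_univ x). Qed.

Definition tau : functor (full_subcat UA) (full_subcat VA) :=
  @Functor F (full_subcat UA) (full_subcat VA)
    (fun x => exist VA (sob (sval x)) (sob_VA (svalP x)))
    (fun x y f => smap f)
    (fun x => smap1 (sval x)) (fun x y z => @smapM (sval x) (sval y) (sval z))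
    (fun x y => @smap_lin (sval x) (sval y)).

Lemma tau_equivalence : equivalence tau.
Proof.
apply: ff_equivalence => [x y f /= f0|x y g|[y yA]].
- apply: (dmor_inj (T_rib := U_rib)); rewrite dmor0.
  apply: lax_faithful (UA_dual (svalP y)) _ => w q.
  have [g <-] := univ_ex q (sel_univ (sval x)).
  by rewrite (pull_swap P_laws) -smapE f0 (pull0r P_laws) (pull0 P_laws).
- have [f' f'E] := lax_full (pull P (idm _) g (sel (sval y))) (UA_dual (svalP x)) (sel_univ (sval x)).
  have [f fE] := dmor_full U_rib f'; exists f.
  by apply: (univ_inj (sel_univ (sval y))); rewrite smapE fE f'E.
- have [x xA [c uc]] := VA_univ yA; have [z zA zx] := UA_dual_surj xA.
  exists (exist _ z zA).
  have [c' uc'] := univ_isol P_laws (isomorphic_sym zx) uc.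
  exact: (univ_uniq P_laws (sel_univ z) uc').
Qed.

Lemma sJ_ex x y : exists J : mor (sob x ⊗ sob y) (sob (x ⊗ y)),
  pull P (dprod U_rib x y) J (sel (x ⊗ y)) = lmul P (sel x) (sel y).
Proof.
have [d [dd' d'd]] := dprod_iso U_rib x y.
have [J JE] := univ_ex (pull P d (idm _) (lmul P (sel x) (sel y))) (sel_univ (x ⊗ y)).
by exists J; rewrite (pull_split P_laws) JE (pulll P_laws) dd' (pull_id P_laws).
Qed.

Definition sJ x y := sval (cid (sJ_ex x y)).

Lemma sJE x y : pull P (dprod U_rib x y) (sJ x y) (sel (x ⊗ y)) = lmul P (sel x) (sel y).
Proof. by rewrite /sJ; case: cid. Qed.

Lemma se_ex : exists u : mor unit_ob (sob unit_ob),
  pull P (dunit U_rib) u (sel unit_ob) = uni P.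
Proof.
have [d [dd' d'd]] := dunit_iso U_rib.
have [u uE] := univ_ex (pull P d (idm _) (uni P)) (sel_univ unit_ob).
by exists u; rewrite (pull_split P_laws) uE (pulll P_laws) dd' (pull_id P_laws).
Qed.

Definition se := sval (cid se_ex).

Lemma seE : pull P (dunit U_rib) se (sel unit_ob) = uni P.
Proof. by rewrite /se; case: cid. Qed.

(** Universality survives an isomorphism in the first variable, so the coherence laws of [sJ] can be
    tested after pulling back along [dprod], an associator or a unit isomorphism. *)
Lemma sel_inj x w y (f : mor w (dual x)) (g g' : mor y (sob x)) : is_iso f ->
  pull P f g (sel x) = pull P f g' (sel x) -> g = g'.
Proof.
move=> fi gg'; apply: (univ_inj (univ_pull P_laws fi (sel_univ x))).
by rewrite !(pull_pull P_laws) !comp1m !compm1.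
Qed.

Lemma sJ_iso x y : UA x -> UA y -> is_iso (sJ x y).
Proof.
move=> xA yA; apply: (univ_iso P_laws (univ_pull P_laws (dprod_iso U_rib x y) (sel_univ _))).
  exact: univ_tens (UA_dual xA) (sel_univ x) (sel_univ y).
by rewrite (pull_pull P_laws) compm1 comp1m sJE.
Qed.

Lemma se_iso : is_iso se.
Proof.
apply: (univ_iso P_laws (univ_pull P_laws (dunit_iso U_rib) (sel_univ _)) P_unit).
by rewrite (pull_pull P_laws) compm1 comp1m seE.
Qed.

Lemma sJ_nat x x' y y' (f : mor x x') (g : mor y y') :
  sJ x' y' ∘ (smap f ⊗m smap g) = smap (f ⊗m g) ∘ sJ x y.
Proof.
apply: (sel_inj (dprod_iso U_rib x' y')).
rewrite -[dprod _ _ _ in LHS]compm1 -(pull_pull P_laws) sJE -bmap1 -(lmul_pull P_laws).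
rewrite !smapE (lmul_pull P_laws) bmap1 -sJE (pull_pull P_laws) compm1 dprod_nat.
by rewrite -[X in _ = pull P X _ _]comp1m -(pull_pull P_laws) smapE (pull_pull P_laws) comp1m.
Qed.

Lemma smap_pull x y w v (f : mor x y) (h : mor w (dual y)) (g : mor v (sob x)) :
  pull P h (smap f ∘ g) (sel y) = pull P (dmor U_rib f ∘ h) g (sel x).
Proof. by rewrite -[h in LHS]comp1m -(pull_pull P_laws) smapE (pull_pull P_laws) comp1m. Qed.

Lemma sJ_pull x y w v (h : mor w _) (g : mor v _) :
  pull P (dprod U_rib x y ∘ h) (sJ x y ∘ g) (sel (x ⊗ y)) = pull P h g (lmul P (sel x) (sel y)).
Proof. by rewrite -sJE (pull_pull P_laws). Qed.

Lemma sJ_assoc x y z :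
  smap (assoc x y z) ∘ sJ x (y ⊗ z) ∘ (idm (sob x) ⊗m sJ y z)
  = sJ (x ⊗ y) z ∘ (sJ x y ⊗m idm (sob z)) ∘ assoc (sob x) (sob y) (sob z).
Proof.
have di : is_iso (dprod U_rib (x ⊗ y) z ∘ ((dprod U_rib x y ⊗m idm (dual z))
    ∘ assoc (dual x) (dual y) (dual z))).
  apply: iso_comp (dprod_iso U_rib _ _) _; apply: iso_comp.
    have [d dd] := dprod_iso U_rib x y.
    by exists (d ⊗m idm _); apply: bmap_inverses dd (inverses_id _).
  by exists (assocV (dual x) (dual y) (dual z)); exact: mo_assK.
apply: (sel_inj di); rewrite -(compmA (smap _)) -(compmA (sJ (x ⊗ y) z)).
rewrite smap_pull dprod_assoc !sJ_pull -(lmul_pullr P_laws) sJE.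
by rewrite -(pull_pull P_laws) -(lmul_pulll P_laws) sJE (lmul_assoc P_laws).
Qed.

Lemma sJ_lun x :
  smap (lun x) ∘ sJ unit_ob x ∘ (se ⊗m idm (sob x)) = lun (sob x).
Proof.
apply: (@sel_inj _ _ _ (lun (dual x))); first by exists (lunV (dual x)); exact: mo_lunK.
rewrite -compmA smap_pull -dprod_lun sJ_pull -(lmul_pulll P_laws) seE.
exact: lmul_unitl.
Qed.

Lemma sJ_run x :
  smap (run x) ∘ sJ x unit_ob ∘ (idm (sob x) ⊗m se) = run (sob x).
Proof.
apply: (@sel_inj _ _ _ (run (dual x))); first by exists (runV (dual x)); exact: mo_runK.
rewrite -compmA smap_pull -dprod_run sJ_pull -(lmul_pullr P_laws) seE.
exact: lmul_unitr.
Qed.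

(** Commutativity braids both variables of P at once, so a braiding on the U side is matched by the
    inverse braiding on the V side. *)
Lemma sJ_braid x y :
  smap (braid x y) ∘ sJ x y = sJ y x ∘ braidV (sob y) (sob x).
Proof.
apply: (sel_inj (dprod_iso U_rib y x)).
rewrite smap_pull dprod_braid -[sJ x y]compm1 sJ_pull.
rewrite -[dprod _ _ _]compm1 sJ_pull -(lmul_comm P_laws (sel y) (sel x)) (pull_pull P_laws) compm1.
by have [_ ->] := bt_brdK V_br (sob y) (sob x).
Qed.

Lemma tau_braid_reversed :
  @braid_reversed_equivalence F (sub_braided UA_ribbon) (sub_braided VA_ribbon) tau.
Proof.
split; first exact: tau_equivalence.
exists (fun x y => sJ (sval x) (sval y)), se; split=> /=.
- by move=> x y; have [g gP] := sJ_iso (svalP x) (svalP y); exists g.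
- by have [g gP] := se_iso; exists g.
- by move=> *; exact: sJ_nat.
- by move=> *; exact: sJ_assoc.
- by move=> *; exact: sJ_lun.
- by move=> *; exact: sJ_run.
- by move=> *; exact: sJ_braid.
Qed.

Lemma tau_index i : isomorphic (sob (X i)) (dual (Y i)).
Proof.
have [j [ij ji]] := dual_index i; have [c uc] := univ_Y i.
have [c' uc'] := univ_isol P_laws (isomorphic_sym ji) uc.
have [d ud] := univ_isol P_laws ij (sel_univ (X i)).
exact: univ_dual ud uc'.
Qed.

Let VA_cat := full_subcat VA.
Let Ysub i : VA_cat := exist VA (Y i) (sums_of1 Y i).

Lemma VA_schur i j (g : mor (Ysub i) (Ysub j)) : g = 0 \/ is_iso g.
Proof. by case: (Y_schur (g : mor (Y i) (Y j))) => [|[]]; [left | right]. Qed.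

Lemma VA_sums (y : VA_cat) : sums_of Ysub y.
Proof. by have [n [c cy]] := svalP y; exists n, c. Qed.

Lemma VA_dsum n (c : 'I_n -> VA_cat) : exists s, is_dsum c s.
Proof.
have [s cs] := abelian_dsum V_ab (fun k => sval (c k)).
by exists (exist VA s (sums_of_dsum (fun k => svalP (c k)) cs)).
Qed.

Lemma lax_reversed_equivalence :
  exists (UA_sub : ribbon_subcategory UA) (VA_sub : ribbon_subcategory VA),
    let UAc := sub_braided UA_sub in
    let VAc := sub_braided VA_sub in
    [/\ abelian VAc, semisimple VAc,
        forall i, exists Yi : VAc, sval Yi = Y i /\ simple Yi,
        forall i j, isomorphic (Y i) (Y j) -> i = j
      & forall y : VAc, simple y -> exists i, isomorphic (sval y) (Y i)] /\
    exists t : functor UAc VAc,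
      braid_reversed_equivalence t /\
      forall i, exists Xi : UAc,
        sval Xi = X i /\ isomorphic (sval (t Xi)) (dual (Y i)).
Proof.
exists UA_ribbon, VA_ribbon; split; first split.
- exact: schur_abelian VA_schur VA_sums VA_dsum.
- apply: (schur_semisimple _ VA_schur VA_sums) => i; exact: Y_nonzero.
- move=> i; exists (Ysub i); split=> //.
  apply: (schur_simple _ VA_schur VA_sums) => j; exact: Y_nonzero.
- move=> i j [g gi]; case: (Y_schur g) => [g0|[]//].
  by case: (iso_neq0 (Y_nonzero (i := i)) gi).
- move=> y ys; have [|i yi] := simple_in_family _ VA_sums ys; last by exists i.
  by move=> j; exact: Y_nonzero.
exists tau; split; first exact: tau_braid_reversed.
move=> i; exists (exist _ (X i) (sums_of1 X i)); split=> //; exact: tau_index.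
Qed.

End Main.

(** * Morphism spaces of the Deligne product *)

(** A basis together with its dual basis. Explicit linear coordinates are needed to define
    [power_ev]; [has_dim] provides only unique coefficient rows. *)
Definition coords (F : fieldType) (M : lmodType F) n (b : 'I_n -> M)
    (c : 'I_n -> M -> F) :=
  [/\ forall k a u v, c k (a *: u + v) = a * c k u + c k v,
      forall k l, c k (b l) = (k == l)%:R
    & forall v, v = \sum_k c k v *: b k].

Definition finite_dim (F : fieldType) (M : lmodType F) :=
  exists n (b : 'I_n -> M) c, coords b c.

Section FiniteDimension.
Variable F : fieldType.
Implicit Types M N : lmodType F.

Lemma coords0 M n (b : 'I_n -> M) c : coords b c -> forall k, c k 0 = 0.
Proof.
move=> [clin _ _] k; have /esym/eqP := clin k 1 0 0.
by rewrite scale1r addr0 mul1r -subr_eq0 addrK => /eqP.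
Qed.

Lemma has_dim_coords M n : has_dim M n -> exists (b : 'I_n -> M) c, coords b c.
Proof.
move=> [b bP]; exists b.
have [a aP] := dep_choice bP.
exists (fun k v => a v 0 k).
have uniq v (w : 'rV[F]_n) : v = \sum_k w 0 k *: b k -> a v = w by case: (aP v) => _; apply.
split=> [k r u v|k l|v]; last by case: (aP v).
  rewrite (uniq _ (r *: a u + a v)) ?mxE //.
  have [uE _] := aP u; have [vE _] := aP v; rewrite {1}uE {1}vE.
  rewrite scaler_sumr -big_split; apply: eq_bigr => i _.
  by rewrite !mxE scalerDl scalerA.
rewrite (uniq _ (delta_mx 0 l)) ?mxE // (bigD1 l) //= big1 ?addr0 ?mxE ?eqxx ?scale1r //.
by move=> i il; rewrite mxE (negbTE il) scale0r.
Qed.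

Lemma finite_dim_iso M N (f : M -> N) (g : N -> M) :
  (forall a u v, f (a *: u + v) = a *: f u + f v) -> cancel f g -> cancel g f ->
  finite_dim M -> finite_dim N.
Proof.
move=> flin fg gf [n [b [c bc]]]; exists n, (f \o b), (fun k => c k \o g).
have [clin cb cE] := bc.
split=> [k a u v|k l|v] /=.
- by rewrite -clin; congr (c k _); apply: (can_inj fg); rewrite flin !gf.
- by rewrite fg.
have f0 : f 0 = 0.
  by have /esym/eqP := flin 1 0 0; rewrite !scale1r addr0 -subr_eq0 addrK => /eqP.
rewrite -{1}[v]gf [g v in LHS]cE.
have -> (r : seq 'I_n) (a : 'I_n -> F) (w : 'I_n -> M) :
    f (\sum_(k <- r) a k *: w k) = \sum_(k <- r) a k *: f (w k).
  by elim: r => [|k r IH]; rewrite ?big_nil // !big_cons flin IH.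
by [].
Qed.

Lemma finite_dim_sum (m : nat) (N : 'I_m -> lmodType F) M
    (i : forall k, N k -> M) (p : forall k, M -> N k) :
  (forall k a u v, i k (a *: u + v) = a *: i k u + i k v) ->
  (forall k a u v, p k (a *: u + v) = a *: p k u + p k v) ->
  (forall k v, p k (i k v) = v) -> (forall k l v, k != l -> p l (i k v) = 0) ->
  (forall v, v = \sum_k i k (p k v)) ->
  (forall k, finite_dim (N k)) -> finite_dim M.
Proof.
move=> ilin plin pi pi0 ip Nfin.
have [n nP] := dep_choice Nfin.
have [b bP] := dep_choice nP.
have [c cP] := dep_choice bP.
pose T := {k : 'I_m & 'I_(n k)}.
pose b' (t : T) := i (tag t) (b (tag t) (tagged t)).
pose c' (t : T) v := c (tag t) (tagged t) (p (tag t) v).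
have c'b' t s : c' t (b' s) = (t == s)%:R.
  case: t s => [k j] [l j']; rewrite /c' /b' /=.
  have [lk|lk] := eqVneq l k; last first.
    rewrite pi0 // (coords0 (cP k)); case: eqP => // - [kl _].
    by rewrite kl eqxx in lk.
  subst l; rewrite pi; have [_ -> _] := cP k; congr (nat_of_bool _)%:R.
  by apply/eqP/eqP => [->|/eqP]; rewrite // -tag_eqE /tag_eq /= eqxx tagged_asE => /eqP.
have i0 k : i k 0 = 0.
  by have /esym/eqP := ilin k 1 0 0; rewrite !scale1r addr0 -subr_eq0 addrK => /eqP.
have isum k (r : seq 'I_(n k)) (a : 'I_(n k) -> F) (w : 'I_(n k) -> N k) :
    i k (\sum_(j <- r) a j *: w j) = \sum_(j <- r) a j *: i k (w j).
  by elim: r => [|j r IH]; rewrite ?big_nil // !big_cons ilin IH.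
exists #|{: T}|, (b' \o enum_val), (fun k => c' (enum_val k)); split=> [k a u v|k l|v] /=.
- by rewrite /c' plin; have [-> _ _] := cP (tag (enum_val k)).
- by rewrite c'b' (inj_eq enum_val_inj).
- transitivity (\sum_(t : T) c' t v *: b' t); last first.
    by rewrite (reindex _ (onW_bij _ (@enum_val_bij T))).
  transitivity (\sum_k \sum_j (c k j (p k v) *: i k (b k j))); last first.
    by rewrite (sig_big_dep _ (fun _ => xpredT)).
  rewrite {1}[v]ip; apply: eq_bigr => k _.
  by have [_ _ cE] := cP k; rewrite {1}[p k v]cE isum.
Qed.

End FiniteDimension.

(** * Finite dimensionality of the morphism spaces of U *)

Section HomDimension.
Variables (F : fieldType) (U : ribbon F).
Hypotheses (U_rib : ribbon_category U) (U_ss : semisimple U).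
Hypothesis one_dim : finite_dim (mor (unit_ob : U) unit_ob).
Hypothesis one_simple : simple (unit_ob : U).
Let U_mon := ribbon_monoidal U_rib.
Let U_ab := ribbon_abelian U_rib.

(** A simple summand of [z] either admits only the zero map to the unit or is isomorphic to it, so
    the space is a finite sum of copies of End(1). *)
Lemma hom_unit_dim z : finite_dim (mor z (unit_ob : U)).
Proof.
have [n [c [cs [i [p [pi pi0 ip]]]]]] := U_ss z.
apply: (@finite_dim_sum _ _ (fun k => mor (c k) unit_ob) _
    (fun k f => f ∘ p k) (fun k f => f ∘ i k)).
- by move=> k a u v; rewrite compm_linl.
- by move=> k a u v; rewrite compm_linl.
- by move=> k v; rewrite -compmA pi compm1.
- by move=> k l v kl; rewrite -compmA pi0 ?compm0 // eq_sym.
- move=> v; rewrite -[v in LHS]compm1 -ip compm_sumr.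
  by apply: eq_bigr => k _; rewrite compmA.
move=> k; have [[f f0]|nof] := EM (exists f : mor (c k) unit_ob, f <> 0).
  case: (simple_schur U_ab (cs k) one_simple f) => // -[g [gf fg]].
  apply: (finite_dim_iso (f := fun h => h ∘ f) (g := fun h => h ∘ g) _ _ _ one_dim).
  - by move=> a u v; rewrite compm_linl.
  - by move=> h; rewrite -compmA fg compm1.
  - by move=> h; rewrite -compmA gf compm1.
exists 0%N, (fun _ => 0), (fun _ _ => 0); split=> [[]|[]|v] //.
rewrite big_ord0; apply: contrapT => v0; apply: nof; by exists v.
Qed.

(** Mates identify Hom(x, y) with Hom(dual y ⊗ x, 1). *)
Lemma hom_dim (x y : U) : finite_dim (mor x y).
Proof.
have ec := ribbon_dual U_rib y.
have [g gP] := dep_choice (fun h : mor (dual y ⊗ x) unit_ob => lmate_ex U_mon ec h).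
apply: (finite_dim_iso (f := g) (g := fun h => ev y ∘ (idm (dual y) ⊗m h)) _ _ _
  (hom_unit_dim (dual y ⊗ x))).
- move=> a u v; apply: (lmate_uniq U_mon ec).
  by rewrite gP bmap_linr compm_linr !gP.
- by move=> h; rewrite gP.
- by move=> h; apply: (lmate_uniq U_mon ec); rewrite gP.
Qed.

End HomDimension.

(** * The Kunneth formula from the universal property *)

Section Kunneth.
Variables (F : fieldType) (U V C : category F) (B : bifunctor U V C).
Hypotheses (U_ab : abelian U) (U_ss : semisimple U) (V_ab : abelian V) (C_ab : abelian C).
Hypothesis B_univ : deligne_universal B.
Variable x0 : U.
Hypothesis hom_x0 : forall x : U, finite_dim (mor x x0).

Let n x := sval (cid (hom_x0 x)).
Let n_ex x : exists (b : 'I_(n x) -> mor x x0) c, coords b c := svalP (cid (hom_x0 x)).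
Let b x := sval (cid (n_ex x)).
Let b_ex x : exists c, coords (@b x) c := svalP (cid (n_ex x)).
Let c x := sval (cid (b_ex x)).
Let bc x : coords (@b x) (@c x) := svalP (cid (b_ex x)).

(* [power x y] is the object Hom(x, x0)^* ⊗ y of V. *)
Let power_ex x (y : V) : exists s, is_dsum (fun _ : 'I_(n x) => y) s :=
  abelian_dsum V_ab _.
Definition power x y : V := sval (cid (power_ex x y)).
Let inj_ex x y : is_dsum (fun _ : 'I_(n x) => y) (power x y) := svalP (cid (power_ex x y)).
Let inj x y : forall k : 'I_(n x), mor y (power x y) := sval (cid (inj_ex x y)).
Let prj_ex x y := svalP (cid (inj_ex x y)).
Let prj x y : forall k : 'I_(n x), mor (power x y) y := sval (cid (prj_ex x y)).
Let injP x y : [/\ forall k, prj y k ∘ inj y k = idm y,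
        forall k l, k != l -> prj y l ∘ inj y k = 0
      & \sum_(k < n x) (inj y k ∘ prj y k) = idm (power x y)] :=
  svalP (cid (prj_ex x y)).

(** Evaluation at [f], as a map from Hom(x, x0)^* ⊗ y to [y]. By [power_ext] these maps are jointly
    monic, so later identities avoid the chosen basis. *)
Definition power_ev x y (f : mor x x0) : mor (power x y) y :=
  \sum_k c k f *: prj y k.

Lemma power_ev_lin x y a (f g : mor x x0) :
  power_ev y (a *: f + g) = a *: power_ev y f + power_ev y g.
Proof.
have [clin _ _] := bc x.
rewrite /power_ev scaler_sumr -big_split; apply: eq_bigr => k _.
by rewrite clin scalerDl scalerA.
Qed.

Lemma power_ev0 x y : power_ev y (0 : mor x x0) = 0.
Proof. by rewrite /power_ev big1 // => k _; rewrite (coords0 (bc x)) scale0r. Qed.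

Lemma power_ev_sum x y (J : Type) (r : seq J) (a : J -> F) (f : J -> mor x x0) :
  power_ev y (\sum_(j <- r) a j *: f j) = \sum_(j <- r) a j *: power_ev y (f j).
Proof.
elim: r => [|j r IH]; first by rewrite !big_nil power_ev0.
by rewrite !big_cons power_ev_lin IH.
Qed.

Lemma power_ev_basis x y (k : 'I_(n x)) : power_ev y (b k) = prj y k.
Proof.
have [_ cb _] := bc x; rewrite /power_ev (bigD1 k) //= big1 ?addr0.
  by rewrite cb eqxx scale1r.
by move=> l lk; rewrite cb (negbTE lk) scale0r.
Qed.

Lemma power_ext x y w (h h' : mor w (power x y)) :
  (forall f, power_ev y f ∘ h = power_ev y f ∘ h') -> h = h'.
Proof.
have [_ _ ip] := injP x y; move=> hh'; apply: (dsum_eqr ip) => k.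
by rewrite -!power_ev_basis hh'.
Qed.

Definition power_map x x' y y' (f : mor x x') (g : mor y y') :
    mor (power x y) (power x' y') :=
  \sum_k inj y' k ∘ (g ∘ power_ev y (b k ∘ f)).

Lemma power_mapE x x' y y' (f : mor x x') (g : mor y y') (h : mor x' x0) :
  power_ev y' h ∘ power_map f g = g ∘ power_ev y (h ∘ f).
Proof.
have prjE k : prj y' k ∘ power_map f g = g ∘ power_ev y (b k ∘ f).
  have [pi pi0 _] := injP x' y'; rewrite compm_sumr (bigD1 k) //= big1 ?addr0.
    by rewrite compmA pi comp1m.
  by move=> l lk; rewrite compmA pi0 ?comp0m.
rewrite {1}/power_ev compm_suml.
under eq_bigr => k _ do rewrite compmZl prjE -compmZr.
have [_ _ cE] := bc x'; rewrite -compm_sumr -power_ev_sum; congr (g ∘ power_ev _ _).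
rewrite {2}[h]cE compm_suml; apply: eq_bigr => k _; by rewrite compmZl.
Qed.

Lemma power_map1 x y : power_map (idm x) (idm y) = idm (power x y).
Proof. by apply: power_ext => f; rewrite power_mapE comp1m !compm1. Qed.

Lemma power_mapM x x' x'' y y' y'' (f' : mor x' x'') (f : mor x x')
    (g' : mor y' y'') (g : mor y y') :
  power_map (f' ∘ f) (g' ∘ g) = power_map f' g' ∘ power_map f g.
Proof.
apply: power_ext => h; rewrite power_mapE (compmA (power_ev _ _)) power_mapE.
by rewrite -[in RHS](compmA g') power_mapE !compmA.
Qed.

Lemma power_map_linl x x' y y' a (f f' : mor x x') (g : mor y y') :
  power_map (a *: f + f') g = a *: power_map f g + power_map f' g.
Proof.
apply: power_ext => h; rewrite compm_linr !power_mapE compm_linr power_ev_lin.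
by rewrite compm_linr.
Qed.

Lemma power_map_linr x x' y y' a (f : mor x x') (g g' : mor y y') :
  power_map f (a *: g + g') = a *: power_map f g + power_map f g'.
Proof.
by apply: power_ext => h; rewrite compm_linr !power_mapE compm_linl.
Qed.

Definition power_functor : bifunctor U V V :=
  @Bifunctor F U V V power power_map power_map1 power_mapM power_map_linl power_map_linr.

(** In the first variable cokernels split, hence are preserved; in the second the functor is a
    finite power, and a finite power of a cokernel is a cokernel. *)
Lemma power_birex : birex power_functor.
Proof.
split=> [u x y z f g fg|u x y z f g fg].
  have [s [r [gs sg]]] := semisimple_cokernel U_ab U_ss fg; have [gf _] := fg.
  split=> [|v h hf] /=.
    rewrite -power_mapM gf comp1m; exact: (bmap0l power_functor).
  exists (h ∘ power_map s (idm u)); split=> [|k <-].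
    rewrite -compmA -power_mapM comp1m.
    have -> : s ∘ g = idm y - f ∘ r by rewrite -sg addrK.
    have -> : power_map (idm y - f ∘ r) (idm u)
        = idm _ - power_map f (idm u) ∘ power_map r (idm u).
      rewrite -power_mapM comp1m -scaleN1r addrC power_map_linl power_map1.
      by rewrite scaleN1r addrC.
    by rewrite compmBr compm1 compmA hf comp0m subr0.
  by rewrite -compmA -power_mapM gs comp1m power_map1 compm1.
have ge := cokernel_epi fg; have [gf gK] := fg.
have [pz pz0 ipz] := injP u z; have [py py0 ipy] := injP u y.
have mapi y1 y2 (h : mor y1 y2) k : power_map (idm u) h ∘ inj y1 k = inj y2 k ∘ h.
  have [p1 p10 ip1] := injP u y1; have [p2 p20 ip2] := injP u y2.
  apply: (dsum_eqr ip2) => l; rewrite compmA -power_ev_basis power_mapE compm1.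
  rewrite !power_ev_basis -compmA (compmA (prj y2 l)).
  have [->|kl] := eqVneq k l; first by rewrite p1 p2 compm1 comp1m.
  by rewrite p10 // p20 // compm0 comp0m.
split=> [|v h hf] /=.
  rewrite -power_mapM gf comp1m; exact: (bmap0r power_functor).
have [h' h'E] := dep_choice (fun k => gK _ (h ∘ inj y k)
  (etrans (esym (compmA _ _ _)) (etrans (congr1 _ (esym (mapi _ _ f k)))
    (etrans (compmA _ _ _) (etrans (congr1 (fun a => a ∘ inj x k) hf) (comp0m _ _)))))).
exists (\sum_k h' k ∘ prj z k); split=> [|h'' h''E].
  apply: (dsum_eq ipy) => k; rewrite -compmA mapi compmA compm_suml (bigD1 k) //= big1 ?addr0.
    by rewrite -(compmA (h' k)) pz compm1; case: (h'E k).
  by move=> l lk; rewrite -compmA pz0 ?compm0 // eq_sym.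
apply: (dsum_eq ipz) => k; rewrite compm_suml (bigD1 k) //= big1 ?addr0; last first.
  by move=> l lk; rewrite -compmA pz0 ?compm0 // eq_sym.
rewrite -compmA pz compm1; have [_ hu] := h'E k; apply: hu.
by rewrite -compmA -mapi compmA h''E.
Qed.

Definition slot : functor V C :=
  @Functor F V C (fun y => B x0 y) (fun y y' g => bmap B (idm x0) g)
    (fun y => bmap1 B x0 y)
    (fun y y' y'' g f => etrans (congr1 (fun k => bmap B k (g ∘ f)) (esym (comp1m (idm x0))))
      (bmapM B (idm x0) (idm x0) g f))
    (fun y y' a g g' => bmap_linr B a (idm x0) g g').

(* The morphism x ⊠ y -> x0 ⊠ (Hom(x, x0)^* ⊗ y) given by the identity of Hom(x, x0). *)
Definition coev_power x y : mor (B x y) (B x0 (power x y)) :=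
  \sum_k bmap B (b k) (inj y k).

Lemma coev_powerE x y (f : mor x x0) :
  bmap B (idm x0) (power_ev y f) ∘ coev_power x y = bmap B f (idm y).
Proof.
have [pi pi0 ip] := injP x y; have [_ _ cE] := bc x.
rewrite /coev_power compm_sumr [f in RHS]cE bmap_suml; apply: eq_bigr => k _.
rewrite -bmapM comp1m {1}/power_ev compm_suml (bigD1 k) //= big1 ?addr0.
  by rewrite compmZl pi bmapZr bmapZl.
by move=> l lk; rewrite compmZl pi0 ?scaler0 // eq_sym.
Qed.

Lemma coev_power_ext x y w (h h' : mor w (B x0 (power x y))) :
  (forall f, bmap B (idm x0) (power_ev y f) ∘ h = bmap B (idm x0) (power_ev y f) ∘ h') ->
  h = h'.
Proof.
have [_ _ ip] := injP x y => hh'.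
rewrite -[h]comp1m -[h']comp1m -bmap1 -ip bmap_sumr !compm_suml.
apply: eq_bigr => k _; rewrite -power_ev_basis -[idm x0]comp1m !bmapM -!compmA.
by rewrite hh'.
Qed.

Lemma coev_power_nat x x' y y' (f : mor x x') (g : mor y y') :
  bmap B (idm x0) (power_map f g) ∘ coev_power x y = coev_power x' y' ∘ bmap B f g.
Proof.
apply: coev_power_ext => h; rewrite [RHS]compmA coev_powerE -bmapM comp1m.
rewrite [LHS]compmA -bmapM comp1m power_mapE -{1}(comp1m (idm x0)) bmapM -compmA.
by rewrite coev_powerE -bmapM comp1m compm1.
Qed.

(* [coev_power] extends to a natural transformation id -> x0 ⊠ H with H the right
   exact functor extending [power]; it makes H left adjoint to x0 ⊠ -. *)
Lemma kunneth_power x y y' :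
  (forall h : mor (B x y) (B x0 y'), exists g : mor (power x y) y',
     bmap B (idm x0) g ∘ coev_power x y = h) /\
  (forall g : mor (power x y) y', bmap B (idm x0) g ∘ coev_power x y = 0 -> g = 0).
Proof.
have [H [H_rex [t [t_iso t_nat]]]] := dl_ext B_univ V_ab power_birex.
have [t' t'P] := dep_choice (fun p : U * V => t_iso p.1 p.2).
have tK u v : t' (u, v) ∘ t u v = idm _ by case: (t'P (u, v)).
have Kt u v : t u v ∘ t' (u, v) = idm _ by case: (t'P (u, v)).
have slot_rex : right_exact (compF slot H).
  by move=> u v w f g /H_rex fg; exact: (proj2 (dl_birex B_univ)) x0 _ _ _ _ _ fg.
have id_rex : right_exact (idF C) by [].
pose r u v : mor (idF C (B u v)) (compF slot H (B u v)) :=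
  bmap B (idm x0) (t' (u, v)) ∘ coev_power u v.
have [|s [s_nat sE _]] := dl_nat B_univ C_ab id_rex slot_rex (t := r).
  move=> u u' v v' f g; rewrite /r /= -compmA -coev_power_nat !compmA -!bmapM.
  rewrite comp1m; congr (bmap B _ _ ∘ _).
  apply: (iso_mono (t_iso u' v')).
  by rewrite !compmA Kt comp1m t_nat -compmA Kt compm1.
pose counit v := power_ev v (idm x0) ∘ t x0 v.
have counitE v : bmap B (idm x0) (counit v) ∘ s (B x0 v) = idm (B x0 v).
  rewrite sE /r compmA -bmapM comp1m /counit -compmA Kt compm1.
  by rewrite coev_powerE bmap1.
have counit_nat v v' (g : mor v v') :
    counit v' ∘ fmap H (bmap B (idm x0) g) = g ∘ counit v.
  by rewrite /counit -compmA t_nat /= compmA power_mapE comp1m compmA.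
split=> [h|g g0].
  exists (counit y' ∘ fmap H h ∘ t' (x, y)).
  transitivity (bmap B (idm x0) (counit y') ∘ (bmap B (idm x0) (fmap H h) ∘ s (B x y))).
    by rewrite sE /r !compmA -!bmapM !comp1m.
  by rewrite -[bmap B (idm x0) (fmap H h)]/(fmap (compF slot H) h) -s_nat compmA counitE comp1m.
have triangle : counit (power x y) ∘ fmap H (coev_power x y) = t x y.
  rewrite fmap_sum compm_sumr -[RHS]comp1m.
  have [_ _ <-] := injP x y; rewrite compm_suml; apply: eq_bigr => k _.
  by rewrite /counit -compmA t_nat /= compmA power_mapE comp1m power_ev_basis.
clearbody counit.
rewrite -[g]compm1 -(Kt x y) -triangle !compmA -counit_nat -(compmA (counit y')).
by rewrite -fmapM g0 fmap0 compm0 comp0m.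
Qed.

(** [kunneth_power] in coordinates. The basis depends on [x] and [x0] only, not on [y] and [y']. *)
Lemma kunneth x : exists n (b : 'I_n -> mor x x0) c, coords b c /\
  forall y y',
    (forall h : mor (B x y) (B x0 y'), exists g : 'I_n -> mor y y',
       h = \sum_k bmap B (b k) (g k)) /\
    (forall g : 'I_n -> mor y y', \sum_k bmap B (b k) (g k) = 0 -> forall k, g k = 0).
Proof.
exists (n x), (@b x), (@c x); split=> [//|y y'].
have [ex0 inj0] := kunneth_power x y y'; have [pi pi0 ip] := injP x y.
have powerE (g : mor (power x y) y') :
    bmap B (idm x0) g ∘ coev_power x y = \sum_k bmap B (b k) (g ∘ inj y k).
  by rewrite compm_sumr; apply: eq_bigr => k _; rewrite -bmapM comp1m.
split=> [h|g g0 k].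
  by have [g <-] := ex0 h; exists (fun k => g ∘ inj y k); rewrite powerE.
have gk l : (\sum_k (g k ∘ prj y k)) ∘ inj y l = g l.
  rewrite compm_suml (bigD1 l) //= big1 ?addr0; first by rewrite -compmA pi compm1.
  by move=> i il; rewrite -compmA pi0 ?compm0 // eq_sym.
rewrite -gk (inj0 (\sum_k (g k ∘ prj y k))) ?comp0m // powerE -[RHS]g0.
by apply: eq_bigr => l _; rewrite gk.
Qed.

End Kunneth.

(** * Algebras in the direct sum completion *)

Section DirectSumEntries.
Variables (F : fieldType) (C : category F).
Implicit Types W X Y Z : dsob C.

Lemma ds_finite X Y (f : dshom X Y) s :
  exists2 r : seq (dsidx Y), uniq r & forall t, t \notin r -> f s t = 0.
Proof.
have [r ur rP] := dssupp f [:: s].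
by exists r => // t; apply: rP; rewrite inE.
Qed.

Lemma dscomp_diagr X Y Z (g : dshom Y Z) (e : dsidx X -> dsidx Y) p s u :
  dscomp_mx g (@dsdiag F C X Y e p) s u = g (e s) u ∘ p s.
Proof.
rewrite (@dscompE _ _ _ _ _ _ _ s u [:: e s]) ?big_seq1 //=.
  by rewrite dsdiagE.
by move=> t; rewrite inE => te; rewrite dsdiag0 // eq_sym.
Qed.

(** Injectivity of [e] leaves at most one nonzero term in the sum. *)
Lemma dscomp_diagl X Y Z (e : dsidx Y -> dsidx Z) p (f : dshom X Y) s t :
  injective e -> dscomp_mx (@dsdiag F C Y Z e p) f s (e t) = p t ∘ f s t.
Proof.
move=> ei; have [r ur rP] := ds_finite f s.
rewrite (@dscompE _ _ _ _ _ _ _ s (e t) (undup (t :: r))) ?undup_uniq //; last first.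
  by move=> t'; rewrite mem_undup inE negb_or => /andP[_]; apply: rP.
rewrite (bigD1_seq t) ?undup_uniq ?mem_undup ?mem_head //= dsdiagE big1 ?addr0 //.
by move=> t' tt'; rewrite dsdiag0 ?comp0m // (inj_eq ei).
Qed.

End DirectSumEntries.

Section DirectSumNaturality.
Variables (F : fieldType) (C : balanced F).
Hypothesis C_btc : braided_tensor_category C.
Local Notation D := (ds_completion C).
Implicit Types X Y Z : D.

Lemma ds_assoc_nat X X' Y Y' Z Z' (f : mor X X') (g : mor Y Y') (h : mor Z Z') :
  assoc X' Y' Z' ∘ (f ⊗m (g ⊗m h)) = ((f ⊗m g) ⊗m h) ∘ assoc X Y Z.
Proof.
apply: dshomP => -[s [t u]] [[s' t'] u'] /=.
pose e := fun p : dsidx X' * (dsidx Y' * dsidx Z') => ((p.1, p.2.1), p.2.2).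
have ei : injective e by move=> [a [b c]] [a' [b' c']] [-> -> ->].
have := @dscomp_diagl _ _ (dstens_ob X (dstens_ob Y Z)) (dstens_ob X' (dstens_ob Y' Z'))
  (dstens_ob (dstens_ob X' Y') Z') e _ (f ⊗m (g ⊗m h))
  (s, (t, u)) (s', (t', u')) ei; rewrite /e /= => ->.
by rewrite dscomp_diagr /=; exact: bt_ass_nat.
Qed.

Lemma ds_lun_nat X Y (f : mor X Y) : lun Y ∘ (idm unit_ob ⊗m f) = f ∘ lun X.
Proof.
apply: dshomP => -[[] s] t /=.
pose e := fun p : unit * dsidx Y => p.2.
have ei : injective e by move=> [[] a] [[] b] /= ->.
have := @dscomp_diagl _ _ (dstens_ob (ds_single unit_ob) X)
  (dstens_ob (ds_single unit_ob) Y) Y e _ (idm unit_ob ⊗m f)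
  (tt, s) (tt, t) ei; rewrite /e /= => ->.
rewrite dscomp_diagr /= (@dsdiagE _ C (ds_single unit_ob) _ id).
exact: bt_lun_nat.
Qed.

Lemma ds_run_nat X Y (f : mor X Y) : run Y ∘ (f ⊗m idm unit_ob) = f ∘ run X.
Proof.
apply: dshomP => -[s []] t /=.
pose e := fun p : dsidx Y * unit => p.1.
have ei : injective e by move=> [a []] [b []] /= ->.
have := @dscomp_diagl _ _ (dstens_ob X (ds_single unit_ob))
  (dstens_ob Y (ds_single unit_ob)) Y e _ (f ⊗m idm unit_ob)
  (s, tt) (t, tt) ei; rewrite /e /= => ->.
rewrite dscomp_diagr /= (@dsdiagE _ C (ds_single unit_ob) _ id).
exact: bt_run_nat.
Qed.

Lemma ds_braid_nat X X' Y Y' (f : mor X X') (g : mor Y Y') :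
  braid X' Y' ∘ (f ⊗m g) = (g ⊗m f) ∘ braid X Y.
Proof.
apply: dshomP => -[s t] [t' s'] /=.
pose e := fun p : dsidx X' * dsidx Y' => (p.2, p.1).
have ei : injective e by move=> [a b] [a' b'] [-> ->].
have := @dscomp_diagl _ _ (dstens_ob X Y) (dstens_ob X' Y')
  (dstens_ob Y' X') e _ (f ⊗m g) (s, t) (s', t') ei.
by rewrite /e /= => ->; rewrite dscomp_diagr /=; exact: bt_brd_nat.
Qed.

End DirectSumNaturality.

(** * Elements of the algebra and their products *)

Section Elements.
Variables (F : fieldType) (C : balanced F).
Hypothesis C_btc : braided_tensor_category C.
Local Notation D := (ds_completion C).
Variables (A : D) (mu : mor (A ⊗ A) A) (iota : mor unit_ob A).
Hypothesis A_alg : comm_algebra mu iota.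
Implicit Types z w : C.

Definition elt z : lmodType F := @mor F D (ds_single z) A.

Definition single_hom z w (h : mor z w) : dshom (ds_single z) (ds_single w) :=
  @dsdiag F C (ds_single z) (ds_single w) id (fun _ => h).

Definition epull z w (h : mor z w) (p : elt w) : elt z := dscomp p (single_hom h).

Lemma epullE z w (h : mor z w) (p : elt w) i : (epull h p : dshom _ _) tt i = (p : dshom _ _) tt i ∘ h.
Proof. by rewrite /epull /= dscomp_diagr. Qed.

Lemma eltP z (p q : elt z) :
  (forall i, (p : dshom _ _) tt i = (q : dshom _ _) tt i) -> p = q.
Proof. by move=> pq; apply: dshomP => -[]. Qed.

(** Given by its entries because the source of [mu ∘ (p ⊗m q)] is a sum indexed by pairs of units,
    which is not literally the one-term sum of [z ⊗ w]. *)
Definition emul z w (p : elt z) (q : elt w) : elt (z ⊗ w) :=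
  @DSHom F C (ds_single (z ⊗ w)) A (fun _ => (mu ∘ (p ⊗m q) : dshom _ _) (tt, tt))
    (fun _ => dsfin (mu ∘ (p ⊗m q) : dshom _ _) (tt, tt)).

Lemma emul_sum z w (p : elt z) (q : elt w) (r1 r2 : seq (dsidx A)) k :
  uniq r1 -> uniq r2 ->
  (forall i, i \notin r1 -> (p : dshom _ _) tt i = 0) ->
  (forall i, i \notin r2 -> (q : dshom _ _) tt i = 0) ->
  (emul p q : dshom _ _) tt k = \sum_(i <- r1) \sum_(j <- r2)
    ((mu : dshom _ _) (i, j) k ∘ ((p : dshom _ _) tt i ⊗m (q : dshom _ _) tt j)).
Proof.
move=> u1 u2 pr qr /=.
rewrite (@dscompE _ _ _ (dstens_ob A A) _ _ _ _ _ [seq (i, j) | i <- r1, j <- r2]).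
- by rewrite big_allpairs.
- by apply: allpairs_uniq => // -[? ?] [? ?] _ _ [-> ->].
- move=> [i j] nij /=; case: (boolP (i \in r1)) => [ir|/pr ->]; last by rewrite bmap0l.
  by rewrite qr ?bmap0r //; apply: contra nij => jr; apply: allpairs_f.
Qed.

Lemma epull_id z (p : elt z) : epull (idm z) p = p.
Proof. by apply: eltP => i; rewrite epullE compm1. Qed.

Lemma epull_comp x y z (h : mor y z) (g : mor x y) (p : elt z) :
  epull g (epull h p) = epull (h ∘ g) p.
Proof. by apply: eltP => i; rewrite !epullE compmA. Qed.

Lemma elt_linE z a (p q : elt z) i :
  ((a *: p + q : elt z) : dshom _ _) tt i = a *: (p : dshom _ _) tt i + (q : dshom _ _) tt i.
Proof. exact: dslinE. Qed.

Lemma epull_lin y z (h : mor y z) a (p q : elt z) :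
  epull h (a *: p + q) = a *: epull h p + epull h q.
Proof. by apply: eltP => i; rewrite !(elt_linE, epullE) compm_linl. Qed.

Lemma epull_linl y z a (h h' : mor y z) (p : elt z) :
  epull (a *: h + h') p = a *: epull h p + epull h' p.
Proof. by apply: eltP => i; rewrite !(elt_linE, epullE) compm_linr. Qed.

Lemma emul_pull x y z w (f : mor x z) (g : mor y w) (p : elt z) (q : elt w) :
  emul (epull f p) (epull g q) = epull (f ⊗m g) (emul p q).
Proof.
have [r1 u1 pr] := ds_finite p tt; have [r2 u2 qr] := ds_finite q tt.
apply: eltP => k; rewrite epullE (emul_sum k u1 u2 pr qr) (@emul_sum _ _ _ _ r1 r2) //.
- rewrite compm_suml; apply: eq_bigr => i _; rewrite compm_suml; apply: eq_bigr => j _.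
  by rewrite !epullE bmapM compmA.
- by move=> i /pr pi; rewrite epullE pi comp0m.
- by move=> i /qr qi; rewrite epullE qi comp0m.
Qed.

Lemma emul_assoc x y z (p : elt x) (q : elt y) (r : elt z) :
  epull (assoc x y z) (emul (emul p q) r) = emul p (emul q r).
Proof.
apply: eltP => k; rewrite epullE.
(* The law of A is applied to one-term sums in the completion and then read off at their only source
   index. *)
have E : mu ∘ (p ⊗m (mu ∘ (q ⊗m r)))
    = (mu ∘ ((mu ∘ (p ⊗m q)) ⊗m r)) ∘ assoc (ds_single x : D) (ds_single y) (ds_single z).
  rewrite -[p in LHS]comp1m bmapM compmA (alg_assoc A_alg) -!compmA ds_assoc_nat //.
  by rewrite (compmA (mu ⊗m _)) -bmapM comp1m !compmA.
transitivity ((mu ∘ (p ⊗m (mu ∘ (q ⊗m r))) : dshom _ _) (tt, (tt, tt)) k); last by [].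
by rewrite E /= dscomp_diagr.
Qed.

Lemma emul_unitl z (p : elt z) : emul iota p = epull (lun z) p.
Proof.
apply: eltP => k; rewrite epullE.
have E : mu ∘ (iota ⊗m p) = p ∘ lun (ds_single z : D).
  by rewrite tsplit compmA (alg_unitl A_alg) ds_lun_nat.
transitivity ((mu ∘ (iota ⊗m p) : dshom _ _) (tt, tt) k); first by [].
by rewrite E /= dscomp_diagr.
Qed.

Lemma emul_unitr z (p : elt z) : emul p iota = epull (run z) p.
Proof.
apply: eltP => k; rewrite epullE.
have E : mu ∘ (p ⊗m iota) = p ∘ run (ds_single z : D).
  by rewrite tsplit' compmA (alg_unitr A_alg) ds_run_nat.
transitivity ((mu ∘ (p ⊗m iota) : dshom _ _) (tt, tt) k); first by [].
by rewrite E /= dscomp_diagr.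
Qed.

Lemma emul_comm z w (p : elt z) (q : elt w) : epull (braid z w) (emul q p) = emul p q.
Proof.
apply: eltP => k; rewrite epullE.
have E : mu ∘ (p ⊗m q) = mu ∘ (q ⊗m p) ∘ braid (ds_single z : D) (ds_single w).
  by rewrite -compmA -ds_braid_nat // compmA (alg_comm A_alg).
transitivity ((mu ∘ (p ⊗m q) : dshom _ _) (tt, tt) k); last by [].
by rewrite E /= dscomp_diagr.
Qed.

End Elements.

(* The elements annihilated by every functional "multiply, then project to the
   component i0" form an ideal of A, which is zero because A is simple. *)
Section NullIdeal.
Variables (F : fieldType) (C : balanced F).
Hypothesis C_btc : braided_tensor_category C.
Variables (I : choiceType) (i0 : I) (a : I -> C).
Local Notation D := (ds_completion C).
Local Notation A := (ds_sum a).
Variables (mu : mor (A ⊗ A) A) (iota : mor unit_ob A).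
Hypothesis A_alg : comm_algebra mu iota.
Hypothesis A_simple : simple_algebra mu iota.
Hypothesis a0_neq0 : idm (a i0) <> 0.
Local Notation elt := (@elt F C A).
Local Notation emul := (@emul F C A mu).
Local Notation einc := (@ds_incl F C I a).
Local Notation "p ⟨ i ⟩" := ((p : dshom (ds_single _) A) tt i)
  (at level 2, i at level 200, left associativity, format "p ⟨ i ⟩").
Let form i j : mor (a i ⊗ a j) (a i0) := (mu : dshom _ _) (i, j) i0.
Hypothesis form_uniql : forall i i' j, form i j <> 0 -> form i' j <> 0 -> i = i'.
Hypothesis form_uniqr : forall i j j', form i j <> 0 -> form i j' <> 0 -> j = j'.
Variables (d : I -> C) (e : forall j, mor (d j ⊗ a j) unit_ob)
  (c : forall j, mor unit_ob (a j ⊗ d j)).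
Hypothesis zig : forall j, run (a j) ∘ ((idm (a j) ⊗m e j)
  ∘ (assocV (a j) (d j) (a j) ∘ ((c j ⊗m idm (a j)) ∘ lunV (a j)))) = idm (a j).
Let C_mon := braided_monoidal C_btc.

Lemma einc_id i : (einc i : elt (a i))⟨i⟩ = idm (a i).
Proof. exact: (@dsdiagE F C (ds_single (a i)) A (fun=> i) _ tt). Qed.

Lemma einc_neq i j : i != j -> (einc i : elt (a i))⟨j⟩ = 0.
Proof. by move=> ij; exact: (@dsdiag0 F C (ds_single (a i)) A (fun=> i) _ tt). Qed.

Lemma emul_incr z (p : elt z) j r k : uniq r -> (forall i, i \notin r -> p⟨i⟩ = 0) ->
  (emul p (einc j : elt (a j)))⟨k⟩
  = \sum_(i <- r) ((mu : dshom _ _) (i, j) k ∘ (p⟨i⟩ ⊗m idm (a j))).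
Proof.
move=> ur rP; rewrite (@emul_sum _ _ _ _ _ _ _ _ r [:: j]) //.
  by apply: eq_bigr => i _; rewrite big_seq1 einc_id.
by move=> i; rewrite inE => ij; rewrite einc_neq // eq_sym.
Qed.

Lemma emul_inc z i (g : mor z (a i)) j k :
  (emul (epull g (einc i : elt (a i))) (einc j : elt (a j)))⟨k⟩
  = (mu : dshom _ _) (i, j) k ∘ (g ⊗m idm (a j)).
Proof.
rewrite (@emul_incr _ _ _ [:: i]) // ?big_seq1 ?epullE ?einc_id ?comp1m //.
by move=> l; rewrite inE => li; rewrite epullE einc_neq ?comp0m // eq_sym.
Qed.

Definition null z (p : elt z) := forall j, (emul p (einc j : elt (a j)))⟨i0⟩ = 0.

Lemma null_pull y z (h : mor y z) (p : elt z) : null p -> null (epull h p).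
Proof.
move=> p0 j; rewrite -[einc j](epull_id (einc j : elt (a j))) emul_pull epullE.
by rewrite p0 comp0m.
Qed.

(** Every entry of [q] factors through one of the inclusions [einc j], against which [p] is null. *)
Lemma null_mulr z w (p : elt z) (q : elt w) : null p -> (emul p q)⟨i0⟩ = 0.
Proof.
move=> p0; have [r1 u1 pr] := ds_finite p tt; have [r2 u2 qr] := ds_finite q tt.
rewrite (@emul_sum _ _ _ _ _ _ p q r1 r2 i0 u1 u2 pr qr) exchange_big big1 //= => j _.
transitivity ((emul p (einc j : elt (a j)))⟨i0⟩ ∘ (idm z ⊗m q⟨j⟩)); last first.
  by rewrite p0 comp0m.
rewrite (emul_incr j _ u1 pr) compm_suml; apply: eq_bigr => i _.
by rewrite -compmA -tsplit.
Qed.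

(** Commutativity puts [p] on the left; then (p q) times an inclusion is [p] times a product, by
    associativity. *)
Lemma null_mull z w (p : elt z) (q : elt w) : null p -> null (emul q p).
Proof.
move=> p0; rewrite -(emul_comm C_btc A_alg q p); apply: null_pull => j.
have [_ VK] := mo_assK C_mon z w (a j).
rewrite -[emul _ _](epull_id (emul (emul p q) (einc j : elt (a j)))) -VK.
by rewrite -epull_comp (emul_assoc C_btc A_alg) epullE null_mulr ?comp0m.
Qed.

(** For fixed [j] at most one [form i j] is nonzero, so the test against [einc j] sees a single
    component of [p]. Thus the ideal is the sum of its intersections with the components. *)
Lemma null_component z (p : elt z) i : null p -> null (epull p⟨i⟩ (einc i : elt (a i))).
Proof.
move=> p0 j; rewrite emul_inc; have [f0|f0] := EM (form i j = 0).
  by rewrite -/(form i j) f0 comp0m.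
have [r u pr] := ds_finite p tt.
have := p0 j; rewrite (emul_incr j _ u pr).
have [ir|/pr ->] := boolP (i \in r); last by rewrite bmap0l compm0.
rewrite (bigD1_seq i) //= big1 ?addr0 // => l li; rewrite -/(form l j).
have [->|fl] := EM (form l j = 0); first by rewrite comp0m.
by case/eqP: li; exact: form_uniql fl f0.
Qed.

(** The largest null subobject of [a i]: the kernel of the transpose of [form i j] for the unique
    [j] that pairs with [i], and all of [a i] if there is none. *)
Lemma null_kernel i : exists (k : C) (f : mor k (a i)),
  [/\ is_mono f, null (epull f (einc i : elt (a i)))
    & forall z (g : mor z (a i)), null (epull g (einc i : elt (a i))) ->
        exists h, f ∘ h = g].
Proof.
have nullE z (g : mor z (a i)) : null (epull g (einc i : elt (a i))) <->
    forall j, form i j ∘ (g ⊗m idm (a j)) = 0.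
  by split=> g0 j; have := g0 j; rewrite emul_inc.
have [[j fj]|nof] := EM (exists j, form i j <> 0); last first.
  exists (a i), (idm (a i)); split=> [w g h||z g _].
  - by rewrite !comp1m.
  - apply/nullE => j; rewrite (_ : form i j = 0) ?comp0m //.
    by apply: contrapT => fj; apply: nof; exists j.
  - by exists g; rewrite comp1m.
have rt0 z (g : mor z (a i)) : form i j ∘ (g ⊗m idm (a j)) = 0 <->
    rtranspose (c j) (form i j) ∘ g = 0.
  rewrite -(rtranspose_nat C_mon); split=> [->|g0].
    by rewrite /rtranspose /ltranspose /= bmap0l comp0m.
  rewrite -[LHS](zig_rtransposeK C_mon (zig j)) g0.
  by rewrite /runtranspose /luntranspose /= bmap0l compm0.
have [k [f [f0 fK]]] := abelian_ker (bt_abelian C_btc) (rtranspose (c j) (form i j)).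
exists k, f; split=> [|j'|z g /nullE /(_ j) /rt0 /fK [h [hg _]]]; last by exists h.
  apply: is_monoP => w g fg.
  have [h [_ hu]] := fK w 0 (compm0 _ _).
  by rewrite -(hu 0) ?compm0 // -(hu g).
have [->|j'j] := eqVneq j' j; first by rewrite emul_inc; exact/rt0.
rewrite emul_inc -/(form i j') (_ : form i j' = 0) ?comp0m //.
by apply: contrapT => fj'; case/eqP: j'j; exact: form_uniqr fj' fj.
Qed.

Lemma null_eq0 z (p : elt z) : null p -> p = 0.
Proof.
have [k kP] := dep_choice null_kernel.
have [f fP] := dep_choice kP.
have fm i : is_mono (f i) by case: (fP i).
have fn i : null (epull (f i) (einc i : elt (a i))) by case: (fP i).
have fK i y (g : mor y (a i)) : null (epull g (einc i : elt (a i))) ->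
    exists h, f i ∘ h = g by case: (fP i) => _ _; apply.
pose M : D := ds_sum k.
pose incl : mor M A := @dsdiag F C (ds_sum k) A id f.
have inclE w (u : dshom w M) s i : (incl ∘ u : dshom _ _) s i = f i ∘ u s i.
  exact: (@dscomp_diagl F C w M A id f u s i (fun x y => id)).
have incl_mono : is_mono incl.
  move=> w g h gh; apply: dshomP => s i; apply: fm.
  by rewrite -!inclE gh.
(* The ideal property gives the entries of the action on [M]: a product with a null element is null,
   so each component of it factors through the corresponding [f]. *)
have lift (q : I * I * I) : exists h : mor (a q.1.1 ⊗ k q.1.2) (k q.2),
    f q.2 ∘ h = (mu : dshom _ _) (q.1.1, q.1.2) q.2 ∘ (idm (a q.1.1) ⊗m f q.1.2).
  apply: fK; case: q => [[i j] l] /=.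
  pose q := emul (einc i : elt (a i)) (epull (f j) (einc j : elt (a j))).
  have <- : q⟨l⟩ = (mu : dshom _ _) (i, j) l ∘ (idm (a i) ⊗m f j).
    rewrite (@emul_sum F C A mu _ _ _ _ [:: i] [:: j]) ?big_seq1 //.
    - by rewrite epullE !einc_id comp1m.
    - by move=> i'; rewrite inE => ii'; rewrite einc_neq // eq_sym.
    - by move=> j'; rewrite inE => jj'; rewrite epullE einc_neq ?comp0m // eq_sym.
  exact/null_component/null_mull.
have [h hP] := dep_choice lift.
have hE i j l : f l ∘ h (i, j, l) = (mu : dshom _ _) (i, j) l ∘ (idm (a i) ⊗m f j).
  exact: (hP (i, j, l)).
(* Finite support is inherited from [mu], because [f l] is mono. *)
have hfin (s : I * I) : finite_set [set l | h (s.1, s.2, l) != 0].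
  case: s => i j; apply: (sub_finite_set _ (dsfin (mu : dshom _ _) (i, j))) => l /=.
  apply: contra => /eqP mu0; apply/eqP; apply: fm.
  by rewrite hE mu0 comp0m compm0.
pose act : mor (A ⊗ M) M := @DSHom F C (dstens_ob A M) M (fun s l => h (s.1, s.2, l)) hfin.
have act_mor : incl ∘ act = mu ∘ (idm A ⊗m incl).
  apply: dshomP => -[i j] l; rewrite inclE /= hE /=.
  rewrite (@dscompE _ _ _ (dstens_ob A A) _ _ _ _ _ [:: (i, j)]) ?big_seq1 //=.
    by rewrite (@dsdiagE _ C A A id) (@dsdiagE _ C M A id).
  move=> [i' j']; rewrite inE xpair_eqE negb_and => /orP[ii'|jj'] /=.
    by rewrite (@dsdiag0 _ C A A id) ?bmap0l // eq_sym.
  by rewrite (@dsdiag0 _ C M A id) ?bmap0r // eq_sym.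
have M_module : left_module mu iota act.
  split; apply: incl_mono.
    rewrite compmA act_mor -compmA -tcomp1m act_mor tcomp1m compmA (alg_assoc A_alg).
    rewrite -!compmA ds_assoc_nat // bmap1 [RHS]compmA act_mor -!compmA.
    by rewrite (compmA (mu ⊗m idm A)) -tsplit (tsplit' mu) -!compmA.
  rewrite compmA act_mor -compmA -tsplit' tsplit compmA (alg_unitl A_alg).
  exact: ds_lun_nat.
have null_incl w (u : dshom (ds_single w) M) : null (incl ∘ u : elt w).
  move=> j; have [r ur rP] := ds_finite (incl ∘ u : elt w) tt.
  rewrite (@emul_incr w (incl ∘ u : elt w) j r i0 ur rP) big1 // => i _.
  rewrite inclE tcompm1 compmA.
  by have := fn i j; rewrite emul_inc => ->; rewrite comp0m.
(* If [incl] were invertible, the unit of A would be null; but its product with [einc i0] has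
   [lun (a i0)] as its entry at [i0], and [a i0] is not zero. *)
have incl0 : incl = 0.
  have [_ /(_ M act incl M_module act_mor incl_mono)[//|[g [_ ig]]]] := A_simple.
  have iota_null : null (iota : elt unit_ob).
    have -> : (iota : elt unit_ob) = incl ∘ (g ∘ iota) by rewrite compmA ig comp1m.
    exact: null_incl.
  case: a0_neq0; apply: (iso_epi (ex_intro _ _ (mo_lunK C_mon (a i0)))).
  rewrite comp0m -(null_mulr (einc i0 : elt (a i0)) iota_null).
  by rewrite (emul_unitl C_btc A_alg) epullE einc_id.
move=> p0; apply: eltP => i.
have [g <-] := fK i _ _ (null_component i p0).
have fi : (incl : dshom _ _) i i = f i := @dsdiagE F C M A id f i.
by rewrite -fi incl0 comp0m.
Qed.

End NullIdeal.

(** * The lax presheaf of the algebra *)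

Lemma has_dim0_eq0 (F : fieldType) (M : lmodType F) : has_dim M 0 -> forall v : M, v = 0.
Proof. by move=> [b bP] v; have [a [-> _]] := bP v; rewrite big_ord0. Qed.

Lemma has_dim1_scalar (F : fieldType) (M : lmodType F) : has_dim M 1 ->
  forall v : M, v <> 0 -> forall w, exists k, w = k *: v.
Proof.
move=> [b bP] v v0 w; have [a [vE _]] := bP v; have [c [wE _]] := bP w.
rewrite big_ord1 in vE; rewrite big_ord1 in wE.
have a0 : a 0 ord0 != 0 by apply/eqP => a0; apply: v0; rewrite vE a0 scale0r.
by exists (c 0 ord0 / a 0 ord0); rewrite vE scalerA divfK.
Qed.

(** Turns the equalities [X i0 = unit_ob] and [Y i0 = unit_ob] into isomorphisms, so that no
    morphism is transported along them. *)
Lemma eq_iso F (C : category F) (x y : C) : x = y -> exists f : mor x y, is_iso f.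
Proof. by move=> ->; exists (idm y); exact: iso_id. Qed.

Lemma comp4K F (C : category F) (u v w x y z : C) (h : mor y z) (g : mor x y)
    (f : mor w x) (e : mor v w) (d : mor v z) : h ∘ (g ∘ (f ∘ e)) = d ->
  forall k : mor u v, h ∘ (g ∘ (f ∘ (e ∘ k))) = d ∘ k.
Proof. by move=> <- k; rewrite !compmA. Qed.

Section Assembly.
Variables (F : fieldType) (U V : ribbon F) (C : balanced F).
Variables (bx : bifunctor U V C) (I : choiceType) (i0 : I) (X : I -> U) (Y : I -> V).
Local Notation a := (fun i => bx (X i) (Y i)).
Local Notation A := (ds_sum a).
Variables (mu : mor (A ⊗ A) A) (iota : mor unit_ob A).
Hypotheses (U_rib : ribbon_category U) (U_ss : semisimple U) (V_rib : ribbon_category V).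
Hypotheses (C_bal : balanced_tensor_category C) (bx_univ : deligne_universal bx).
Variables (m : forall x x' y y', mor (bx x y ⊗ bx x' y') (bx (x ⊗ x') (y ⊗ y')))
  (mV : forall x x' y y', mor (bx (x ⊗ x') (y ⊗ y')) (bx x y ⊗ bx x' y')).
Variables (eps : mor unit_ob (bx unit_ob unit_ob)) (epsV : mor (bx unit_ob unit_ob) unit_ob).
Hypothesis bx_cw : componentwise m eps.
Hypothesis mK : forall x x' y y', inverses (m x x' y y') (mV x x' y y').
Hypothesis epsK : inverses eps epsV.
Hypothesis X_simple : forall i, simple (X i).
Hypothesis X_distinct : forall i j, isomorphic (X i) (X j) -> i = j.
Hypothesis X_unit : X i0 = unit_ob.
Hypothesis Y_nonzero : forall i, idm (Y i) <> 0.
Hypothesis Y_unit : Y i0 = unit_ob.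
Hypothesis A_alg : comm_algebra mu iota.
Hypothesis A_simple : simple_algebra mu iota.
Hypothesis X_dim : forall i, has_dim (mor (X i0) (X i)) (i == i0).
Hypothesis Y_dim : forall i, has_dim (mor (Y i0) (Y i)) (i == i0).
Let U_mon := ribbon_monoidal U_rib.
Let V_mon := ribbon_monoidal V_rib.
Let U_br := ribbon_braided U_rib.
Let U_ab := ribbon_abelian U_rib.
Let V_ab := ribbon_abelian V_rib.
Let C_btc := bl_braided C_bal.
Let C_mon := braided_monoidal C_btc.
Let C_ab := bt_abelian C_btc.
Local Notation elt := (@elt F C A).
Local Notation emul := (@emul F C A mu).
Local Notation einc := (@ds_incl F C I a).
Local Notation "p ⟨ i ⟩" := ((p : dshom (ds_single _) A) tt i)
  (at level 2, i at level 200, left associativity, format "p ⟨ i ⟩").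

Lemma mV_nat x1 x1' x2 x2' y1 y1' y2 y2' (f1 : mor x1 x1') (f2 : mor x2 x2')
    (g1 : mor y1 y1') (g2 : mor y2 y2') :
  (bmap bx f1 g1 ⊗m bmap bx f2 g2) ∘ mV x1 x2 y1 y2
  = mV x1' x2' y1' y2' ∘ bmap bx (f1 ⊗m f2) (g1 ⊗m g2).
Proof.
apply: (move_l (mK _ _ _ _)); rewrite compmA (cw_m_nat bx_cw) -compmA.
by have [_ ->] := mK x1 x2 y1 y2; rewrite compm1.
Qed.

Lemma mV_assoc x x' x'' y y' y'' :
  (mV x x' y y' ⊗m idm (bx x'' y'')) ∘ (mV (x ⊗ x') x'' (y ⊗ y') y''
    ∘ bmap bx (assoc x x' x'') (assoc y y' y''))
  = assoc (bx x y) (bx x' y') (bx x'' y'')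
    ∘ ((idm (bx x y) ⊗m mV x' x'' y' y'') ∘ mV x (x' ⊗ x'') y (y' ⊗ y'')).
Proof.
have k1 := bmap_inverses (@tens _ C) (mK x x' y y') (inverses_id (bx x'' y'')).
have k2 := bmap_inverses (@tens _ C) (inverses_id (bx x y)) (mK x' x'' y' y'').
have k3 := mK x (x' ⊗ x'') y (y' ⊗ y''); have k4 := mK (x ⊗ x') x'' (y ⊗ y') y''.
have E := cw_ass bx_cw x x' x'' y y' y''.
move/(move_r k2)/(move_r k3) in E; rewrite E.
rewrite -!compmA; have [k4l _] := k4; have [k1l _] := k1.
by rewrite (compK k4l) comp1m (compK k1l) comp1m.
Qed.

Lemma mV_lun x y :
  lun (bx x y) ∘ ((epsV ⊗m idm (bx x y)) ∘ mV unit_ob x unit_ob y) = bmap bx (lun x) (lun y).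
Proof.
have k := bmap_inverses (@tens _ C) epsK (inverses_id (bx x y)).
have := cw_lun bx_cw x y; move/(move_r k)/(move_r (mK _ _ _ _)) => ->.
by rewrite -compmA.
Qed.

Lemma mV_run x y :
  run (bx x y) ∘ ((idm (bx x y) ⊗m epsV) ∘ mV x unit_ob y unit_ob) = bmap bx (run x) (run y).
Proof.
have k := bmap_inverses (@tens _ C) (inverses_id (bx x y)) epsK.
have := cw_run bx_cw x y; move/(move_r k)/(move_r (mK _ _ _ _)) => ->.
by rewrite -compmA.
Qed.

Lemma mV_braid x x' y y' :
  mV x' x y' y ∘ bmap bx (braid x x') (braid y y') = braid (bx x y) (bx x' y') ∘ mV x x' y y'.
Proof.
apply/esym/(move_l (mK _ _ _ _)); rewrite compmA -(cw_brd bx_cw) -compmA.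
by have [_ ->] := mK x x' y y'; rewrite compm1.
Qed.

Definition deligne_presheaf : lax_presheaf U V :=
  @LaxPresheaf F U V (fun x y => elt (bx x y))
    (fun x x' y y' f g p => epull (bmap bx f g) p)
    (fun x x' y y' p q => epull (mV x x' y y') (emul p q))
    (epull epsV (iota : elt unit_ob)).
Local Notation P := deligne_presheaf.

Lemma deligne_laws : lax_laws P.
Proof.
split=> /=.
- by move=> x y p; rewrite bmap1 epull_id.
- by move=> *; rewrite epull_comp -bmapM.
- by move=> *; exact: epull_lin.
- by move=> *; rewrite bmap_linl epull_linl.
- by move=> *; rewrite bmap_linr epull_linl.
- by move=> *; rewrite emul_pull !epull_comp mV_nat.
- move=> x x' x'' y y' y'' p q r.
  rewrite -[r in LHS](epull_id (r : elt _)) -[p in RHS](epull_id (p : elt _)) !emul_pull.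
  by rewrite -(emul_assoc C_btc A_alg) !epull_comp -?compmA mV_assoc.
- move=> x y p; rewrite -[p in LHS](epull_id (p : elt _)) emul_pull.
  by rewrite (emul_unitl C_btc A_alg) !epull_comp -?compmA mV_lun.
- move=> x y p; rewrite -[p in LHS](epull_id (p : elt _)) emul_pull.
  by rewrite (emul_unitr C_btc A_alg) !epull_comp -?compmA mV_run.
- move=> x x' y y' p q.
  by rewrite epull_comp mV_braid -epull_comp (emul_comm C_btc A_alg).
Qed.

Lemma X0_iso : exists f : mor unit_ob (X i0), is_iso f.
Proof. exact: eq_iso (esym X_unit). Qed.

Lemma Y0_iso : exists f : mor unit_ob (Y i0), is_iso f.
Proof. exact: eq_iso (esym Y_unit). Qed.

Lemma U_hom_dim (x y : U) : finite_dim (mor x y).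
Proof.
apply: hom_dim => //; last by rewrite -X_unit.
have := X_dim i0; rewrite eqxx X_unit => /has_dim_coords[b [c bc]].
by exists 1%N, b, c.
Qed.

Let kun x0 := kunneth U_ab U_ss V_ab C_ab bx_univ (fun x => U_hom_dim x x0).

(** The Kunneth coordinates of [bmap bx f g] are the multiples of [g] by the coordinates of [f]. *)
Lemma bx_eq0 x x' y y' (f : mor x x') (g : mor y y') : bmap bx f g = 0 -> f = 0 \/ g = 0.
Proof.
move=> fg0; have [n [b [c [bc bxP]]]] := kun x' x; have [_ _ cE] := bc.
have [g0|g0] := EM (g = 0); [by right | left].
rewrite [f]cE big1 // => k _; have [_ inj] := bxP y y'.
have /inj/(_ k) /eqP : \sum_k bmap bx (b k) (c k f *: g) = 0.
  rewrite -[RHS]fg0 {2}[f]cE bmap_suml; apply: eq_bigr => l _.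
  by rewrite bmapZl bmapZr.
by rewrite scaler_eq0 => /orP[/eqP->|/eqP //]; rewrite scale0r.
Qed.

Lemma bx_hom x x' y y' (h : mor (bx x y) (bx x' y')) : h <> 0 ->
  exists f : mor x x', f <> 0.
Proof.
move=> h0; have [n [b [c [bc bxP]]]] := kun x' x; have [ex _] := bxP y y'.
have [g hE] := ex h; apply: contrapT => nof; apply: h0.
rewrite hE big1 // => k _; rewrite (_ : b k = 0) ?bmap0l //.
by apply: contrapT => bk; apply: nof; exists (b k).
Qed.

Lemma bx_neq0 i : idm (bx (X i) (Y i)) <> 0.
Proof.
by rewrite -bmap1 => /bx_eq0[]; [case: (X_simple i) | exact: Y_nonzero].
Qed.

Lemma hom_X i x (f : mor x (X i)) : simple x -> f <> 0 -> isomorphic x (X i).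
Proof.
by move=> xs f0; exists f; case: (simple_schur U_ab xs (X_simple i) f).
Qed.

Lemma X_hom0 i (f : mor unit_ob (X i)) : i != i0 -> f = 0.
Proof.
move=> ii0; have := X_dim i; rewrite (negbTE ii0) X_unit => X0.
exact: has_dim0_eq0 X0 f.
Qed.

Lemma Y_hom0 i (f : mor unit_ob (Y i)) : i != i0 -> f = 0.
Proof.
move=> ii0; have := Y_dim i; rewrite (negbTE ii0) Y_unit => Y0.
exact: has_dim0_eq0 Y0 f.
Qed.

Lemma scalar_l x (xi : mor x (X i0)) xi' (f : mor x (X i0)) :
  inverses xi xi' -> exists k, f = k *: xi.
Proof.
move=> [xi'xi _]; have := X_dim i0; rewrite eqxx => /has_dim1_scalar sc.
have [k kE] := sc _ (X_simple i0).1 (f ∘ xi').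
by exists k; rewrite -[f]compm1 -xi'xi compmA kE compmZl comp1m.
Qed.

Lemma scalar_r y (eta : mor y (Y i0)) eta' (g : mor y (Y i0)) :
  inverses eta eta' -> exists k, g = k *: eta.
Proof.
move=> [eta'eta _]; have := Y_dim i0; rewrite eqxx => /has_dim1_scalar sc.
have [k kE] := sc _ (Y_nonzero (i := i0)) (g ∘ eta').
by exists k; rewrite -[g]compm1 -eta'eta compmA kE compmZl comp1m.
Qed.

(** Hom(1, X_i) vanishes for [i != i0] and is spanned by [xi] for [i0], so the Kunneth expansion
    collapses to one term. *)
Lemma entry_unit y (p : elt (bx unit_ob y)) (xi : mor unit_ob (X i0)) xi' :
  inverses xi xi' ->
  (forall i, i != i0 -> p⟨i⟩ = 0) /\ exists g : mor y (Y i0), p⟨i0⟩ = bmap bx xi g.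
Proof.
move=> xiK; split=> [i ii0|].
  by apply: contrapT => /bx_hom[f]; apply; exact: X_hom0.
have [n [b [c [bc bxP]]]] := kun (X i0) unit_ob; have [ex _] := bxP y (Y i0).
have [g ->] := ex p⟨i0⟩; have [k kE] := choice (fun l => scalar_l (b l) xiK).
exists (\sum_l k l *: g l); rewrite bmap_sumr; apply: eq_bigr => l _.
by rewrite kE bmapZl bmapZr.
Qed.

Lemma entry_one x (p : elt (bx x unit_ob)) (eta : mor unit_ob (Y i0)) eta' :
  inverses eta eta' ->
  (forall i, i != i0 -> p⟨i⟩ = 0) /\ exists f : mor x (X i0), p⟨i0⟩ = bmap bx f eta.
Proof.
move=> etaK; split=> [i ii0|].
  have [n [b [c [bc bxP]]]] := kun (X i) x; have [ex _] := bxP unit_ob (Y i).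
  by have [g ->] := ex p⟨i⟩; rewrite big1 // => k _; rewrite (Y_hom0 (g k)) ?bmap0r.
have [n [b [c [bc bxP]]]] := kun (X i0) x; have [ex _] := bxP unit_ob (Y i0).
have [g ->] := ex p⟨i0⟩; have [k kE] := choice (fun l => scalar_r (g l) etaK).
exists (\sum_l k l *: b l); rewrite bmap_suml; apply: eq_bigr => l _.
by rewrite kE bmapZl bmapZr.
Qed.

Lemma iota_neq0 : (iota : elt unit_ob) <> 0.
Proof.
move=> iota0; apply: (bx_neq0 (i := i0)).
apply: (iso_epi (ex_intro _ _ (mo_lunK C_mon _))); rewrite comp0m.
have <- : (emul (iota : elt unit_ob) (einc i0 : elt (a i0)))⟨i0⟩ = 0.
  rewrite (emul_incr _ _ (r := [::])) ?big_nil // => i _.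
  by rewrite iota0.
by rewrite (emul_unitl C_btc A_alg) epullE einc_id.
Qed.

(** The scalar [k] relates the unit of A to the chosen isomorphisms; its inverse normalises the
    witnesses in [deligne_unit] and [deligne_one]. *)
Lemma uni_entry (xi : mor unit_ob (X i0)) xi' (eta : mor unit_ob (Y i0)) eta' :
  inverses xi xi' -> inverses eta eta' ->
  (forall i, i != i0 -> (uni P : elt _)⟨i⟩ = 0) /\
  exists2 k, k != 0 & (uni P : elt _)⟨i0⟩ = k *: bmap bx xi eta.
Proof.
move=> xiK etaK; have [u0 [g gE]] := entry_unit (uni P) xiK.
split=> //; have [k kE] := scalar_r g etaK; exists k; last by rewrite gE kE bmapZr.
apply/eqP => k0; apply: iota_neq0.
have uni0 : epull epsV (iota : elt unit_ob) = 0.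
  apply: eltP => i; have [->|ii0] := eqVneq i i0; last exact: u0.
  by rewrite [LHS]gE kE k0 scale0r bmap0r.
have [eK _] := epsK.
rewrite -[iota](epull_id (iota : elt unit_ob)) -eK -epull_comp uni0.
by apply: eltP => i; rewrite epullE comp0m.
Qed.

Lemma deligne_unit : univ (uni P).
Proof.
have [xi [xi' xiK]] := X0_iso; have [eta [eta' etaK]] := Y0_iso.
have [u0 [k k0 uE]] := uni_entry xiK etaK; have [eta'eta etaeta'] := etaK.
apply: (univ_intro deligne_laws) => y p.
  have [p0 [g gE]] := entry_unit p xiK.
  exists (k^-1 *: (eta' ∘ g)); apply: eltP => i; rewrite epullE.
  have [->|ii0] := eqVneq i i0; last by rewrite u0 // p0 // comp0m.
  rewrite uE gE compmZl -bmapM compm1 compmZr bmapZr scalerA divff // scale1r.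
  by rewrite compmA etaeta' comp1m.
move=> p0; have := epullE (bmap bx (idm unit_ob) p) (uni P : elt _) i0.
rewrite -[epull _ _]/(pull P (idm unit_ob) p (uni P)) p0 uE compmZl -bmapM compm1.
move/esym/eqP; rewrite scaler_eq0 (negbTE k0) /= => /eqP /bx_eq0[xi0|ep0].
  case: (X_simple i0) => + _; case; have [_ <-] := xiK; by rewrite xi0 comp0m.
by rewrite -[p]comp1m -eta'eta -compmA ep0 compm0.
Qed.

Lemma deligne_one x (p : P x unit_ob) :
  exists! t : mor x unit_ob, pull P t (idm unit_ob) (uni P) = p.
Proof.
have [xi [xi' xiK]] := X0_iso; have [eta [eta' etaK]] := Y0_iso.
have [u0 [k k0 uE]] := uni_entry xiK etaK; have [xi'xi xixi'] := xiK.
have [p0 [f fE]] := entry_one p etaK.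
exists (k^-1 *: (xi' ∘ f)); split=> [|t tp].
  apply: eltP => i; rewrite epullE.
  have [->|ii0] := eqVneq i i0; last by rewrite u0 // p0 // comp0m.
  rewrite uE fE compmZl -bmapM compm1 compmZr bmapZl scalerA divff // scale1r.
  by rewrite compmA xixi' comp1m.
have := epullE (bmap bx t (idm unit_ob)) (uni P : elt _) i0.
rewrite -[epull _ _]/(pull P t (idm unit_ob) (uni P)) tp uE fE compmZl -bmapM compm1.
rewrite -bmapZl => /eqP; rewrite -subr_eq0 -scaleN1r addrC -bmap_linl => /eqP /bx_eq0[|eta0].
  rewrite scaleN1r addrC => /eqP; rewrite subr_eq0 => /eqP ->.
  by rewrite compmZr scalerA mulVf // scale1r compmA xi'xi comp1m.
case: (Y_nonzero (i := i0)); have [_ <-] := etaK; by rewrite eta0 comp0m.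
Qed.

Lemma deligne_supp x : simple x -> forall y (p : P x y), p <> 0 ->
  exists i, isomorphic x (X i).
Proof.
move=> xs y p p0; apply: contrapT => noi; apply: p0; apply: eltP => i.
by apply: contrapT => /bx_hom[f /(hom_X xs)]; apply: contra_not noi; exists i.
Qed.

(** The X_i being distinct simple objects, an element over X_i has only the component [i], and
    Kunneth gives P(X_i, y) = Hom(y, Y_i)^n with n = dim End(X_i). *)
Lemma deligne_rep i : exists n (s : V) (c : P (X i) s),
  [/\ (0 < n)%N, is_dsum (fun _ : 'I_n => Y i) s & univ c].
Proof.
have [n [b [c [bc bxP]]]] := kun (X i) (X i).
have [s sY] := abelian_dsum V_ab (fun _ : 'I_n => Y i).
have [j [q [qj qj0 jq]]] := sY.
pose h : mor (bx (X i) s) (bx (X i) (Y i)) := \sum_k bmap bx (b k) (q k).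
have off x (p : P (X i) x) l : l != i -> (p : elt _)⟨l⟩ = 0.
  move=> li; apply: contrapT => /bx_hom[f /(hom_X (X_simple i)) /X_distinct il].
  by rewrite il eqxx in li.
have onE y (g : mor y s) : (epull (bmap bx (idm (X i)) g)
    (epull h (einc i : elt (a i))))⟨i⟩ = \sum_k bmap bx (b k) (q k ∘ g).
  rewrite !epullE einc_id comp1m compm_suml; apply: eq_bigr => k _.
  by rewrite -bmapM compm1.
exists n, s, (epull h (einc i : elt (a i))); split=> //.
  (* For [n = 0] the identity of the simple object [X i] would be an empty combination. *)
  case: n => [|//] in b c bc bxP s sY j q qj qj0 jq h onE *.
  have [_ _ bE] := bc; case: (X_simple i) => + _; case.
  by rewrite [idm _]bE big_ord0.
apply: (univ_intro deligne_laws) => y p.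
  have [ex _] := bxP y (Y i); have [g gE] := ex (p : elt _)⟨i⟩.
  exists (\sum_k j k ∘ g k); apply: eltP => l.
  have [->|li] := eqVneq l i; last by rewrite !off.
  rewrite onE gE; apply: eq_bigr => k _; congr (bmap bx _ _).
  rewrite compm_sumr (bigD1 k) //= big1 ?addr0 ?compmA ?qj ?comp1m // => k' k'k.
  by rewrite compmA qj0 ?comp0m.
move=> p0; have := onE y p.
rewrite -[epull _ _]/(pull P (idm (X i)) p (epull h (einc i : elt (a i)))) p0.
move/esym; have [_ inj] := bxP y (Y i) => /inj qp0.
by apply: (dsum_eqr jq) => k; rewrite qp0 compm0.
Qed.

(** The componentwise evaluation and coevaluation. Their zigzag is moved across [m] and [eps] and
    becomes the product of the zigzags in U and in V. *)
Lemma bx_zig j : run (a j) ∘ ((idm (a j)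
    ⊗m (epsV ∘ (bmap bx (ev (X j)) (ev (Y j)) ∘ m (dual (X j)) (X j) (dual (Y j)) (Y j))))
  ∘ (assocV (a j) (bx (dual (X j)) (dual (Y j))) (a j)
  ∘ (((mV (X j) (dual (X j)) (Y j) (dual (Y j)) ∘ (bmap bx (coev (X j)) (coev (Y j)) ∘ eps))
      ⊗m idm (a j)) ∘ lunV (a j)))) = idm (a j).
Proof.
have [zX _] := ribbon_dual U_rib (X j); have [zY _] := ribbon_dual V_rib (Y j).
set x := X j in zX *; set y := Y j in zY *.
rewrite !(tcomp1m, tcompm1) -?compmA.
have runE : run (bx x y) ∘ (idm (bx x y) ⊗m epsV)
    = bmap bx (run x) (run y) ∘ m x unit_ob y unit_ob.
  apply: (move_r (inverses_sym (mK _ _ _ _))).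
  by rewrite -compmA mV_run.
have assE : m x (dual x ⊗ x) y (dual y ⊗ y) ∘ ((idm (bx x y) ⊗m m (dual x) x (dual y) y)
    ∘ (assocV (bx x y) (bx (dual x) (dual y)) (bx x y)
    ∘ (mV x (dual x) y (dual y) ⊗m idm (bx x y))))
    = bmap bx (assocV x (dual x) x) (assocV y (dual y) y) ∘ m (x ⊗ dual x) x (y ⊗ dual y) y.
  have k1 := bmap_inverses (@tens _ C) (mK x (dual x) y (dual y)) (inverses_id (bx x y)).
  have k2 := bmap_inverses bx (mo_assK U_mon x (dual x) x) (mo_assK V_mon y (dual y) y).
  have := cw_ass bx_cw x (dual x) x y (dual y) y.
  rewrite -!compmA => /(move_l k2) E; rewrite (compK E) -!compmA.
  have [_ aK] := mo_assK C_mon (bx x y) (bx (dual x) (dual y)) (bx x y).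
  by have [_ k1r] := k1; rewrite (compK aK) comp1m k1r compm1.
have lunE : m unit_ob x unit_ob y ∘ ((eps ⊗m idm (bx x y)) ∘ lunV (bx x y))
    = bmap bx (lunV x) (lunV y).
  have k := bmap_inverses bx (mo_lunK U_mon x) (mo_lunK V_mon y).
  rewrite -[RHS]compm1; apply: (move_l k).
  by rewrite !compmA (cw_lun bx_cw); case: (mo_lunK C_mon (bx x y)).
rewrite (compmA (run _)) runE -?compmA -{1}bmap1 (compmA (m x unit_ob y unit_ob)).
rewrite (cw_m_nat bx_cw) -?compmA.
rewrite (comp4K assE) -{1}(bmap1 bx x y) -?compmA.
rewrite (compmA (m (x ⊗ dual x) x _ _)) (cw_m_nat bx_cw) -?compmA lunE -!bmapM.
by rewrite -?compmA zX zY bmap1.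
Qed.

Lemma X_pairing i j (t : mor (X i ⊗ X j) (X i0)) : t <> 0 ->
  isomorphic (X i) (dual (X j)).
Proof.
move=> t0; have [xi [xi' [xi'xi xixi']]] := X0_iso.
have [g gE] := rmate_ex U_mon (ribbon_dual U_rib (X j)) (xi' ∘ t).
have dXj := dual_simple U_rib U_ss (X_simple j).
exists g; case: (simple_schur U_ab (X_simple i) dXj g) => // g0; case: t0.
by rewrite -[t]comp1m -xixi' -compmA -gE g0 bmap0l !compm0.
Qed.

Lemma form_tens i j : (mu : dshom _ _) (i, j) i0 <> 0 ->
  exists t : mor (X i ⊗ X j) (X i0), t <> 0.
Proof.
move=> f0; have [_ mmV] := inverses_sym (mK (X i) (X j) (Y i) (Y j)).
apply: (@bx_hom _ _ (Y i ⊗ Y j) (Y i0) ((mu : dshom _ _) (i, j) i0 ∘ mV _ _ _ _)).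
by move=> f0'; apply: f0; rewrite -[LHS]compm1 -mmV compmA f0' comp0m.
Qed.

(** A nonzero entry makes X_i isomorphic to the dual of X_j, so [j] determines [i] by
    distinctness. *)
Lemma form_uniql i i' j :
  (mu : dshom _ _) (i, j) i0 <> 0 -> (mu : dshom _ _) (i', j) i0 <> 0 -> i = i'.
Proof.
move=> /form_tens[t t0] /form_tens[t' t'0]; apply: X_distinct.
exact: isomorphic_trans (X_pairing t0) (isomorphic_sym (X_pairing t'0)).
Qed.

Lemma form_uniqr i j j' :
  (mu : dshom _ _) (i, j) i0 <> 0 -> (mu : dshom _ _) (i, j') i0 <> 0 -> j = j'.
Proof.
have flip k l (t : mor (X k ⊗ X l) (X i0)) : t <> 0 -> t ∘ braid (X l) (X k) <> 0.
  move=> t0 tb0; apply: t0; have [_ bK] := bt_brdK U_br (X l) (X k).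
  by rewrite -[t]compm1 -bK compmA tb0 comp0m.
move=> /form_tens[t /flip t0] /form_tens[t' /flip t'0]; apply: X_distinct.
exact: isomorphic_trans (X_pairing t0) (isomorphic_sym (X_pairing t'0)).
Qed.

(** A simple summand of [w] on which [h] is nonzero has a nonzero map to [X i0], hence is isomorphic
    to the unit and is reached by some [t]. *)
Lemma detect_unit w v y (h : mor (bx w v) (bx (X i0) y)) :
  (forall t : mor unit_ob w, h ∘ bmap bx t (idm v) = 0) -> h = 0.
Proof.
move=> h0; have [n [S [Ss [j [q [_ _ jq]]]]]] := U_ss w.
have split w1 w2 w3 (f : mor w2 w3) (g : mor w1 w2) :
    bmap bx (f ∘ g) (idm v) = bmap bx f (idm v) ∘ bmap bx g (idm v).
  by rewrite -bmapM compm1.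
rewrite -[h]compm1 -bmap1 -jq bmap_suml compm_sumr big1 // => k _.
rewrite split compmA; suff -> : h ∘ bmap bx (j k) (idm v) = 0 by rewrite comp0m.
apply: contrapT => hk0; have [f f0] := bx_hom hk0.
have [//|[g [gf _]]] := simple_schur U_ab (Ss k) (X_simple i0) f.
have [xi [xi' [_ xixi']]] := X0_iso; apply: hk0.
have := h0 (j k ∘ (g ∘ xi)); rewrite split compmA => hg.
rewrite -[LHS]compm1 -bmap1 -gf -[f]comp1m -xixi' -(compmA xi) (compmA g) split.
by rewrite compmA hg comp0m.
Qed.

(** [null_eq0] tests the entry [i0] of whole products, the hypothesis only their restrictions along
    maps from the unit; [detect_unit] shows that these see the entry [i0] completely. *)
Lemma deligne_nondeg x y (p : P x y) :
  (forall j (t : mor unit_ob (x ⊗ X j)), pull P t (idm (y ⊗ Y j))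
     (lmul P p (einc j : P (X j) (Y j))) = 0) -> p = 0.
Proof.
move=> p0; apply: (null_eq0 C_btc A_alg A_simple (@bx_neq0 i0) form_uniql form_uniqr bx_zig).
move=> j; have [_ mVm] := inverses_sym (mK x (X j) y (Y j)).
rewrite -[LHS]compm1 -mVm compmA [X in X ∘ _](_ : _ = 0) ?comp0m //.
apply: detect_unit => t; have := p0 j t; rewrite /= epull_comp => /(congr1 (fun q : elt _ => q⟨i0⟩)).
by rewrite epullE compmA.
Qed.

Lemma deligne_reversed_equivalence :
  exists (UA_sub : ribbon_subcategory (sums_of X)) (VA_sub : ribbon_subcategory (sums_of Y)),
    let UA := sub_braided UA_sub in
    let VA := sub_braided VA_sub in
    [/\ abelian VA, semisimple VA,
        forall i, exists Yi : VA, sval Yi = Y i /\ simple Yi,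
        forall i j, isomorphic (Y i) (Y j) -> i = j
      & forall y : VA, simple y -> exists i, isomorphic (sval y) (Y i)] /\
    exists tau : functor UA VA,
      braid_reversed_equivalence tau /\
      forall i, exists Xi : UA,
        sval Xi = X i /\ isomorphic (sval (tau Xi)) (dual (Y i)).
Proof.
have X1 : sums_of X unit_ob by rewrite -X_unit; exact: sums_of1.
exact: (@lax_reversed_equivalence F U V P U_rib V_rib U_ss deligne_laws I X Y
  (fun i => einc i : P (X i) (Y i)) deligne_unit deligne_one deligne_nondeg
  X_simple X_distinct Y_nonzero deligne_supp deligne_rep X1).
Qed.

End Assembly.

Theorem theorem2 (F : fieldType) (U V : ribbon F) (C : balanced F)
    (bx : bifunctor U V C) (I : choiceType) (i0 : I)
    (X : I -> U) (Y : I -> V) (odd_part : I -> bool)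
    (A := ds_sum (fun i => bx (X i) (Y i)))
    (mu : mor (A ⊗ A) A) (iota : mor unit_ob A)
    (U_ribbon : ribbon_category U) (U_semisimple : semisimple U)
    (V_ribbon : ribbon_category V)
    (C_deligne : deligne_product bx)
    (X_simple : forall i, simple (X i))
    (X_distinct : forall i j, isomorphic (X i) (X j) -> i = j)
    (X_unit : X i0 = unit_ob)
    (Y_nonzero : forall i, idm (Y i) <> 0)
    (Y_unit : Y i0 = unit_ob)
    (Y_unit_simple : simple (Y i0))
    (A_algebra : comm_algebra mu iota)
    (A_simple : simple_algebra mu iota)
    (X_dim : forall i, has_dim (mor (X i0) (X i)) (i == i0))
    (Y_dim : forall i, has_dim (mor (Y i0) (Y i)) (i == i0))
    (i0_even : odd_part i0 = false)
    (A_twist : forall i,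
       twist A ∘ ds_incl (fun j => bx (X j) (Y j)) i
       = (-1) ^+ odd_part i *: ds_incl (fun j => bx (X j) (Y j)) i) :
  exists (UA_sub : ribbon_subcategory (sums_of X))
         (VA_sub : ribbon_subcategory (sums_of Y)),
    let UA := sub_braided UA_sub in
    let VA := sub_braided VA_sub in
    [/\ abelian VA, semisimple VA,
        forall i, exists Yi : VA, sval Yi = Y i /\ simple Yi,
        forall i j, isomorphic (Y i) (Y j) -> i = j
      & forall y : VA, simple y -> exists i, isomorphic (sval y) (Y i)] /\
    exists tau : functor UA VA,
      braid_reversed_equivalence tau /\
      forall i, exists Xi : UA,
        sval Xi = X i /\ isomorphic (sval (tau Xi)) (dual (Y i)).
Proof.
have [C_bal bx_univ [m [eps bx_cw]]] := C_deligne.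
have [mV mVP] : exists mV : forall x x' y y', mor (bx (x ⊗ x') (y ⊗ y')) (bx x y ⊗ bx x' y'),
    forall x x' y y', inverses (m x x' y y') (mV x x' y y').
  have [f fP] := dep_choice (fun s : (U * U) * (V * V) =>
    cw_m_iso bx_cw s.1.1 s.1.2 s.2.1 s.2.2).
  exists (fun x x' y y' => f ((x, x'), (y, y'))) => x x' y y'.
  exact: (fP ((x, x'), (y, y'))).
have [epsV epsK] := cw_e_iso bx_cw.
exact: (deligne_reversed_equivalence U_ribbon U_semisimple V_ribbon C_bal bx_univ bx_cw mVP epsK
  X_simple X_distinct X_unit Y_nonzero Y_unit A_algebra A_simple X_dim Y_dim).
Qed.
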